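(* Let $N\ge 3$ be an integer, let $1<p<\frac{N+2}{N-2}$, and let $\Omega=\{x\in\mathbb{R}^N:\|x\|<1\}$ be the unit ball. Let $K\in C^2[0,1]$ with $K(r)>0$ for all $r\in[0,1]$, and set $V(r)=rK'(r)/K(r)$. Assume that $$[V(r)-p(N-2)-N+4]\,[V(r)-p(N-2)+N]-2rV'(r)<0\qquad\text{for all } r\in[0,1].$$ Then the problem $$\Delta u+K(\|x\|)|u|^{p-1}u=0 \ \text{ in } \Omega,\qquad u=0\ \text{ on }\partial\Omega,$$ has infinitely many nonradial solutions.
   Context: $\|\cdot\|$ is the Euclidean norm on $\mathbb{R}^N$. Solutions are real-valued functions $u\in H_0^1(\Omega)$ solving the Dirichlet problem (critical points of $J(u)=\int_\Omega\left(\frac12\|\nabla u\|^2-\frac1{p+1}K(\|x\|)|u|^{p+1}\right)dx$ on $H^1_0(\Omega)$). A solution is radial if $u(x)$ depends only on $\|x\|$, and nonradial otherwise. *)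

(* Defs.v *)
From HB Require Import structures.
From mathcomp Require Import all_boot all_order all_algebra.
From mathcomp Require Import all_classical all_reals all_analysis.

Set Implicit Arguments.
Unset Strict Implicit.
Unset Printing Implicit Defensive.

Import Order.TTheory GRing.Theory Num.Theory.
Import numFieldNormedType.Exports.

Local Open Scope classical_set_scope.
Local Open Scope ring_scope.

(* The Borel sigma-algebra of R^n, generated by the n coordinate maps. *)
Definition rV_display : measure_display -> measure_display.
Proof. exact. Qed.

Section measurable_rV.
Context {d} {T : measurableType d} {n : nat}.

Let coord : 'I_n -> 'rV[T]_n -> T := fun i x => x ord0 i.

Let rV_set0 : g_sigma_preimage coord set0.
Proof. exact: sigma_algebra0. Qed.

Let rV_setC A : g_sigma_preimage coord A -> g_sigma_preimage coord (~` A).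
Proof. exact: sigma_algebraC. Qed.

Let rV_bigcup (F : _^nat) : (forall i, g_sigma_preimage coord (F i)) ->
  g_sigma_preimage coord (\bigcup_i (F i)).
Proof. exact: sigma_algebra_bigcup. Qed.

HB.instance Definition _ := @isMeasurable.Build (rV_display d)
  'rV[T]_n (g_sigma_preimage coord) rV_set0 rV_setC rV_bigcup.

End measurable_rV.

Lemma measurable_rV_coord d (T : measurableType d) n (i : 'I_n) :
  measurable_fun setT (fun x : 'rV[T]_n => x ord0 i).
Proof.
move=> _ Y mY; rewrite setTI; apply: sub_sigma_algebra => /=.
rewrite -bigcup_seq/=; exists i => /=; first by rewrite mem_index_enum.
by exists Y => //; rewrite setTI.
Qed.

Lemma measurable_rVP d (T : measurableType d) d' (U : measurableType d') n
    (f : U -> 'rV[T]_n) :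
  (forall i, measurable_fun setT (fun y => f y ord0 i)) ->
  measurable_fun setT f.
Proof.
move=> mf.
suff H : g_sigma_preimage (fun i (x : 'rV[T]_n) => x ord0 i) `<=`
    [set A | measurable (f @^-1` A)].
  by move=> _ A mA; rewrite setTI; exact: H.
apply: smallest_sub.
  split => /=.
  - by rewrite preimage_set0; exact: measurable0.
  - by move=> A mA; rewrite setTD preimage_setC; exact: measurableC.
  - move=> F mF; rewrite preimage_bigcup; exact: bigcupT_measurable.
rewrite -bigcup_seq => A [i _ [B mB <-]] /=.
by rewrite setTI; have := mf i measurableT B mB; rewrite setTI.
Qed.

Section lebesgue_rV.
Variable R : realType.

Definition rV_cons n (xy : 'rV[R]_n * measurableTypeR R) : 'rV[R]_n.+1 :=
  \row_i (if unlift ord0 i is Some j then xy.1 ord0 j else xy.2).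

Lemma measurable_rV_cons n : measurable_fun setT (@rV_cons n).
Proof.
apply: measurable_rVP => i; under eq_fun do rewrite mxE.
case: unliftP => [j _|_]; last exact: measurable_snd.
apply: (@measurableT_comp _ _ _ _ _ _ (fun x : 'rV[R]_n => x ord0 j)).
  exact: measurable_rV_coord.
exact: measurable_fst.
Qed.

Section succ.
Variables (n : nat) (m : {measure set 'rV[R]_n -> \bar R}).

Definition lebesgue_rV_succ : set 'rV[R]_n.+1 -> \bar R :=
  pushforward (m \x lebesgue_measure)%E (@rV_cons n).

Let mpre (A : set 'rV[R]_n.+1) : measurable A -> measurable (@rV_cons n @^-1` A).
Proof. by move=> mA; rewrite -[X in measurable X]setTI; exact: measurable_rV_cons. Qed.

Let succ0 : lebesgue_rV_succ set0 = 0%E.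
Proof. by rewrite /lebesgue_rV_succ /pushforward preimage_set0 measure0. Qed.

Let succ_ge0 A : (0 <= lebesgue_rV_succ A)%E.
Proof. by rewrite /lebesgue_rV_succ /pushforward; exact: measure_ge0. Qed.

Let succ_sigma_additive : semi_sigma_additive lebesgue_rV_succ.
Proof.
move=> F mF tF mUF; rewrite /lebesgue_rV_succ /pushforward preimage_bigcup.
apply: measure_semi_sigma_additive.
- by move=> k; exact: mpre.
- apply/trivIsetP => /= i j _ _ ij; rewrite -preimage_setI.
  by move/trivIsetP : tF => /(_ _ _ _ _ ij) ->//; rewrite preimage_set0.
- by rewrite -preimage_bigcup; exact: mpre.
Qed.

HB.instance Definition _ := isMeasure.Build _ _ _
  lebesgue_rV_succ succ0 succ_ge0 succ_sigma_additive.

End succ.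

Fixpoint lebesgue_rV n : {measure set 'rV[R]_n -> \bar R} :=
  match n with
  | 0 => dirac (0 : 'rV[R]_0)
  | n'.+1 => lebesgue_rV_succ (lebesgue_rV n')
  end.

Lemma lebesgue_rV_box n (A : 'I_n -> set (measurableTypeR R)) :
  (forall i, measurable (A i)) ->
  lebesgue_rV n [set x | forall i, A i (x ord0 i)] =
  (\prod_(i < n) lebesgue_measure (A i))%E.
Proof.
elim: n A => [|n IH] A mA /=.
  rewrite big_ord0 diracE mem_set//= => -[].
  by [].
rewrite big_ord_recl /lebesgue_rV_succ /pushforward.
rewrite (_ : _ @^-1` _ =
  [set x : 'rV[R]_n | forall j, A (lift ord0 j) (x ord0 j)] `*` A ord0).
  rewrite product_measure1E//; first by rewrite muleC; congr (_ * _)%E; apply: IH.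
  rewrite (_ : [set _ | _] = \bigcap_(j in [set: 'I_n])
      ((fun x : 'rV[R]_n => x ord0 j) @^-1` A (lift ord0 j))).
    apply: fin_bigcap_measurable; [exact: finite_finset|move=> j _]; rewrite -[X in measurable X]setTI.
    by apply: measurable_rV_coord => //; exact: mA.
  by apply/seteqP; split => x /= h j => [_|]; [exact: h|exact: (h j I)].
apply/seteqP; split => -[x y] /=.
  move=> h; split => [j|].
    by have := h (lift ord0 j); rewrite mxE liftK.
  by have := h ord0; rewrite mxE unlift_none.
move=> [hx hy] i; rewrite mxE.
by case: unliftP => [j ->|->] /=.
Qed.

End lebesgue_rV.

(* The Euclidean norm; the norm of the library on 'rV[R]_n is the sup norm. *)
Definition enorm (R : realType) n (x : 'rV[R]_n) : R :=
  Num.sqrt (\sum_(i < n) x ord0 i ^+ 2).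

Definition unit_ball (R : realType) n : set 'rV[R]_n := [set x | enorm x < 1].

Section sobolev.
Variables (R : realType) (n : nat).
Implicit Types (Om : set 'rV[R]_n) (u v phi : 'rV[R]_n -> R).

Local Notation mu := (lebesgue_rV R n).

Definition partial (i : 'I_n) u : 'rV[R]_n -> R := 'D_(delta_mx ord0 i) u.

(* C^infinity on R^n: all iterated partial derivatives are differentiable. *)
Definition smooth u :=
  forall (s : seq 'I_n) x, differentiable (foldr partial u s) x.

Definition test_function Om phi :=
  smooth phi /\
  exists2 C, compact C /\ C `<=` Om & forall x, ~ C x -> phi x = 0.

Definition square_integrable Om u :=
  measurable_fun Om u /\ mu.-integrable Om (fun x => (u x ^+ 2)%:E).

Definition is_weak_gradient Om u (g : 'rV[R]_n -> 'rV[R]_n) :=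
  forall i : 'I_n,
    square_integrable Om (fun x => g x ord0 i) /\
    forall phi, test_function Om phi ->
      \int[mu]_(x in Om) (u x * partial i phi x) =
      - \int[mu]_(x in Om) (g x ord0 i * phi x).

Definition H1 Om u :=
  square_integrable Om u /\ exists g, is_weak_gradient Om u g.

(* The weak gradient of u in H1, unique up to a null set. *)
Definition wgrad Om u : 'rV[R]_n -> 'rV[R]_n :=
  get [set g | is_weak_gradient Om u g].

Definition H1_norm Om u : R :=
  Num.sqrt (\int[mu]_(x in Om) (u x ^+ 2 + enorm (wgrad Om u x) ^+ 2)).

Definition H10 Om u :=
  H1 Om u /\
  forall e : R, 0 < e ->
    exists2 phi, test_function Om phi & H1_norm Om (fun x => u x - phi x) < e.

Definition energy Om (K : R -> R) (p : R) u : R :=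
  \int[mu]_(x in Om)
    (2^-1 * enorm (wgrad Om u x) ^+ 2 -
     (p + 1)^-1 * K (enorm x) * `|u x| `^ (p + 1)).

(* The Frechet derivative on H^1_0 of the functional J vanishes at u. *)
Definition critical_point Om (J : ('rV[R]_n -> R) -> R) u :=
  forall e : R, 0 < e -> exists2 d : R, 0 < d &
    forall v, H10 Om v -> H1_norm Om v < d ->
      `|J (fun x => u x + v x) - J u| <= e * H1_norm Om v.

(* The equation Delta u + K(|x|)|u|^(p-1) u = 0 in the sense of distributions on Om, the
   first integration by parts being carried out. *)
Definition weak_equation Om (K : R -> R) (p : R) u :=
  forall phi, test_function Om phi ->
    \int[mu]_(x in Om)
      (K (enorm x) * `|u x| `^ (p - 1) * u x * phi x -
       \sum_(i < n) wgrad Om u x ord0 i * partial i phi x) = 0.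

(* For u in H^1_0 and p subcritical, the last two conditions are equivalent. *)
Definition dirichlet_solution Om (K : R -> R) (p : R) u :=
  [/\ H10 Om u, weak_equation Om K p u & critical_point Om (energy Om K p) u].

(* Elements of H^1_0 are functions up to almost everywhere equality. *)
Definition radial Om u :=
  exists f : R -> R, u = f \o @enorm R n %[ae mu in Om].

End sobolev.

(* Derivatives on A; one-sided at the end points when A is an interval. *)
Section derive_within.
Variables (R : realType) (A : set R).
Implicit Types (f : R -> R) (x : R).

Definition derivable_within f x :=
  cvg ((fun y => (f y - f x) / (y - x)) @ within A x^').

Definition derive_within f x : R :=
  lim ((fun y => (f y - f x) / (y - x)) @ within A x^').

Definition C2_on f :=
  [/\ {in A, forall x, derivable_within f x},
      {in A, forall x, derivable_within (derive_within f) x} &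
      {within A, continuous (derive_within (derive_within f))}].

End derive_within.

(* Main.v *)
(* For k >= 0 let T be the rotation by pi / 2^(k+1) in the plane of the first two coordinates.
   Maximize the integral of K |phi|^(p+1) over the test functions with phi o T = - phi and Dirichlet
   integral at most 1. As p is subcritical, Rellich's theorem and uniform convexity give a maximizer
   u in H^1_0. Since the functional is invariant under T, averaging an arbitrary test function over
   the finite cyclic group generated by T shows that the Euler-Lagrange equation of u holds against
   all test functions, and by homogeneity a multiple of u solves the problem. A radial function with
   u o T = - u vanishes, so u is nonradial. For k < l the k-th rotation is an even power of the l-th
   one, so a function antisymmetric under both vanishes: the solutions are pairwise distinct.
   The Sobolev and Rellich theorems are proved for test functions only, by comparing averages on
   dyadic cubes. *)

(* Subcriticality enters as positivity of b = N + q - N q / 2, where q = p + 1: on a cube of side l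
   the q-th power of the oscillation is at most a multiple of l^b times the power q / 2 of the
   Dirichlet energy. A positive b makes the sum over dyadic scales converge, and it makes small
   scales negligible, which gives compactness. Weak convergence is avoided: along an ultrafilter the
   near-maximizers are Cauchy in L^q, and since the midpoint of two of them competes for the same
   supremum, they are Cauchy in the Dirichlet norm as well. The angles have two further virtues. The
   rotation has even order, whereas odd order would force an antisymmetric function to vanish. Its
   cosine is nonnegative, so it factors into three shears, and for a measure built as an iterated
   product a shear is a translation in one factor. The nonlinearity is controlled by a first-order
   expansion with quadratic remainder, which serves both for the Euler-Lagrange equation and for the
   Frechet derivative. *)
Require Import Defs.
From HB Require Import structures.
From mathcomp Require Import all_boot all_order all_algebra.
From mathcomp Require Import all_classical all_reals all_analysis.
From mathcomp Require Import fingroup perm measurable_realfun ring lra.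

Set Implicit Arguments.
Unset Strict Implicit.
Unset Printing Implicit Defensive.

Import Order.TTheory GRing.Theory Num.Theory.
Import numFieldNormedType.Exports.

Local Open Scope classical_set_scope.
Local Open Scope ring_scope.

(** * Rotations preserve Lebesgue measure *)

Section MeasureRV.
Variable R : realType.
Local Notation leb := (@lebesgue_measure R).
Local Notation RR := (measurableTypeR R).

(** The measure structure is applied explicitly because it depends on the proof [mf], which the bare
    pushforward does not carry. *)
Definition pushm d d' (T1 : measurableType d) (T2 : measurableType d')
  (m : {measure set T1 -> \bar R}) (f : T1 -> T2) (mf : measurable_fun setT f) :
  {measure set T2 -> \bar R} := @measure_function_pushforward__canonical__measure_function_Measure _ _ _ _ _ m f mf.

(** The pushforward by a shift has the right values on half-open intervals, and these determine
    Lebesgue measure. *)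
Lemma leb_shift (c : R) (A : set RR) : measurable A ->
  leb ((fun y : RR => (y + c : RR)) @^-1` A) = leb A.
Proof.
move=> mA.
have mf : measurable_fun setT (fun y : RR => (y + c : RR)).
  exact: measurable_funD.
symmetry.
apply: (lebesgue_measure_unique (mu := pushm leb mf)) => // X.
rewrite /ocitv /= => -[[a b] _ <-].
rewrite /pushforward /=.
rewrite [X in _ = leb X](_ : _ = `]a - c, b - c]%classic); last first.
  by apply/seteqP; split => x /=; rewrite !in_itv/= ltrBlDr lerBrDr.
rewrite !lebesgue_measure_itv /= !lte_fin ltrD2r.
case: ifPn => // _; rewrite -!EFinB; congr EFin; ring.
Qed.

Definition box n (A : 'I_n -> set RR) : set 'rV[R]_n :=
  [set x | forall i, A i (x ord0 i)].

Lemma measurable_box n (A : 'I_n -> set RR) :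
  (forall i, measurable (A i)) -> measurable (box A).
Proof.
move=> mA; rewrite (_ : box A = \bigcap_(j in [set: 'I_n])
      ((fun x : 'rV[R]_n => x ord0 j) @^-1` A j)).
  apply: fin_bigcap_measurable; [exact: finite_finset|move=> j _].
  rewrite -[X in measurable X]setTI.
  by apply: measurable_rV_coord => //; exact: mA.
by apply/seteqP; split => x /= h j => [_|]; [exact: h|exact: (h j I)].
Qed.

(** Boxes form a pi-system generating the Borel sets, and the cubes [g k] of finite measure exhaust
    the space. *)
Lemma box_unique n (nu : {measure set 'rV[R]_n -> \bar R}) :
  (forall A : 'I_n -> set RR, (forall i, measurable (A i)) ->
    nu (box A) = (\prod_(i < n) leb (A i))%E) ->
  forall B, measurable B -> nu B = lebesgue_rV R n B.
Proof.
move=> Hnu.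
pose G : set (set 'rV[R]_n) := [set box A | A in [set A | forall i, measurable (A i)]].
have EG : @measurable _ 'rV[R]_n = <<s G >>.
  apply/seteqP; split.
    apply: smallest_sub; first exact: smallest_sigma_algebra.
    rewrite -bigcup_seq => A [i _ [B mB <-]] /=.
    apply: sub_sigma_algebra; exists (fun j => if j == i then B else setT).
      by move=> j /=; case: ifP.
    rewrite setTI; apply/seteqP; split => x /=.
      by move=> /(_ i); rewrite eqxx.
    by move=> Bx j /=; case: eqP => // ->.
  apply: smallest_sub; first exact: sigma_algebra_measurable.
  by move=> _ [A mA <-]; exact: measurable_box.
pose g (k : nat) : set 'rV[R]_n := box (fun _ => `]-(k%:R), k%:R]%classic).
apply: (measure_unique G g) => //.
- move=> _ _ [A mA <-] [B mB <-]; exists (fun i => A i `&` B i).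
    by move=> i; exact: measurableI.
  apply/seteqP; split => x /=.
    by move=> h; split => i; have [] := h i.
  by move=> [h1 h2] i; split.
- by move=> k; exists (fun _ => `]-(k%:R), k%:R]%classic).
- apply/seteqP; split => // x _.
  have [k hk] : exists k : nat, forall i, `|x ord0 i| < k%:R.
    exists (\max_i (Num.truncn `|x ord0 i|).+1)%N => i.
    apply: (lt_le_trans (truncnS_gt _)).
    by rewrite ler_nat; exact: (leq_bigmax (F := fun i => (Num.truncn `|x ord0 i|).+1)).
  exists k => // i; rewrite /= in_itv/=.
  by move: (hk i); rewrite ltr_norml => /andP[-> /ltW].
- move=> _ [A mA <-]; rewrite Hnu//.
  by symmetry; exact: lebesgue_rV_box.
- move=> k; rewrite Hnu //.
  under eq_bigr => i _ do rewrite lebesgue_measure_itv.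
  rewrite ltey_eq; apply/orP; left.
  elim/big_ind : _ => [//|x y|i _]; first exact: fin_numM.
  by case: ifP.
Qed.

Definition mpres n (f : 'rV[R]_n -> 'rV[R]_n) :=
  measurable_fun setT f /\
  forall B, measurable B -> lebesgue_rV R n (f @^-1` B) = lebesgue_rV R n B.

Lemma mpres_comp n (f g : 'rV[R]_n -> 'rV[R]_n) :
  mpres f -> mpres g -> mpres (f \o g).
Proof.
move=> [mf Hf] [mg Hg]; split; first exact: measurableT_comp.
move=> B mB; rewrite comp_preimage Hg ?Hf//.
by rewrite -[X in measurable X]setTI; exact: mf.
Qed.

Lemma mpres_box n (f : 'rV[R]_n -> 'rV[R]_n) : measurable_fun setT f ->
  (forall A : 'I_n -> set RR, (forall i, measurable (A i)) ->
    lebesgue_rV R n (f @^-1` box A) = (\prod_(i < n) leb (A i))%E) -> mpres f.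
Proof.
by move=> mf H; split=> // B; apply: (box_unique (nu := pushm (lebesgue_rV R n) mf)).
Qed.

Lemma mpres_shift n (w : 'rV[R]_n) : mpres (fun x => x + w).
Proof.
apply: mpres_box => [|A mA].
  apply: measurable_rVP => i; under eq_fun do rewrite mxE.
  by apply: measurable_funD => //; exact: measurable_rV_coord.
rewrite (_ : _ @^-1` _ =
    box (fun i => (fun y : RR => (y + w ord0 i : RR)) @^-1` A i)); last first.
  by apply/seteqP; split => x /= h i; have := h i; rewrite /= mxE.
rewrite lebesgue_rV_box; first by apply: eq_bigr => i _; exact: leb_shift.
move=> i; rewrite -[X in measurable X]setTI.
have mf : measurable_fun setT (fun y : RR => (y + w ord0 i : RR)).
  exact: measurable_funD.
exact: mf.
Qed.

Lemma mpres_perm n (s : {perm 'I_n}) :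
  mpres (fun x : 'rV[R]_n => \row_i x ord0 (s i)).
Proof.
apply: mpres_box => [|A mA].
  apply: measurable_rVP => i; under eq_fun do rewrite mxE.
  exact: measurable_rV_coord.
rewrite (_ : _ @^-1` _ = box (fun i => A ((s^-1)%g i))); last first.
  apply/seteqP; split => x /= h i.
    by have := h ((s^-1)%g i); rewrite mxE permKV.
  by rewrite mxE; have := h (s i); rewrite permK.
rewrite lebesgue_rV_box; last by move=> i; exact: mA.
by rewrite [RHS](reindex_inj (@perm_inj _ (s^-1)%g)).
Qed.

(** The measure is the product of the one in the last n + 1 coordinates with the line of coordinate
    0. With the other coordinates fixed, the shear is a shift of that line. *)
Lemma mpres_shear0 n (a : R) :
  mpres (fun x : 'rV[R]_n.+2 =>
    \row_i (if i == ord0 then x ord0 ord0 + a * x ord0 (lift ord0 ord0)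
            else x ord0 i)).
Proof.
set f := (X in mpres X).
have mf : measurable_fun setT f.
  apply: measurable_rVP => i; under eq_fun do rewrite mxE.
  case: (i == ord0); last exact: measurable_rV_coord.
  apply: measurable_funD; first exact: measurable_rV_coord.
  by apply: measurable_funM => //; exact: measurable_rV_coord.
split => // B mB; rewrite /= /lebesgue_rV_succ /pushforward /=.
rewrite /product_measure1.
apply: eq_integral => x _ /=.
rewrite -[RHS](@leb_shift (a * x ord0 ord0)).
  congr (lebesgue_measure _); apply/seteqP.
  have E y : f (rV_cons (x, y)) = rV_cons (x, y + a * x ord0 ord0).
    apply/rowP => i; rewrite !mxE /=.
    case: (unliftP ord0 i) => [j ->|->] /=.
      by [].
    by rewrite unlift_none liftK.
  by rewrite /xsection; split => y; rewrite /preimage /mkset => /set_mem /= h; apply/mem_set; move: h; rewrite /= -?E /= ?E.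
apply: measurable_xsection; rewrite -[X in measurable X]setTI.
exact: measurable_rV_cons.
Qed.

(** The previous shear conjugated by the transposition of the first two coordinates. *)
Lemma mpres_shear1 n (a : R) :
  mpres (fun x : 'rV[R]_n.+2 =>
    \row_i (if i == lift ord0 ord0 then x ord0 (lift ord0 ord0) + a * x ord0 ord0
            else x ord0 i)).
Proof.
pose s : {perm 'I_n.+2} := tperm ord0 (lift ord0 ord0).
pose P := fun x : 'rV[R]_n.+2 => \row_i x ord0 (s i).
have := mpres_comp (mpres_perm s) (mpres_comp (mpres_shear0 n a) (mpres_perm s)).
congr mpres; apply/funext => x; apply/rowP => i; rewrite /= !mxE tpermL tpermR tpermK.
rewrite -(inj_eq (@perm_inj _ s) i) tpermR.
by [].
Qed.

Definition rot01 n (c s : R) (x : 'rV[R]_n.+2) : 'rV[R]_n.+2 :=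
  \row_i (if i == ord0 then c * x ord0 ord0 - s * x ord0 (lift ord0 ord0)
          else if i == lift ord0 ord0 then
            s * x ord0 ord0 + c * x ord0 (lift ord0 ord0)
          else x ord0 i).

(* A planar rotation by an angle other than pi is a product of three shears. *)
Lemma mpres_rot01 n (c s : R) : c ^+ 2 + s ^+ 2 = 1 -> c != -1 ->
  mpres (@rot01 n c s).
Proof.
move=> cs c1; have c1' : 1 + c != 0 by apply: contra c1 => /eqP H; apply/eqP; lra.
(* Minus the tangent of half the angle; the outer two shears use [t] and the middle one uses [s]. *)
pose t := - (s / (1 + c)).
have := mpres_comp (mpres_shear0 n t) (mpres_comp (mpres_shear1 n s) (mpres_shear0 n t)).
have ss : s ^+ 2 = (1 - c) * (1 + c) by lra.
congr mpres; apply/funext => x; apply/rowP => i; rewrite /= !mxE /= ?eqxx.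
have l01 : (lift ord0 ord0 == ord0 :> 'I_n.+2) = false by [].
have l10 : (ord0 == lift ord0 ord0 :> 'I_n.+2) = false by [].
rewrite ?l01 ?l10.
have st : s * t = c - 1.
  by rewrite /t mulrN mulrA -expr2 ss -mulrA divff// mulr1 opprB.
have tt : t + t * c = - s.
  by rewrite -[X in X + _]mulr1 -mulrDr /t mulNr -mulrA mulVf// mulr1.
case: ifP => [_|i0].
  set a := x _ _; set b := x _ _.
  have -> : a + t * b + t * (b + s * (a + t * b)) = (1 + s * t) * a + (t + t * (1 + s * t)) * b by ring.
  rewrite st; have -> : 1 + (c - 1) = c by ring.
  by rewrite tt; ring.
case: ifP => _; last by rewrite i0.
set a := x _ (lift _ _); set b := x _ ord0.
have -> : a + s * (b + t * a) = s * b + (1 + s * t) * a by ring.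
by rewrite st; ring.
Qed.

End MeasureRV.

(** * Borel sets, measure-preserving maps, cubes and the unit ball *)

Section RV1.
Variable (R : realType) (n : nat).
Local Notation leb := (@lebesgue_measure R).
Local Notation RR := (measurableTypeR R).
Local Notation mu := (lebesgue_rV R n).
Local Notation rV := 'rV[R]_n.

Lemma ball_rV (x y : rV) e : 0 < e ->
  ball x e y <-> forall i, `|x ord0 i - y ord0 i| < e.
Proof.
move=> e0; split => [[_ h] i|h]; first by have := h ord0 i; rewrite -ball_normE.
by split=> // i j; rewrite ord1 -ball_normE; exact: h.
Qed.

(** An open set is the union of those boxes inside it that have rational centre and half-width 1 /
    (k + 1), and there are countably many of them. *)
Lemma open_measurable_rV (U : set rV) : open U -> measurable U.
Proof.
move=> oU.
pose F (qk : 'rV[rat]_n * nat) : set rV :=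
  box (fun i => `]ratr (qk.1 ord0 i) - qk.2.+1%:R^-1, ratr (qk.1 ord0 i) + qk.2.+1%:R^-1[%classic).
pose G qk := if `[< F qk `<=` U >] then F qk else set0.
have -> : U = \bigcup_qk G qk.
  apply/seteqP; split => x; last first.
    by move=> [qk _]; rewrite /G; case: asboolP => // h /h.
  move=> Ux; have /nbhs_ballP[e /= e0 he] : nbhs x U by exact: open_nbhs_nbhs.
  have [k ke] : exists k, k.+1%:R^-1 < e / 2.
    exists (Num.truncn (e / 2)^-1).
    rewrite invf_plt ?posrE ?divr_gt0//; exact: truncnS_gt.
  have k0 : 0 < k.+1%:R^-1 :> R by rewrite invr_gt0 ltr0n.
  have hq i : exists q : rat, `|x ord0 i - ratr q| < k.+1%:R^-1.
    have [] := @rat_in_itvoo _ (x ord0 i - k.+1%:R^-1) (x ord0 i + k.+1%:R^-1).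
      by rewrite ltrBlDr -addrA ltrDl addr_gt0.
    by move=> q; rewrite in_itv /= => h; exists q; rewrite ltr_distlC.
  have {}hq i := cid (hq i).
  exists (\row_i projT1 (hq i), k) => //.
  have h : F (\row_i projT1 (hq i), k) `<=` U.
    move=> y Fy; apply: he; apply/ball_rV => // i.
    have := Fy i; rewrite /= mxE in_itv /= -ltr_distlC => h1.
    have := projT2 (hq i) => h2.
    apply: (le_lt_trans (ler_distD (ratr (projT1 (hq i))) _ _)).
    by rewrite [e]splitr; apply: ltrD; [exact: lt_trans h2 ke|exact: lt_trans h1 ke].
  rewrite /G; case: asboolP => // _ i.
  by rewrite /= mxE in_itv/= -ltr_distlC distrC; exact: projT2 (hq i).
apply: countable_bigcupT_measurable; first exact: countableP.
move=> qk; rewrite /G; case: asboolP => // _.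
exact: measurable_box.
Qed.

Lemma continuous_measurable_rV (f : rV -> R) : continuous f -> measurable_fun setT f.
Proof.
move=> cf; apply: (measurability _ (RGenOpens.measurableE R)).
move=> _ [_ [a [b ->] <-]]; rewrite setTI; apply: open_measurable_rV.
by move/continuousP : cf; apply; exact: interval_open.
Qed.

Lemma measurable_fun_mpres (T : rV -> rV) D (f : rV -> R) : mpres T ->
  measurable D -> measurable_fun D f -> measurable_fun (T @^-1` D) (f \o T).
Proof.
move=> [mT _] mD mf _ Y mY.
have := mT measurableT _ (mf mD Y mY); rewrite setTI.
by rewrite preimage_setI.
Qed.

Lemma mpres_preimage (T : rV -> rV) D : mpres T -> measurable D -> measurable (T @^-1` D).
Proof. by move=> [mT _] mD; rewrite -[X in measurable X]setTI; exact: mT. Qed.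

Lemma ge0_integral_mpres (T : rV -> rV) D (f : rV -> \bar R) : mpres T ->
  measurable D -> measurable_fun D f -> (forall x, D x -> 0 <= f x)%E ->
  (\int[mu]_(x in T @^-1` D) f (T x) = \int[mu]_(x in D) f x)%E.
Proof.
move=> [mT HT] mD mf f0.
rewrite -(ge0_integral_pushforward mT)//; last by move=> x /set_mem /f0.
symmetry; by apply: (eq_measure_integral (pushm mu mT)) => A mA _; rewrite /= /pushforward HT.
Qed.

Lemma integral_mpres (T : rV -> rV) D (f : rV -> R) : mpres T ->
  measurable D -> measurable_fun D f ->
  (\int[mu]_(x in T @^-1` D) (f (T x))%:E = \int[mu]_(x in D) (f x)%:E)%E.
Proof.
move=> HT mD mf; rewrite integralE [RHS]integralE.
have mf' : measurable_fun D (EFin \o f) by exact/measurable_EFinP.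
rewrite -(ge0_integral_mpres (f := fun x => ((EFin \o f)^\+ x)%E) HT mD); first last.
- by move=> x _; exact: funepos_ge0.
- exact: measurable_funepos.
rewrite -(ge0_integral_mpres (f := fun x => ((EFin \o f)^\- x)%E) HT mD); first last.
- by move=> x _; exact: funeneg_ge0.
- exact: measurable_funeneg.
by congr (_ - _)%E; apply: eq_integral => x _; rewrite ?funeposE ?funenegE.
Qed.

Lemma Rint_mpres (T : rV -> rV) D (f : rV -> R) : mpres T ->
  measurable D -> measurable_fun D f ->
  \int[mu]_(x in T @^-1` D) f (T x) = \int[mu]_(x in D) f x.
Proof. by move=> HT mD mf; rewrite /Rintegral integral_mpres. Qed.

Lemma integrable_mpres (T : rV -> rV) D (f : rV -> R) : mpres T ->
  measurable D -> mu.-integrable D (EFin \o f) ->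
  mu.-integrable (T @^-1` D) (EFin \o (f \o T)).
Proof.
move=> HT mD /integrableP[mf fi]; apply/integrableP; split.
  by apply/measurable_EFinP; apply: measurable_fun_mpres => //; exact/measurable_EFinP.
rewrite (ge0_integral_mpres (f := fun x => `|(f x)%:E|%E) HT mD) //.
exact: measurableT_comp.
Qed.

(** Half open, so that the dyadic children of a cube partition it. *)
Definition cube (a : rV) (l : R) : set rV :=
  box (fun i => `[a ord0 i, a ord0 i + l[%classic).

Lemma measurable_cube a l : measurable (cube a l).
Proof. exact: measurable_box. Qed.

Lemma mu_cube a l : 0 <= l -> mu (cube a l) = (l ^+ n)%:E.
Proof.
move=> l0; rewrite lebesgue_rV_box //.
rewrite (eq_bigr (fun=> l%:E)); last first.
  move=> i _; rewrite lebesgue_measure_itv /= lte_fin.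
  by case: ltP => h; rewrite -?EFinB; congr EFin; lra.
by rewrite prodEFin prodr_const card_ord.
Qed.

Lemma enorm_ge0 (x : rV) : 0 <= enorm x.
Proof. exact: sqrtr_ge0. Qed.

Lemma enorm_sqr (x : rV) : enorm x ^+ 2 = \sum_(i < n) x ord0 i ^+ 2.
Proof. by rewrite sqr_sqrtr// sumr_ge0// => i _; exact: sqr_ge0. Qed.

Lemma coord_le_enorm (x : rV) i : `|x ord0 i| <= enorm x.
Proof.
rewrite -sqrtr_sqr ler_wsqrtr// (bigD1 i)//= lerDl sumr_ge0// => j _; exact: sqr_ge0.
Qed.

Lemma continuous_sum_sqr : continuous (fun x : rV => \sum_(i < n) x ord0 i ^+ 2).
Proof.
apply: continuous_big => [|i _ x]; first exact: add_continuous.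
by apply: (@continuous_comp _ _ _ (fun x : rV => x ord0 i) (fun y => y ^+ 2)); [exact: coord_continuous|exact: exprn_continuous].
Qed.

Lemma enorm_continuous : continuous (@enorm R n).
Proof.
move=> x; apply: (@continuous_comp _ _ _ (fun x : rV => \sum_(i < n) x ord0 i ^+ 2) Num.sqrt).
  exact: continuous_sum_sqr.
exact: sqrt_continuous.
Qed.

Lemma measurable_enorm : measurable_fun setT (@enorm R n).
Proof. by apply: continuous_measurable_rV; exact: enorm_continuous. Qed.

Lemma open_unit_ball : open (@unit_ball R n).
Proof.
rewrite (_ : @unit_ball R n = @enorm R n @^-1` [set y | y < 1])//.
by apply: open_comp => [x _|]; [exact: enorm_continuous|exact: open_lt].
Qed.

Lemma measurable_unit_ball : measurable (@unit_ball R n).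
Proof. by apply: open_measurable_rV; exact: open_unit_ball. Qed.

Lemma unit_ball_cube : @unit_ball R n `<=` cube (const_mx (-1)) 2.
Proof.
move=> x x1 i; rewrite /= mxE in_itv/=.
have := le_lt_trans (coord_le_enorm x i) x1; rewrite ltr_norml => /andP[h1 h2].
by apply/andP; split; lra.
Qed.

Lemma mu_unit_ball : (mu (@unit_ball R n) < +oo)%E.
Proof.
apply: (@le_lt_trans _ _ (mu (cube (const_mx (-1)) 2))).
  apply: (@le_measure _ _ _ mu (@unit_ball R n) (cube (const_mx (-1)) 2)); last exact: unit_ball_cube.
    apply/mem_set; exact: measurable_unit_ball.
  apply/mem_set; exact: measurable_cube.
by rewrite mu_cube// ltry.
Qed.

End RV1.

(** * Smooth functions and test functions *)

Section Flat.
Variable R : realType.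

(* The factor [t^-1 ^+ k] makes the family stable under derivation. *)
Definition flat k (t : R) : R := if 0 < t then (t^-1) ^+ k * expR (- t^-1) else 0.

Lemma flat_ge0 k t : 0 <= flat k t.
Proof.
rewrite /flat; case: ifP => // t0.
by rewrite mulr_ge0 ?expR_ge0// exprn_ge0// invr_ge0 ltW.
Qed.

(** The exponential series gives exp (1 / t) >= (1 / t)^(k + 2) / (k + 2)!. The order t^2 is what
    makes the derivative at 0 vanish. *)
Lemma flat_le k t : flat k t <= k.+2`!%:R * t ^+ 2.
Proof.
rewrite /flat; case: ifP => t0; last by rewrite mulr_ge0// sqr_ge0.
have ti0 : 0 < t^-1 by rewrite invr_gt0.
have fk : 0 < k.+2`!%:R :> R by rewrite ltr0n fact_gt0.
have H : (t^-1) ^+ k.+2 / k.+2`!%:R <= expR t^-1.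
  by apply: le_trans (expR_ge1Dxn k.+1 (ltW ti0)); rewrite lerDr.
have h0 : 0 < (t^-1) ^+ k.+2 / k.+2`!%:R by rewrite divr_gt0// exprn_gt0.
rewrite expRN.
apply: (@le_trans _ _ ((t^-1) ^+ k * ((t^-1) ^+ k.+2 / k.+2`!%:R)^-1)).
  rewrite ler_pM2l ?exprn_gt0// lef_pV2// ?posrE//; exact: expR_gt0.
have a0 : (t^-1) ^+ k != 0 by rewrite expf_neq0// gt_eqF.
rewrite !exprS; set a := _ ^+ k in a0 *; set F := _%:R.
rewrite le_eqVlt; apply/orP; left; apply/eqP.
by field; rewrite a0 !gt_eqF.
Qed.

(** The derivative is again a combination of members of the family, so [sm] is closed under
    derivation. At 0 the difference quotient is O(|h|) by [flat_le]. *)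
Lemma is_derive_flat k (t : R) :
  is_derive t (1 : R) (flat k) (flat k.+2 t - k%:R * flat k.+1 t).
Proof.
have [t0|t0|t0] := ltgtP 0 t.
- pose g := (fun t : R => (t^-1) ^+ k) * (expR \o (fun t => - t^-1)).
  have E : \near t, g t = flat k t.
    near=> s; rewrite /flat ifT//; near: s.
    exact: lt_nbhsr.
  apply: near_eq_is_derive E _.
  have D1 : is_derive t (1 : R) (fun t : R => t^-1) (- t ^- 2).
    have H : is_derive t (1 : R) (fun t : R => t) 1 by exact: is_derive_id.
    apply: is_derive_eq; first by apply: is_deriveV => //; rewrite gt_eqF.
    by rewrite /GRing.scale /= mulr1.
  have D2 : is_derive t (1 : R) (expR \o (fun t : R => - t^-1)) (expR (- t^-1) * t ^- 2).
    apply: is_derive1_comp.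
    by rewrite -[t ^- 2]opprK; exact: is_deriveN.
  have D3 : is_derive t (1 : R) (fun t : R => (t^-1) ^+ k) ((k%:R * (t^-1) ^+ k.-1) *: (- t ^- 2)).
    have -> : (fun t : R => t^-1 ^+ k) = (fun t => t^-1) ^+ k by apply/funext => s; rewrite fctE.
    exact: is_deriveX.
  apply: is_derive_eq.
  rewrite /flat t0 /= /GRing.scale /= -!exprVn.
  case: k {g D3} => [|k] /=.
    by rewrite !expr0 !mul0r !mul1r; ring.
  by rewrite !exprS; ring.
- have E : \near t, (cst 0 : R -> R) t = flat k t.
    near=> s; rewrite /flat ifF//; apply/negbTE; rewrite -leNgt; near: s.
    by apply: filterS (lt_nbhsl t0) => y /ltW.
  apply: near_eq_is_derive E _.
  have F0 j : flat j t = 0 by rewrite /flat ltNge (ltW t0).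
  rewrite !F0 mulr0 subr0.
  exact: is_derive_cst.
- have F0 j : flat j (0 : R) = 0 by rewrite /flat ltxx.
  rewrite -t0 !F0 mulr0 subr0.
  have H : (fun h : R => h^-1 *: ((flat k \o shift 0) (h *: 1) - flat k 0)) @ 0^' --> (0 : R).
    apply/cvgrPdist_lt => e e0.
    near=> h.
    have hh : h *: (1 : R) = h by rewrite /GRing.scale /= mulr1.
    rewrite sub0r normrN hh /= addr0 F0 subr0 /GRing.scale /= normrM.
    have h0 : h != 0 by near: h; exact: nbhs_dnbhs_neq.
    have hp : 0 < `|h| by rewrite normr_gt0.
    have C0 : 0 < k.+2`!%:R :> R by rewrite ltr0n fact_gt0.
    rewrite normrV ?unitfE// (ger0_norm (flat_ge0 _ _)).
    apply: (@le_lt_trans _ _ (`|h|^-1 * (k.+2`!%:R * `|h| ^+ 2))).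
      by rewrite ler_pM2l ?invr_gt0// real_normK ?num_real// flat_le.
    rewrite mulrCA expr2 mulKf ?gt_eqF//.
    rewrite mulrC -ltr_pdivlMr//.
    near: h; apply: dnbhs0_lt.
    by rewrite divr_gt0.
  apply: DeriveDef; first by apply/cvg_ex; exists 0.
  exact: cvg_lim H.
Unshelve. all: by end_near.
Qed.

End Flat.

(** * Smooth functions and their partial derivatives *)

Section Smooth.
Variables (R : realType) (n : nat).
Local Notation rV := 'rV[R]_n.
Local Notation e_ i := (delta_mx ord0 i : rV).

Lemma is_derive_line (u : rV -> R) (x v : rV) (t : R) :
  derivable u (x + t *: v) v ->
  is_derive t (1 : R) (fun t : R => u (x + t *: v)) ('D_v u (x + t *: v)).
Proof.
move=> du.
have E : (fun h : R => h^-1 *: (((fun t : R => u (x + t *: v)) \o shift t) (h *: (1 : R)) - u (x + t *: v)))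
  = (fun h : R => h^-1 *: ((u \o shift (x + t *: v)) (h *: v) - u (x + t *: v))).
  apply/funext => h /=; congr (_ *: (u _ - _)).
  by rewrite scalerDl /GRing.scale /= mulr1 addrCA addrA addrC addrA.
by apply: DeriveDef; rewrite /derivable /derive E.
Qed.

Lemma derive_sum_partial (u : rV -> R) x w : differentiable u x ->
  'D_w u x = \sum_(i < n) w ord0 i * partial i u x.
Proof.
move=> du; rewrite deriveE// {1}(row_sum_delta w) linear_sum.
by apply: eq_bigr => i _; rewrite linearZ /= -deriveE.
Qed.

Lemma derive_mulmx (u : rV -> R) (M : 'M[R]_n) x v :
  'D_v (fun x => u (x *m M)) x = 'D_(v *m M) u (x *m M).
Proof.
rewrite /derive; set f := (X in X @ _); set g := (X in _ = lim (X @ _)).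
suff -> : f = g by [].
by apply/funext => h; rewrite /f /g /= mulmxDl scalemxAl.
Qed.

Lemma differentiable_mulmx (M : 'M[R]_n) (x : rV) :
  differentiable (fun x : rV => x *m M) x.
Proof.
have -> : (fun x : rV => x *m M) = \sum_(i < n) (fun x : rV => x ord0 i *: row i M).
  by apply/funext => y; rewrite mulmx_sum_row fct_sumE.
apply: differentiable_sum => i.
by apply: differentiableZl; exact: differentiable_coord.
Qed.

(* The members are differentiable and [sm] is stable under partial derivatives, hence they are
   smooth ([smP]); this avoids a Leibniz rule for iterated partial derivatives. *)
Inductive sm : (rV -> R) -> Prop :=
| sm_smooth u of smooth u : sm u
| sm_cst c : sm (cst c)
| sm_coord i : sm (fun x => x ord0 i)
| sm_add u v of sm u & sm v : sm (u + v)
| sm_mul u v of sm u & sm v : sm (u * v)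
| sm_flat k u of sm u : sm (flat k \o u)
| sm_mulmx M u of sm u : sm (fun x => u (x *m M)).

Lemma sm_big I (r : seq I) (F : I -> rV -> R) : (forall i, sm (F i)) ->
  sm (\sum_(i <- r) F i).
Proof.
by move=> H; elim/big_ind : _ => // [|u v]; [exact: (sm_cst 0)|exact: sm_add].
Qed.

Lemma sm_prod I (r : seq I) (F : I -> rV -> R) : (forall i, sm (F i)) ->
  sm (\prod_(i <- r) F i).
Proof.
by move=> H; elim/big_ind : _ => // [|u v]; [exact: (sm_cst 1)|exact: sm_mul].
Qed.

Lemma sm_partial u : sm u -> (forall x, differentiable u x) /\ forall i, sm (partial i u).
Proof.
elim => {u}.
- move=> u su; split => [x|i]; first exact: (su [::]).
  by apply: sm_smooth => s x; have := su (rcons s i) x; rewrite foldr_rcons.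
- move=> c; split => [x|i]; first exact: differentiable_cst.
  rewrite (_ : partial i _ = cst 0); first exact: sm_cst.
  by apply/funext => x; rewrite /partial derive_cst.
- move=> j; split => [x|i]; first exact: differentiable_coord.
  rewrite (_ : partial i _ = cst ((i == j)%:R)); first exact: sm_cst.
  apply/funext => x; rewrite /partial.
  (* The partial derivative is read off along the line: the j-th coordinate of x + t e_i is affine
     in t. *)
  have := @is_derive_line (fun x : rV => x ord0 j) x (e_ i) 0.
  rewrite scale0r addr0 => /(_ (diff_derivable (differentiable_coord _ _ _))) [_ <-].
  have -> : (fun t : R => (x + t *: e_ i) ord0 j) = cst (x ord0 j) + (i == j)%:R \*: (@idfun R).
    apply/funext => t; rewrite !mxE eqxx /= eq_sym.
    by rewrite [RHS]/= /GRing.scale /= mulrC.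
  have D : is_derive (0 : R) (1 : R) (cst (x ord0 j) + (i == j)%:R \*: (@idfun R))
    (0 + (i == j)%:R *: 1) by apply: is_deriveD.
  by rewrite derive_val add0r /GRing.scale /= mulr1.
- move=> u v su [du pu] sv [dv pv]; split => [x|i]; first exact: differentiableD.
  rewrite (_ : partial i _ = partial i u + partial i v); first exact: sm_add.
  by apply/funext => x; rewrite /partial deriveD//; exact: diff_derivable.
- move=> u v su [du pu] sv [dv pv]; split => [x|i]; first exact: differentiableM.
  rewrite (_ : partial i _ = u * partial i v + v * partial i u).
    by apply: sm_add; exact: sm_mul.
  by apply/funext => x; rewrite /partial deriveM//; exact: diff_derivable.
- move=> k u su [du pu].
  have dk y : differentiable (flat k : R -> R) y.
    by apply/derivable1_diffP; have [] := is_derive_flat k y.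
  split => [x|i]; first exact: differentiable_comp.
  rewrite (_ : partial i _ =
    ((flat k.+2 \o u) + cst (- k%:R) * (flat k.+1 \o u)) * partial i u).
    by apply: sm_mul => //; apply: sm_add; [exact: sm_flat|apply: sm_mul; [exact: sm_cst|exact: sm_flat]].
  apply/funext => x; rewrite /partial deriveE; last exact: differentiable_comp.
  rewrite diff_comp// /= diff1E// derive1E.
  have [_ ->] := is_derive_flat k (u x).
  by rewrite -deriveE// /GRing.scale /= mulrC !fctE mulNr.
- move=> M u su [du pu]; split => [x|i].
    by apply: differentiable_comp => //; exact: differentiable_mulmx.
  rewrite (_ : partial i _ = \sum_(k < n) cst (M i k) * (fun x => partial k u (x *m M))).
    by apply: sm_big => k; apply: sm_mul; [exact: sm_cst|exact: sm_mulmx].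
  apply/funext => x; rewrite /partial derive_mulmx derive_sum_partial// fct_sumE.
  by apply: eq_bigr => k _; rewrite -rowE mxE.
Qed.

Lemma smP u : sm u -> smooth u.
Proof.
move=> su s; suff H : sm (foldr (@partial R n) u s) by move=> x; have [] := sm_partial H.
by elim: s => //= i s IH; have [_] := sm_partial IH.
Qed.

Lemma smooth_diff (u : rV -> R) x : smooth u -> differentiable u x.
Proof. by move=> su; exact: (su [::]). Qed.

Lemma smooth_continuous (u : rV -> R) : smooth u -> continuous u.
Proof. by move=> su x; apply: differentiable_continuous; exact: smooth_diff. Qed.

Lemma smooth_partial i (u : rV -> R) : smooth u -> smooth (partial i u).
Proof. by move=> su; apply: smP; have [_] := sm_partial (sm_smooth su). Qed.

Lemma smooth_measurable (u : rV -> R) : smooth u -> measurable_fun setT u.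
Proof. by move=> su; apply: continuous_measurable_rV; exact: smooth_continuous. Qed.

Lemma partialD i (u v : rV -> R) x : smooth u -> smooth v ->
  partial i (fun x => u x + v x) x = partial i u x + partial i v x.
Proof.
by move=> su sv; rewrite /partial (deriveD (f := u) (g := v))//; apply: diff_derivable; exact: smooth_diff.
Qed.

Lemma partialM i (u v : rV -> R) x : smooth u -> smooth v ->
  partial i (fun x => u x * v x) x = u x * partial i v x + v x * partial i u x.
Proof.
by move=> su sv; rewrite /partial (deriveM (f := u) (g := v))//; apply: diff_derivable; exact: smooth_diff.
Qed.

Lemma partialZ i (c : R) (u : rV -> R) x : smooth u ->
  partial i (fun x => c * u x) x = c * partial i u x.
Proof.
by move=> su; rewrite /partial (deriveZ c (f := u))//; apply: diff_derivable; exact: smooth_diff.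
Qed.

Lemma partial_mulmx i (u : rV -> R) (M : 'M[R]_n) x : smooth u ->
  partial i (fun x => u (x *m M)) x = \sum_(k < n) M i k * partial k u (x *m M).
Proof.
move=> su; rewrite /partial derive_mulmx derive_sum_partial; last exact: smooth_diff.
by apply: eq_bigr => k _; rewrite -rowE mxE.
Qed.

Lemma mean_value (u : rV -> R) x w : smooth u -> exists2 c : R, 0 < c < 1 &
  u (x + w) - u x = \sum_(i < n) w ord0 i * partial i u (x + c *: w).
Proof.
move=> su.
have H t : is_derive t (1 : R) (fun t : R => u (x + t *: w)) ('D_w u (x + t *: w)).
  by apply: is_derive_line; apply: diff_derivable; exact: smooth_diff.
have [|c] := @MVT _ (fun t : R => u (x + t *: w)) (fun t => 'D_w u (x + t *: w)) 0 1 ltr01 (fun t _ => H t).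
  apply: continuous_subspaceT => t.
  by apply: differentiable_continuous; apply/derivable1_diffP; have [] := H t.
rewrite in_itv /= scale1r scale0r addr0 subr0 mulr1 => c01 ->.
by exists c => //; rewrite derive_sum_partial//; exact: smooth_diff.
Qed.

End Smooth.

(** * Bounded measurable functions *)

Section Bdm.
Variables (R : realType) (n : nat).
Local Notation rV := 'rV[R]_n.
Local Notation mu := (lebesgue_rV R n).
Implicit Types (f g : rV -> R) (D : set rV).

(** An algebra of functions integrable on every set of finite measure. Test functions and their
    derivatives belong to it, so integrability is proved by following the shape of the integrand. *)
Definition bdm f := measurable_fun setT f /\ exists M, forall x, `|f x| <= M.

Lemma bdm_cst c : bdm (fun=> c).
Proof. by split; [exact: measurable_cst|exists `|c|]. Qed.

Lemma bdmD f g : bdm f -> bdm g -> bdm (fun x => f x + g x).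
Proof.
move=> [mf [M HM]] [mg [N HN]]; split; first exact: measurable_funD.
by exists (M + N) => x; apply: le_trans (ler_normD _ _) _; exact: lerD.
Qed.

Lemma bdmM f g : bdm f -> bdm g -> bdm (fun x => f x * g x).
Proof.
move=> [mf [M HM]] [mg [N HN]]; split; first exact: measurable_funM.
by exists (M * N) => x; rewrite normrM; exact: ler_pM.
Qed.

Lemma bdmN f : bdm f -> bdm (fun x => - f x).
Proof.
move=> bf; have := bdmM (bdm_cst (-1)) bf.
by congr bdm; apply/funext => x; rewrite mulN1r.
Qed.

Lemma bdmB f g : bdm f -> bdm g -> bdm (fun x => f x - g x).
Proof. by move=> bf bg; apply: bdmD => //; exact: bdmN. Qed.

Lemma bdmX f k : bdm f -> bdm (fun x => f x ^+ k).
Proof.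
move=> bf; elim: k => [|k IH].
  by under eq_fun do rewrite expr0; exact: bdm_cst.
by under eq_fun do rewrite exprS; exact: bdmM.
Qed.

Lemma bdm_sum I (r : seq I) (F : I -> rV -> R) : (forall i, bdm (F i)) ->
  bdm (fun x => \sum_(i <- r) F i x).
Proof.
move=> H; elim: r => [|i r IH].
  by under eq_fun do rewrite big_nil; exact: bdm_cst.
by under eq_fun do rewrite big_cons; exact: bdmD.
Qed.

Lemma bdm_norm f : bdm f -> bdm (fun x => `|f x|).
Proof.
move=> [mf [M HM]]; split; first exact: measurableT_comp.
by exists M => x; rewrite normr_id.
Qed.

Lemma bdm_powR f q : 0 <= q -> bdm f -> bdm (fun x => `|f x| `^ q).
Proof.
move=> q0 [mf [M HM]]; split.
  apply: (measurableT_comp (measurable_powR q)) => //.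
  exact: measurableT_comp.
exists (M `^ q) => x; rewrite ger0_norm ?powR_ge0//.
by apply: ge0_ler_powR; rewrite ?nnegrE// (le_trans _ (HM x)).
Qed.

Lemma bdm_mpres T f : mpres T -> bdm f -> bdm (fun x => f (T x)).
Proof.
move=> [mT _] [mf [M HM]]; split; first exact: measurableT_comp.
by exists M.
Qed.

Lemma bdm_shift w f : bdm f -> bdm (fun x => f (x + w)).
Proof. by apply: bdm_mpres; exact: mpres_shift. Qed.

Section Int.
Variable D : set rV.
Hypotheses (mD : measurable D) (fD : (mu D < +oo)%E).

Lemma bdm_integrable f : bdm f -> mu.-integrable D (EFin \o f).
Proof.
move=> [mf [M HM]]; apply: measurable_bounded_integrable => //.
  exact: measurable_funS mf.
exists M; split; first exact: num_real.
by move=> y My x _ /=; apply: (le_trans (HM x)); exact: ltW.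
Qed.

Lemma bdm_RintD f g : bdm f -> bdm g ->
  \int[mu]_(x in D) (f x + g x) = \int[mu]_(x in D) f x + \int[mu]_(x in D) g x.
Proof. by move=> bf bg; rewrite RintegralD//; exact: bdm_integrable. Qed.

Lemma bdm_RintB f g : bdm f -> bdm g ->
  \int[mu]_(x in D) (f x - g x) = \int[mu]_(x in D) f x - \int[mu]_(x in D) g x.
Proof. by move=> bf bg; rewrite RintegralB//; exact: bdm_integrable. Qed.

Lemma bdm_RintZ c f : bdm f ->
  \int[mu]_(x in D) (c * f x) = c * \int[mu]_(x in D) f x.
Proof. by move=> bf; rewrite RintegralZl//; exact: bdm_integrable. Qed.

Lemma bdm_Rint_sum I (r : seq I) (F : I -> rV -> R) : (forall i, bdm (F i)) ->
  \int[mu]_(x in D) (\sum_(i <- r) F i x) = \sum_(i <- r) \int[mu]_(x in D) F i x.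
Proof.
move=> H; elim: r => [|i r IH].
  under eq_Rintegral do rewrite big_nil.
  by rewrite big_nil /Rintegral integral0.
under eq_Rintegral do rewrite big_cons.
by rewrite big_cons -IH bdm_RintD//; exact: bdm_sum.
Qed.

Lemma bdm_le_Rint f g : bdm f -> bdm g -> (forall x, D x -> f x <= g x) ->
  \int[mu]_(x in D) f x <= \int[mu]_(x in D) g x.
Proof. by move=> bf bg H; apply: le_Rintegral => //; exact: bdm_integrable. Qed.

Lemma Rint_cst c : \int[mu]_(x in D) c = c * fine (mu D).
Proof. by rewrite Rintegral_cst. Qed.

Lemma bdm_normr_Rint f : bdm f -> `|\int[mu]_(x in D) f x| <= \int[mu]_(x in D) `|f x|.
Proof. by move=> bf; apply: le_normr_Rintegral => //; exact: bdm_integrable. Qed.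

End Int.

Lemma Rint_subset A D f : measurable A -> measurable D -> (mu D < +oo)%E -> A `<=` D ->
  bdm f -> (forall x, 0 <= f x) ->
  \int[mu]_(x in A) f x <= \int[mu]_(x in D) f x.
Proof.
move=> mA mD fD AD bf f0; rewrite /Rintegral fine_le//.
- apply: integrable_fin_num => //; apply: bdm_integrable => //.
  by apply: le_lt_trans fD; apply: le_measure => //; exact/mem_set.
- by apply: integrable_fin_num => //; exact: bdm_integrable.
- apply: ge0_subset_integral => //.
    by apply/measurable_EFinP; apply: measurable_funTS; case: bf.
  by move=> x _; rewrite lee_fin.
Qed.

Lemma Rint_support A D f : A `<=` D -> (forall x, ~ A x -> f x = 0) ->
  \int[mu]_(x in D) f x = \int[mu]_(x in A) f x.
Proof.
move=> AD f0; rewrite Rintegral_mkcond [RHS]Rintegral_mkcond; congr Rintegral.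
apply/funext => x; rewrite !patchE; case: ifPn => [xD|xD]; case: ifPn => // xA.
  by apply: f0 => /mem_set; apply/negP.
by move: (xA) (xD) => /set_mem/AD/mem_set ->.
Qed.

End Bdm.

(** * Test functions on the ball and their Taylor estimates *)

Section TestFun.
Variables (R : realType) (n : nat).
Local Notation rV := 'rV[R]_n.
Local Notation mu := (lebesgue_rV R n).
Local Notation Om := (@unit_ball R n).
Local Notation test := (@test_function R n Om).

Lemma test_smooth phi : test phi -> smooth phi. Proof. by case. Qed.

Lemma test_out phi x : test phi -> ~ Om x -> phi x = 0.
Proof. by move=> [_ [C [_ CO] H]] nx; apply: H => /CO. Qed.

Lemma test_partial i phi : test phi -> test (partial i phi).
Proof.
move=> [sphi [C [cC CO] H]]; split; first exact: smooth_partial.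
exists C => // x nC; rewrite /partial.
have cloC : closed C by apply: compact_closed => //; exact: norm_hausdorff.
(* The complement of the compact set is open, so [phi] vanishes on a neighbourhood of x and its
   derivative is 0 there. *)
have E : \near x, (cst 0 : rV -> R) x = phi x.
  have : nbhs x (~` C) by apply: open_nbhs_nbhs; split => //; exact: closed_openC.
  by apply: filterS => y /H ->.
by rewrite -(near_eq_derive _ E) derive_cst.
Qed.

Lemma test_bdm phi : test phi -> bdm phi.
Proof.
move=> [sphi [C [cC CO] H]]; split; first exact: smooth_measurable.
have : bounded_set (phi @` C).
  apply: compact_bounded; apply: continuous_compact => //.
  by apply: continuous_subspaceT => x; exact: smooth_continuous.
move=> [M [_ HM]]; exists (`|M| + 1) => x.
have [Cx|nCx] := pselect (C x).
  by apply: HM; [apply: (le_lt_trans (ler_norm _)); rewrite ltrDl|exists x].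
by rewrite H// normr0 addr_ge0.
Qed.

Lemma testD phi psi : test phi -> test psi -> test (fun x => phi x + psi x).
Proof.
move=> [s1 [C [cC CO] H]] [s2 [C' [cC' CO'] H']]; split.
  by apply: smP; apply: (sm_add (sm_smooth s1) (sm_smooth s2)).
exists (C `|` C'); first by split; [exact: compactU|move=> x [/CO|/CO']].
by move=> x /not_orP[h1 h2]; rewrite H// H'// addr0.
Qed.

Lemma testM f phi : smooth f -> test phi -> test (fun x => f x * phi x).
Proof.
move=> sf [s1 [C [cC CO] H]]; split.
  by apply: smP; apply: (sm_mul (sm_smooth sf) (sm_smooth s1)).
by exists C => // x /H ->; rewrite mulr0.
Qed.

Lemma smooth_cst (c : R) : smooth (cst c : rV -> R).
Proof. by apply: smP; exact: sm_cst. Qed.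

Lemma testZ c phi : test phi -> test (fun x => c * phi x).
Proof. by apply: testM; exact: smooth_cst. Qed.

(** The partial derivatives are test functions, hence bounded on the whole space, and the mean value
    theorem applies between any two points. *)
Lemma smooth_lip phi : test phi -> exists2 L, 0 <= L & forall (x w : rV) (d : R), 0 <= d ->
  (forall i, `|w ord0 i| <= d) -> `|phi (x + w) - phi x| <= L * d.
Proof.
move=> tphi.
have H i := (test_bdm (test_partial i tphi)).2.
exists (\sum_(i < n) `|projT1 (cid (H i))|); first by rewrite sumr_ge0.
move=> x w d d0 wd.
have [c _ ->] := mean_value x w (test_smooth tphi).
apply: le_trans (ler_norm_sum _ _ _) _; rewrite mulr_suml.
apply: ler_sum => i _; rewrite normrM mulrC ler_pM//.
by apply: le_trans (projT2 (cid (H i)) _) _; exact: ler_norm.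
Qed.

(** Mean value theorem, followed by the Lipschitz bound of each partial derivative between x and the
    intermediate point. *)
Lemma smooth_taylor phi : test phi -> exists2 L, 0 <= L & forall (x w : rV) (d : R), 0 <= d ->
  (forall i, `|w ord0 i| <= d) ->
  `|phi (x + w) - phi x - \sum_(i < n) w ord0 i * partial i phi x| <= L * d ^+ 2.
Proof.
move=> tphi.
have H i : exists L : R, 0 <= L /\ forall (x w : rV) (d : R), 0 <= d ->
    (forall i, `|w ord0 i| <= d) -> `|partial i phi (x + w) - partial i phi x| <= L * d.
  by have [L L0 HL] := smooth_lip (test_partial i tphi); exists L.
have [L HL] := choice H.
exists (\sum_(i < n) L i); first by apply: sumr_ge0 => i _; have [] := HL i.
move=> x w d d0 wd.
have [c /andP[c0 c1] ->] := mean_value x w (test_smooth tphi).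
rewrite -sumrB mulr_suml; apply: le_trans (ler_norm_sum _ _ _) _.
apply: ler_sum => i _; rewrite -mulrBr normrM expr2 mulrCA ler_pM//.
apply: (HL i).2 => // j.
by rewrite mxE normrM (gtr0_norm c0) (le_trans _ (wd j))// ler_piMl// ltW.
Qed.

End TestFun.

(** * Translation estimate and integration by parts *)

Section Aux.
Variable R : realType.

(** Replaces a passage to the limit in estimates that carry an error of order 1 / m. *)
Lemma le_invn (x y C : R) : (forall m : nat, x <= y + C / m.+1%:R) -> x <= y.
Proof.
move=> H; apply/ler_addgt0Pr => e e0.
apply: le_trans (H (Num.truncn (`|C| / e))) _; rewrite lerD2l.
rewrite ler_pdivrMr ?ltr0n// mulrC -ler_pdivrMr//.
apply: le_trans (ltW (truncnS_gt _)).
by rewrite ler_pM2r ?invr_gt0// ler_norm.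
Qed.

(** The sum of the squares of m a_k - S is m times the difference of the two sides. *)
Lemma sqr_sum_le m (a : 'I_m -> R) :
  (\sum_(k < m) a k) ^+ 2 <= m%:R * \sum_(k < m) a k ^+ 2.
Proof.
case: m a => [|m] a; first by rewrite !big_ord0 expr0n mulr0.
set S := \sum_(k < _) a k; set Q := \sum_(k < _) _ ^+ 2.
have m0 : 0 < m.+1%:R :> R by rewrite ltr0n.
have : 0 <= \sum_(k < m.+1) (m.+1%:R * a k - S) ^+ 2.
  by apply: sumr_ge0 => k _; exact: sqr_ge0.
under eq_bigr => k _ do rewrite sqrrB exprMn.
rewrite big_split /= sumrB -mulr_sumr -/Q.
under [X in _ - X]eq_bigr => k _ do rewrite mulrAC -mulrnAl.
rewrite -mulr_sumr -/S sumr_const card_ord => H.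
rewrite -subr_ge0 -(pmulr_rge0 _ m0); apply: le_trans H _.
rewrite le_eqVlt; apply/orP; left; apply/eqP.
by rewrite -[S ^+ 2 *+ m.+1]mulr_natr; ring.
Qed.

End Aux.

Section Transl.
Variables (R : realType) (n : nat).
Local Notation rV := 'rV[R]_n.
Local Notation mu := (lebesgue_rV R n).
Local Notation Om := (@unit_ball R n).
Local Notation test := (@test_function R n Om).
Implicit Types (phi : rV -> R).

Definition gradsq phi x := \sum_(i < n) partial i phi x ^+ 2.

Lemma gradsq_ge0 phi x : 0 <= gradsq phi x.
Proof. by apply: sumr_ge0 => i _; exact: sqr_ge0. Qed.

Lemma gradsq_bdm phi : test phi -> bdm (gradsq phi).
Proof. by move=> tp; apply: bdm_sum => i; apply: bdmX; apply: test_bdm; exact: test_partial. Qed.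

(* Cut the segment from x to x + z into m pieces, apply Taylor's formula on each, let m grow. *)
Lemma translation_estimate phi (A Q : set rV) (z : rV) (d : R) : test phi ->
  measurable A -> measurable Q -> (mu A < +oo)%E -> (mu Q < +oo)%E ->
  0 <= d -> (forall i, `|z ord0 i| <= d) ->
  (forall x (t : R), A x -> 0 <= t <= 1 -> Q (x + t *: z)) ->
  \int[mu]_(x in A) ((phi (x + z) - phi x) ^+ 2) <=
  n%:R * d ^+ 2 * \int[mu]_(x in Q) gradsq phi x.
Proof.
move=> tphi mA mQ fA fQ d0 zd AQ.
have bphi := test_bdm tphi.
pose g x := \sum_(i < n) z ord0 i * partial i phi x.
have bg : bdm g.
  by apply: bdm_sum => i; apply: bdmM; [exact: bdm_cst|apply: test_bdm; exact: test_partial].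
have [G HG] := bg.2.
have [L L0 HL] := smooth_taylor tphi.
(* With M pieces, M^2 times the square of |g| / M + L (d / M)^2 exceeds g^2 by at most C / M. *)
pose C := 2 * `|G| * L * d ^+ 2 + L ^+ 2 * d ^+ 4.
have C0 : 0 <= C by rewrite addr_ge0// mulr_ge0// ?exprn_ge0// ?mulr_ge0.
apply: (@le_trans _ _ (\int[mu]_(x in Q) (g x ^+ 2))); last first.
  rewrite -bdm_RintZ//; last exact: gradsq_bdm.
  apply: bdm_le_Rint => //; first exact: bdmX.
    by apply: bdmM; [exact: bdm_cst|exact: gradsq_bdm].
  move=> x _; apply: le_trans (sqr_sum_le _) _.
  rewrite -mulrA ler_wpM2l// /gradsq mulr_sumr; apply: ler_sum => i _.
  by rewrite exprMn ler_wpM2r ?sqr_ge0// -(real_normK (num_real (z _ _))) lerXn2r// nnegrE.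
apply: (@le_invn _ _ _ (C * fine (mu Q))) => m.
set M : R := m.+1%:R; have M0 : 0 < M by rewrite ltr0n.
pose w := M^-1 *: z.
pose f y := (phi (y + w) - phi y) ^+ 2.
have bf : bdm f by apply: bdmX; apply: bdmB => //; exact: bdm_shift.
have f0 y : 0 <= f y by exact: sqr_ge0.
(* Telescoping over the m + 1 pieces; squaring the sum then costs the factor M by [sqr_sum_le]. *)
have tel x : phi (x + z) - phi x = \sum_(k < m.+1) (phi (x + k%:R *: w + w) - phi (x + k%:R *: w)).
  rewrite (eq_bigr (fun k : 'I_m.+1 => phi (x + k.+1%:R *: w) - phi (x + k%:R *: w))); last first.
    by move=> k _; rewrite -addrA -[X in _ + (_ + X)]scale1r -scalerDl -natr1.
  rewrite -(big_mkord xpredT (fun k => phi (x + k.+1%:R *: w) - phi (x + k%:R *: w))).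
  rewrite (telescope_sumr (fun k => phi (x + k%:R *: w)))//.
  by rewrite scale0r addr0 scalerA divff ?scale1r// gt_eqF.
have bfk k : bdm (fun x => f (x + k%:R *: w)) by exact: (bdm_shift _ bf).
apply: (@le_trans _ _ (M * \sum_(k < m.+1) \int[mu]_(x in A) f (x + k%:R *: w))).
  rewrite -bdm_Rint_sum//.
  rewrite -bdm_RintZ//; last by apply: bdm_sum => k; exact: bfk.
  apply: bdm_le_Rint => //.
  - by apply: bdmX; apply: bdmB => //; exact: bdm_shift.
  - by apply: bdmM; [exact: bdm_cst|apply: bdm_sum => k; exact: bfk].
  - by move=> x _; rewrite tel; exact: sqr_sum_le.
apply: (@le_trans _ _ (M * \sum_(k < m.+1) \int[mu]_(x in Q) f x)).
  rewrite ler_pM2l//; apply: ler_sum => k _.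
  pose T := fun x : rV => x + k%:R *: w; pose T' := fun x : rV => x + - (k%:R *: w).
  (* Translate [A] by k w. The translate lies in [Q], since its points are those of the segments at
     parameter k / M. *)
  have -> : A = T @^-1` (T' @^-1` A).
    by apply/seteqP; split => x; rewrite /T /T' /= addrK.
  have mB : measurable (T' @^-1` A) by apply: mpres_preimage => //; exact: mpres_shift.
  rewrite (Rint_mpres (f := f) (mpres_shift (k%:R *: w)) mB); last first.
    by apply: measurable_funTS; case: bf.
  apply: Rint_subset => // y /= Ay.
  have := AQ _ (k%:R / M) Ay; rewrite -scalerA subrK; apply.
  apply/andP; split; first by rewrite divr_ge0// ltW.
  by rewrite ler_pdivrMr// mul1r ler_nat ltnW.
rewrite sumr_const card_ord -[_ *+ _]mulr_natl mulrA -/M.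
rewrite -bdm_RintZ//.
rewrite mulrAC -(@Rint_cst _ _ Q mQ).
rewrite -bdm_RintD//; [|exact: bdmX|exact: bdm_cst].
apply: bdm_le_Rint => //; first by apply: bdmM => //; exact: bdm_cst.
  by apply: bdmD; [exact: bdmX|exact: bdm_cst].
move=> x _.
have wd i : `|w ord0 i| <= d / M.
  by rewrite mxE normrM mulrC (gtr0_norm (_ : 0 < M^-1)) ?invr_gt0// ler_pM2r ?invr_gt0.
have := HL x w _ (divr_ge0 d0 (ltW M0)) wd.
have -> : \sum_(i < n) w ord0 i * partial i phi x = g x / M.
  by rewrite mulr_suml; apply: eq_bigr => i _; rewrite mxE [RHS]mulrC mulrA.
set D := phi (x + w) - phi x => HD.
have HD' : `|D| <= `|g x| / M + L * (d / M) ^+ 2.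
  have -> : D = g x / M + (D - g x / M) by rewrite addrC subrK.
  apply: le_trans (ler_normD _ _) _; rewrite lerD// normrM.
  by rewrite [`|M^-1|]gtr0_norm ?invr_gt0.
rewrite /f -/D -(real_normK (num_real D)).
apply: (@le_trans _ _ (M * M * (`|g x| / M + L * (d / M) ^+ 2) ^+ 2)).
  rewrite ler_pM2l ?mulr_gt0// lerXn2r// nnegrE// addr_ge0// ?mulr_ge0// ?invr_ge0 ?exprn_ge0// ?divr_ge0// ltW//.
have gG : `|g x| <= `|G| by apply: le_trans (HG x) (ler_norm _).
rewrite -[g x ^+ 2](real_normK (num_real (g x))).
set a := `|g x| in gG *.
have -> : M * M * (a / M + L * (d / M) ^+ 2) ^+ 2 = a ^+ 2 + (2 * a * L * d ^+ 2 + L ^+ 2 * d ^+ 4 / M) / M.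
  by field; rewrite gt_eqF.
rewrite lerD2l ler_pM2r ?invr_gt0// /C lerD//.
  by rewrite ler_wpM2r ?exprn_ge0// ler_wpM2r// ler_wpM2l.
by rewrite ler_piMr ?mulr_ge0// ?exprn_ge0// invf_le1// ler1n.
Qed.

(* Difference quotients integrate to 0 by translation invariance. *)
Lemma Rint_partial0 i phi : test phi -> \int[mu]_(x in Om) partial i phi x = 0.
Proof.
move=> tphi.
(* This cube contains the ball and its translates by at most 1 along a coordinate axis, in both
   directions. *)
pose Q := cube (const_mx (-2) : rV) 4.
have mQ : measurable Q by exact: measurable_cube.
have fQ : (mu Q < +oo)%E by rewrite mu_cube// ltry.
have OQ (t : R) j : 0 <= t <= 1 -> Om `<=` (fun x => x + t *: delta_mx ord0 j) @^-1` Q.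
  move=> /andP[t0 t1] x x1 k; rewrite /= in_itv/= !mxE.
  have := le_lt_trans (coord_le_enorm x k) x1; rewrite ltr_norml => /andP[h1 h2].
  by rewrite eqxx /=; case: eqP => _ /=; rewrite ?mulr1 ?mulr0 ?addr0; apply/andP; split; lra.
have OQ' (t : R) j : 0 <= t <= 1 -> Om `<=` (fun x => x + (- (t *: delta_mx ord0 j))) @^-1` Q.
  move=> /andP[t0 t1] x x1 k; rewrite /= in_itv/= !mxE.
  have := le_lt_trans (coord_le_enorm x k) x1; rewrite ltr_norml => /andP[h1 h2].
  by rewrite eqxx /=; case: eqP => _ /=; rewrite ?mulr1 ?mulr0 ?oppr0 ?addr0; apply/andP; split; lra.
have OQ0 : Om `<=` Q.
  by move=> x Ox; have := @OQ 0 i _ x Ox; rewrite /= scale0r addr0; apply; rewrite lexx ler01.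
have bphi := test_bdm tphi; have bp := test_bdm (test_partial i tphi).
rewrite -(Rint_support OQ0); last by move=> x; apply: test_out; exact: test_partial.
have [L L0 HL] := smooth_taylor tphi.
apply/eqP; rewrite -normr_le0; apply: (@le_invn _ _ _ (L * fine (mu Q))) => m.
set t : R := m.+1%:R^-1.
have t0 : 0 < t by rewrite invr_gt0 ltr0n.
have t1 : t <= 1 by rewrite invf_le1 ?ltr0n// ler1n.
pose w : rV := t *: delta_mx ord0 i.
(* Both functions have their support inside [Q], so both integrals equal that of [phi] over the
   ball. *)
have Z : \int[mu]_(x in Q) (phi (x + w) - phi x) = 0.
  rewrite bdm_RintB//; last exact: bdm_shift.
  apply/eqP; rewrite subr_eq0; apply/eqP.
  have -> : Q = (fun x => x + w) @^-1` ((fun x => x + - w) @^-1` Q).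
    by apply/seteqP; split => x; rewrite /= addrK.
  have mB : measurable ((fun x => x + - w) @^-1` Q) by apply: mpres_preimage => //; exact: mpres_shift.
  rewrite (Rint_mpres (f := phi) (mpres_shift w) mB); last by apply: measurable_funTS; case: bphi.
  rewrite (_ : (fun x => x + w) @^-1` _ = Q); last first.
    by apply/seteqP; split => x; rewrite /= addrK.
  rewrite (@Rint_support _ _ Om); [|by apply: OQ'; rewrite ltW|by move=> x; exact: test_out].
  by rewrite (@Rint_support _ _ Om)// => x; exact: test_out.
rewrite add0r -/t -(ler_pM2l t0) -{1}(gtr0_norm t0) -normrM.
rewrite -bdm_RintZ// -[X in `|X|]subr0 -Z distrC -bdm_RintB//; first last.
- by apply: bdmM => //; exact: bdm_cst.
- by apply: bdmB => //; exact: bdm_shift.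
have bb : bdm (fun x => phi (x + w) - phi x - t * partial i phi x).
  by apply: bdmB; [apply: bdmB => //; exact: bdm_shift|apply: bdmM => //; exact: bdm_cst].
apply: le_trans (bdm_normr_Rint mQ fQ bb) _.
have -> : t * (L * fine (mu Q) * t) = L * t ^+ 2 * fine (mu Q) by ring.
rewrite -(@Rint_cst _ _ Q mQ).
apply: bdm_le_Rint => //; [exact: bdm_norm|exact: bdm_cst|move=> x _].
have := HL x w t (ltW t0).
rewrite (bigD1 i)//= big1 ?addr0; last first.
  by move=> j ji; rewrite !mxE eqxx /= (negbTE ji) mulr0 mul0r.
rewrite !mxE !eqxx mulr1; apply => j; rewrite !mxE eqxx /=.
by case: eqP => _; rewrite ?mulr1 ?mulr0 ?normr0 ?(gtr0_norm t0)// ltW.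
Qed.

Lemma test_ibp i phi psi : test phi -> test psi ->
  \int[mu]_(x in Om) (phi x * partial i psi x) =
  - \int[mu]_(x in Om) (partial i phi x * psi x).
Proof.
move=> t1 t2; apply/eqP; rewrite -addr_eq0; apply/eqP.
have b1 := test_bdm t1; have b2 := test_bdm t2.
have b3 := test_bdm (test_partial i t1); have b4 := test_bdm (test_partial i t2).
have mO := @measurable_unit_ball R n; have fO := @mu_unit_ball R n.
rewrite -bdm_RintD//; [|exact: bdmM|exact: bdmM].
rewrite -[RHS](@Rint_partial0 i (fun x => phi x * psi x)); last first.
  by apply: testM => //; exact: test_smooth.
apply: eq_Rintegral => x _.
by rewrite partialM; [rewrite [X in _ + X]mulrC|exact: test_smooth|exact: test_smooth].
Qed.

End Transl.

(** * Subcritical Sobolev and Rellich theorems on dyadic cubes *)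

Section Pow.
Variable R : realType.

(** Choose h with (1 + h)^q = k. Either |b| <= h |a| and the first term suffices, or |a| < |b| / h
    and the second does. A factor k as close to 1 as desired is what [osc_rec] and [max_cauchy]
    require. *)
Lemma powR_conv (k q : R) : 1 < k -> 1 <= q -> exists2 C : R, 0 <= C &
  forall a b : R, `|a + b| `^ q <= k * `|a| `^ q + C * `|b| `^ q.
Proof.
move=> k1 q1; have q0 : 0 < q by lra.
pose h := k `^ q^-1 - 1.
have h0 : 0 < h.
  have : 1 `^ q^-1 < k `^ q^-1.
    by apply: gt0_ltr_powR; rewrite ?nnegrE ?invr_gt0//; lra.
  by rewrite powR1 subr_gt0.
have hq : (1 + h) `^ q = k.
  by rewrite /h addrC subrK -powRrM mulVf ?gt_eqF// powRr1//; lra.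
exists ((1 + h^-1) `^ q); first exact: powR_ge0.
move=> a b.
have [ba|ab] := leP `|b| (h * `|a|).
  apply: (@le_trans _ _ (k * `|a| `^ q)); last by rewrite lerDl mulr_ge0// powR_ge0.
  rewrite -hq -powRM//; last lra.
  apply: ge0_ler_powR; rewrite ?nnegrE//; first lra.
    by rewrite mulr_ge0//; lra.
  by apply: le_trans (ler_normD _ _) _; rewrite mulrDl mul1r lerD2l.
apply: (@le_trans _ _ ((1 + h^-1) `^ q * `|b| `^ q)); last first.
  by rewrite lerDr mulr_ge0// ?powR_ge0//; lra.
have hi0 : 0 < h^-1 by rewrite invr_gt0.
rewrite -powRM//; last lra.
apply: ge0_ler_powR; rewrite ?nnegrE//; first lra.
  by rewrite mulr_ge0//; lra.
apply: le_trans (ler_normD _ _) _; rewrite mulrDl mul1r addrC lerD2l.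
by rewrite mulrC ler_pdivlMr// mulrC ltW.
Qed.

Lemma powR_add2 (q a b : R) : 0 <= q ->
  `|a + b| `^ q <= 2 `^ q * (`|a| `^ q + `|b| `^ q).
Proof.
move=> q0; rewrite mulrDr -!powRM//.
wlog ab : a b / `|b| <= `|a|.
  move=> W; have [h|h] := leP `|b| `|a|; first exact: W.
  by rewrite addrC [leRHS]addrC; apply: W; rewrite ltW.
apply: (@le_trans _ _ ((2 * `|a|) `^ q)); last by rewrite lerDl powR_ge0.
apply: ge0_ler_powR; rewrite ?nnegrE// ?mulr_ge0//.
by apply: le_trans (ler_normD _ _) _; lra.
Qed.

(** Write E^s = E E^(s - 1) and replace E by the whole sum in the second factor. *)
Lemma powR_superadd (I : eqType) (r : seq I) (E : I -> R) (s : R) : 1 <= s ->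
  (forall i, 0 <= E i) -> \sum_(i <- r) E i `^ s <= (\sum_(i <- r) E i) `^ s.
Proof.
move=> s1 E0; set S := \sum_(i <- r) E i.
have s0 : 0 < s by lra.
have S0 : 0 <= S by exact: sumr_ge0.
rewrite -[leRHS]mulr_powRB1// {1}/S mulr_suml.
rewrite !big_seq; apply: ler_sum => i ir.
rewrite -mulr_powRB1// ler_wpM2l//.
apply: ge0_ler_powR; rewrite ?nnegrE//; first lra.
rewrite /S (big_rem i)//= lerDl; exact: sumr_ge0.
Qed.

End Pow.

(** * Dyadic subdivision and averages on cubes *)

Section Dyadic.
Variables (R : realType) (n : nat).
Local Notation rV := 'rV[R]_n.
Local Notation mu := (lebesgue_rV R n).
Local Notation Om := (@unit_ball R n).
Local Notation test := (@test_function R n Om).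
Local Notation ix := {ffun 'I_n -> bool}.
Implicit Types (phi : rV -> R) (a : rV) (l : R).

Definition child a l (s : ix) : rV := \row_i (a ord0 i + l / 2 * (s i)%:R).

Lemma cube_child a l x : 0 < l -> cube a l x <-> exists s : ix, cube (child a l s) (l / 2) x.
Proof.
move=> l0; split.
  move=> Qx; exists [ffun i => a ord0 i + l / 2 <= x ord0 i] => i.
  have := Qx i; rewrite /= !in_itv/= mxE ffunE => /andP[h1 h2].
  by case: (leP (a ord0 i + l / 2) (x ord0 i)) => h3 /=; apply/andP; split; lra.
move=> [s Qx] i; have := Qx i; rewrite /= !in_itv/= mxE => /andP[h1 h2].
by move: h1 h2; case: (s i) => /= h1 h2; apply/andP; split; lra.
Qed.

Lemma child_inj a l (s t : ix) x : 0 < l ->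
  cube (child a l s) (l / 2) x -> cube (child a l t) (l / 2) x -> s = t.
Proof.
move=> l0 Qs Qt; apply/ffunP => i.
have := Qs i; have := Qt i; rewrite /= !in_itv/= !mxE => /andP[h1 h2] /andP[h3 h4].
by move: h1 h2 h3 h4; case: (s i); case: (t i) => //= h1 h2 h3 h4; exfalso; lra.
Qed.

Lemma mu_cubey a l : 0 < l -> (mu (cube a l) < +oo)%E.
Proof. by move=> l0; rewrite mu_cube ?ltry// ltW. Qed.

Lemma fine_mu_cube a l : 0 < l -> fine (mu (cube a l)) = l ^+ n.
Proof. by move=> l0; rewrite mu_cube// ltW. Qed.

Let mcube a l : measurable (cube a l : set rV) := measurable_cube a l.

Lemma Rint_child a l (f : rV -> R) : 0 < l -> bdm f ->
  \int[mu]_(x in cube a l) f x =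
  \sum_(s : ix) \int[mu]_(x in cube (child a l s) (l / 2)) f x.
Proof.
move=> l0 bf.
pose F (s : ix) x := f x * \1_(cube (child a l s) (l / 2)) x.
have bF s : bdm (F s).
  apply: bdmM => //; split; first exact: measurable_indic.
  exists 1 => x; rewrite indicE; case: (_ \in _); rewrite ?normr1 ?normr0//.
transitivity (\int[mu]_(x in cube a l) \sum_s F s x).
  apply: eq_Rintegral => x /set_mem /(cube_child _ _ l0)[s Qs].
  rewrite (bigD1 s)//= big1 ?addr0; last first.
    move=> t ts; rewrite /F indicE memNset ?mulr0// => Qt.
    by move: ts; rewrite (child_inj l0 Qt Qs) eqxx.
  by rewrite /F indicE mem_set// mulr1.
rewrite (bdm_Rint_sum (mcube a l) (mu_cubey a l0))//.
apply: eq_bigr => s _.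
rewrite (@Rint_support _ _ (cube (child a l s) (l / 2))).
- by apply: eq_Rintegral => x xQ; rewrite /F indicE xQ mulr1.
- by move=> x Qx; apply/cube_child => //; exists s.
- by move=> x nQ; rewrite /F indicE memNset// mulr0.
Qed.

Definition avg a l (f : rV -> R) := (l ^+ n)^-1 * \int[mu]_(x in cube a l) f x.

(** The integral of (f - c)^2 is a nonnegative quadratic polynomial in c; evaluate it at the mean of
    f. *)
Lemma jensen2 (D : set rV) (f : rV -> R) : measurable D -> (mu D < +oo)%E -> bdm f ->
  (\int[mu]_(x in D) f x) ^+ 2 <= fine (mu D) * \int[mu]_(x in D) (f x ^+ 2).
Proof.
move=> mD fD bf; set S := \int[mu]_(x in D) f x; set m := fine (mu D).
have m0 : 0 <= m by exact: fine_ge0.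
have H c : 0 <= \int[mu]_(x in D) (f x ^+ 2) - 2 * c * S + c ^+ 2 * m.
  have -> : \int[mu]_(x in D) (f x ^+ 2) - 2 * c * S + c ^+ 2 * m
     = \int[mu]_(x in D) ((f x - c) ^+ 2).
    rewrite -(@Rint_cst _ _ D mD (c ^+ 2)) -bdm_RintZ// -bdm_RintB//; last first.
    - by apply: bdmM => //; exact: bdm_cst.
    - exact: bdmX.
    rewrite -bdm_RintD//; last exact: bdm_cst.
      by apply: eq_Rintegral => x _; ring.
    by apply: bdmB; [exact: bdmX|apply: bdmM => //; exact: bdm_cst].
  by apply: Rintegral_ge0 => x _; exact: sqr_ge0.
have [m00|mn0] := eqVneq m 0.
  suff -> : S = 0 by rewrite expr0n mulr_ge0// Rintegral_ge0// => x _; exact: sqr_ge0.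
  apply/eqP; apply/negPn/negP => S0.
  (* For a null set the polynomial is affine in c, and this c would give it the value -1. *)
  have := H ((\int[mu]_(x in D) (f x ^+ 2) + 1) / (2 * S)).
  rewrite m00 mulr0 addr0; set X := Rintegral _ _ _.
  have -> : X - 2 * ((X + 1) / (2 * S)) * S = - 1 by field.
  lra.
have mp : 0 < m by rewrite lt_neqAle eq_sym mn0.
have := H (S / m); set X := Rintegral _ _ _.
have -> : X - 2 * (S / m) * S + (S / m) ^+ 2 * m = (m * X - S ^+ 2) / m by field.
by rewrite pmulr_lge0 ?invr_gt0// subr_ge0.
Qed.

Lemma avg_child a l (f : rV -> R) : 0 < l -> bdm f ->
  avg a l f = (2 ^+ n)^-1 * \sum_(s : ix) avg (child a l s) (l / 2) f.
Proof.
move=> l0 bf; rewrite /avg -mulr_sumr Rint_child// mulrA; congr (_ * _).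
by rewrite expr_div_n; field; rewrite !expf_neq0// gt_eqF.
Qed.

(** Two children are translates of each other by a vector with entries 0 or l / 2 up to sign, and by
    convexity the segments of the translation stay in the parent cube. So Jensen and
    [translation_estimate] apply. *)
Lemma avg_siblings a l phi (s t : ix) : 0 < l -> test phi ->
  (avg (child a l s) (l / 2) phi - avg (child a l t) (l / 2) phi) ^+ 2 <=
  n%:R * (l / 2) ^+ 2 / (l / 2) ^+ n * \int[mu]_(x in cube a l) gradsq phi x.
Proof.
move=> l0 tphi; set h := l / 2; have h0 : 0 < h by rewrite divr_gt0.
have hn : 0 < h ^+ n by rewrite exprn_gt0.
pose z := child a l t - child a l s.
have bphi := test_bdm tphi.
have -> : avg (child a l s) h phi - avg (child a l t) h phi =
    - ((h ^+ n)^-1 * \int[mu]_(x in cube (child a l s) h) (phi (x + z) - phi x)).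
  rewrite (bdm_RintB (mcube _ _) (mu_cubey _ h0)) //; last exact: bdm_shift.
  have E : cube (child a l s) h = (fun x => x + z) @^-1` cube (child a l t) h.
    apply/seteqP; split => x H i; have := H i; rewrite /= !in_itv/= !mxE => /andP[h1 h2];
    by apply/andP; split; lra.
  have -> : \int[mu]_(x in cube (child a l s) h) phi (x + z) =
      \int[mu]_(x in cube (child a l t) h) phi x.
    rewrite E (Rint_mpres (f := phi) (mpres_shift z) (mcube _ _))//.
    by apply: measurable_funTS; case: bphi.
  by rewrite /avg; ring.
rewrite sqrrN exprMn.
apply: (@le_trans _ _ ((h ^+ n)^-1 ^+ 2 * (h ^+ n *
   (n%:R * h ^+ 2 * \int[mu]_(x in cube a l) gradsq phi x)))).
  rewrite ler_pM2l ?exprn_gt0 ?invr_gt0//.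
  apply: le_trans (jensen2 (mcube _ _) (mu_cubey _ h0) _) _.
    by apply: bdmB => //; exact: bdm_shift.
  rewrite fine_mu_cube// ler_pM2l//.
  apply: translation_estimate => //; [exact: mu_cubey|exact: mu_cubey|exact: ltW| |].
    by move=> i; rewrite !mxE -/h ler_norml; case: (s i); case: (t i) => /=; apply/andP; split; lra.
  move=> x r Qx /andP[r0 r1] i; have := Qx i.
  rewrite /= !in_itv/= !mxE; rewrite -/h.
  have -> : l = h + h by rewrite /h; lra.
  by case: (s i); case: (t i) => /= /andP[h1 h2]; apply/andP; split; nra.
rewrite le_eqVlt; apply/orP; left; apply/eqP.
by set X := Rintegral _ _ _; field; rewrite gt_eqF.
Qed.

(** The average over the parent is the mean of the averages over its children, to which
    [avg_siblings] applies. *)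
Lemma avg_parent a l phi (s : ix) : 0 < l -> test phi ->
  `|avg (child a l s) (l / 2) phi - avg a l phi| <=
  Num.sqrt (n%:R * (l / 2) ^+ 2 / (l / 2) ^+ n * \int[mu]_(x in cube a l) gradsq phi x).
Proof.
move=> l0 tphi; set B := Num.sqrt _.
rewrite [avg a l phi]avg_child//; last exact: test_bdm.
set A := avg _ _ _.
have p0 : 0 < 2 ^+ n :> R by rewrite exprn_gt0.
have -> : A - (2 ^+ n)^-1 * \sum_s0 avg (child a l s0) (l / 2) phi =
   (2 ^+ n)^-1 * \sum_(t : ix) (A - avg (child a l t) (l / 2) phi).
  rewrite sumrB sumr_const card_ffun card_bool card_ord -[A *+ _]mulr_natl natrX; set S := \sum_s0 _.
  by field; rewrite gt_eqF.
rewrite normrM gtr0_norm ?invr_gt0// mulrC ler_pdivrMr//.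
apply: le_trans (ler_norm_sum _ _ _) _.
apply: (@le_trans _ _ (\sum_(t : ix) B)); last first.
  by rewrite sumr_const card_ffun card_bool card_ord -[B *+ _]mulr_natr natrX.
apply: ler_sum => t _.
by rewrite -sqrtr_sqr ler_wsqrtr//; exact: avg_siblings.
Qed.

End Dyadic.

Lemma gt0_powRD (R : realType) (x r s : R) : 0 < x -> x `^ (r + s) = x `^ r * x `^ s.
Proof. by move=> x0; rewrite powRD// (gt_eqF x0) implybT. Qed.

(** * Sobolev-Poincare inequality on cubes *)

Section SobolevPoincare.
Variables (R : realType) (n : nat) (q : R).
Local Notation rV := 'rV[R]_n.
Local Notation mu := (lebesgue_rV R n).
Local Notation Om := (@unit_ball R n).
Local Notation test := (@test_function R n Om).
Local Notation ix := {ffun 'I_n -> bool}.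
Implicit Types (phi : rV -> R) (a : rV) (l : R).

(* Positive exactly when q is subcritical. *)
Let b : R := n%:R + q - n%:R * q / 2.
Hypotheses (q2 : 2 <= q) (b0 : 0 < b).

Let q0 : 0 < q. Proof. exact: lt_le_trans (ltr0n _ 2) q2. Qed.

Let mcube a l : measurable (cube a l : set rV) := measurable_cube a l.

Definition osc a l phi := \int[mu]_(x in cube a l) (`|phi x - avg a l phi| `^ q).
Definition en a l phi := \int[mu]_(x in cube a l) gradsq phi x.

Lemma en_ge0 a l phi : 0 <= en a l phi.
Proof. by apply: Rintegral_ge0 => x _; exact: gradsq_ge0. Qed.

Lemma en_child a l phi : 0 < l -> test phi ->
  en a l phi = \sum_(s : ix) en (child a l s) (l / 2) phi.
Proof. by move=> l0 tp; apply: Rint_child => //; exact: gradsq_bdm. Qed.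

Lemma osc_bdm c phi : test phi -> bdm (fun x => `|phi x - c| `^ q).
Proof.
move=> tp; apply: bdm_powR; first exact: ltW.
by apply: bdmB; [exact: test_bdm|exact: bdm_cst].
Qed.

(** Inside each child, pass from the average over the child to that over the parent. By [powR_conv]
    this costs a factor k on the oscillation plus a multiple of the difference of averages, which
    [avg_parent] bounds by the energy. *)
Lemma osc_rec (k : R) : 1 < k -> exists2 C : R, 0 <= C & forall a l phi, 0 < l -> test phi ->
  osc a l phi <= k * (\sum_(s : ix) osc (child a l s) (l / 2) phi)
     + C * l `^ b * en a l phi `^ (q / 2).
Proof.
move=> k1; have [C C0 HC] := @powR_conv R k q k1 (le_trans (ler1n _ 2) q2).
exists (C * 2 ^+ n * n%:R `^ (q / 2)); first by rewrite !mulr_ge0// ?powR_ge0// exprn_ge0.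
move=> a l phi l0 tp; pose h := l / 2; have h0 : 0 < h by rewrite divr_gt0.
have E0 := en_ge0 a l phi.
set B := Num.sqrt (n%:R * h ^+ 2 / h ^+ n * en a l phi).
(* Origin of the exponent b: the volume h^n times (h^(2 - n))^(q / 2). *)
have hB : h ^+ n * B `^ q = n%:R `^ (q / 2) * h `^ b * en a l phi `^ (q / 2).
  rewrite /B -powR12_sqrt; last by rewrite !mulr_ge0// ?invr_ge0 ?exprn_ge0// ltW.
  rewrite -powRrM [2^-1 * q]mulrC -[n%:R * _ / _]mulrA.
  have -> : h ^+ 2 / h ^+ n = h `^ (2 - n%:R).
    by rewrite gt0_powRD// powRN -!powR_mulrn// ltW.
  rewrite powRM ?mulr_ge0 ?powR_ge0// powRM ?powR_ge0// -powRrM.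
  rewrite -powR_mulrn; last exact: ltW.
  have -> : h `^ b = h `^ n%:R * h `^ ((2 - n%:R) * (q / 2)).
    by rewrite -gt0_powRD//; congr (_ `^ _); rewrite /b; field.
  ring.
rewrite /osc (Rint_child _ l0); last exact: osc_bdm.
rewrite -/h mulr_sumr.
apply: (@le_trans _ _ (\sum_(s : ix) (k * osc (child a l s) h phi + C * (h ^+ n * B `^ q)))).
  apply: ler_sum => s _.
  have fh : (mu (cube (child a l s) h) < +oo)%E by exact: mu_cubey.
  have bo := osc_bdm (avg (child a l s) h phi) tp.
  have -> : C * (h ^+ n * B `^ q) = C * B `^ q * fine (mu (cube (child a l s) h)).
    by rewrite fine_mu_cube//; ring.
  rewrite -(@Rint_cst _ _ _ (mcube _ _)) -(bdm_RintZ (mcube _ _) fh)//.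
  have bko : bdm (fun x => k * `|phi x - avg (child a l s) h phi| `^ q).
    by apply: bdmM; [exact: bdm_cst|exact: bo].
  rewrite -(bdm_RintD (mcube _ _) fh bko (bdm_cst _ _)).
  apply: (bdm_le_Rint (mcube _ _) fh); first exact: osc_bdm.
    by apply: bdmD; [exact: bko|exact: bdm_cst].
  move=> x _.
  have := HC (phi x - avg (child a l s) h phi) (avg (child a l s) h phi - avg a l phi).
  rewrite addrA subrK => H; apply: le_trans H _; rewrite lerD2l ler_wpM2l//.
  apply: ge0_ler_powR; rewrite ?nnegrE ?sqrtr_ge0//; first exact: ltW.
  exact: avg_parent.
rewrite big_split /= lerD2l sumr_const card_ffun card_bool card_ord -[_ *+ _]mulr_natl natrX hB.
have hl : h `^ b <= l `^ b.
  apply: ge0_ler_powR; rewrite ?nnegrE ?ltW// /h; lra.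
set X := _ `^ (q / 2); set Y := _ `^ (q / 2).
have -> : 2 ^+ n * (C * (X * h `^ b * Y)) = C * 2 ^+ n * X * Y * h `^ b by ring.
have -> : C * 2 ^+ n * X * l `^ b * Y = C * 2 ^+ n * X * Y * l `^ b by ring.
by rewrite ler_wpM2l// !mulr_ge0// ?powR_ge0// exprn_ge0.
Qed.

(* Iterate [osc_rec] m times. The energies add up since E |-> E^(q/2) is superadditive, with
   geometric weights k 2^-b < 1; at scale l / 2^m the Lipschitz bound osc = O(l^(n+q)) takes over. *)
Lemma sobolev_poincare : exists2 A : R, 0 <= A & forall a l phi, 0 < l -> test phi ->
  osc a l phi <= A * l `^ b * en a l phi `^ (q / 2).
Proof.
have q2' := q2; have b0' := b0; have q0' := q0.
have s1 : 1 <= q / 2 by lra.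
(* With k = min (2, 2^(b / 2)), the ratio k 2^-b is at most 2^(-b / 2) < 1, and k 2^-q is at most 1
   / 2, which halves the remainder at each generation. *)
pose P2 : R := 2 `^ (b / 2).
have P21 : 1 < P2.
  have : 1 `^ (b / 2) < P2 by apply: gt0_ltr_powR; rewrite ?nnegrE ?divr_gt0// ltr1n.
  by rewrite powR1.
pose k : R := Num.min 2 P2.
have k1 : 1 < k by rewrite lt_min ltr1n P21.
have k2 : k <= 2 by rewrite /k ge_min lexx.
have k3 : k * 2 `^ (- b) < 1.
  have -> : 2 `^ (- b) = (P2 * P2)^-1.
    by rewrite powRN /P2 -gt0_powRD//; congr (_ `^ _)^-1; field.
  apply: (@le_lt_trans _ _ (P2 * (P2 * P2)^-1)).
    by rewrite ler_wpM2r ?invr_ge0 ?mulr_ge0 ?powR_ge0// /k ge_min lexx orbT.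
  by rewrite invfM mulrA divff ?gt_eqF ?(lt_trans ltr01)// mul1r invf_lt1// (lt_trans ltr01).
set r := k * 2 `^ (- b) in k3.
have [C C0 HC] := osc_rec k1.
(* The fixed point of A = r A + C, so that the same constant serves at every generation. *)
pose A := C / (1 - r).
have A0 : 0 <= A by rewrite divr_ge0//; lra.
have AE : r * A + C = A by rewrite /A; field; rewrite gt_eqF//; lra.
exists A => // a l phi l0 tp.
have [L L0 HL] := smooth_lip tp.
have bphi := test_bdm tp.
have key (m : nat) : forall a l, 0 < l -> osc a l phi <=
    A * l `^ b * en a l phi `^ (q / 2) + 2 ^- m * (L `^ q * l `^ (n%:R + q)).
  elim: m => [|m IH] {l l0} {}a l l0.
    apply: (@le_trans _ _ (L `^ q * l `^ (n%:R + q))); last first.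
      by rewrite expr0 invr1 mul1r lerDr mulr_ge0 ?powR_ge0// mulr_ge0 ?powR_ge0.
    have ln : 0 < l ^+ n by rewrite exprn_gt0.
    have fl : (mu (cube a l) < +oo)%E by exact: mu_cubey.
    have -> : L `^ q * l `^ (n%:R + q) = (L * l) `^ q * fine (mu (cube a l)).
      rewrite (powRM _ L0 (ltW l0)) fine_mu_cube// gt0_powRD// (powR_mulrn _ (ltW l0)); ring.
    rewrite -(@Rint_cst _ _ _ (mcube _ _)).
    apply: (bdm_le_Rint (mcube _ _) fl); [exact: osc_bdm|exact: bdm_cst|move=> x Qx].
    apply: ge0_ler_powR; rewrite ?nnegrE ?mulr_ge0//; [exact: ltW|exact: ltW|].
    have -> : phi x - avg a l phi = (l ^+ n)^-1 * \int[mu]_(y in cube a l) (phi x - phi y).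
      rewrite (bdm_RintB (mcube _ _) fl (bdm_cst _ _) bphi).
      by rewrite Rint_cst// fine_mu_cube// mulrBr mulrCA mulVf ?mulr1// gt_eqF.
    rewrite normrM gtr0_norm ?invr_gt0// mulrC ler_pdivrMr//.
    have bb : bdm (fun y => phi x - phi y) by apply: bdmB => //; exact: bdm_cst.
    apply: le_trans (bdm_normr_Rint (mcube _ _) fl bb) _.
    rewrite -(fine_mu_cube a l0) -(@Rint_cst _ _ _ (mcube _ _)).
    apply: (bdm_le_Rint (mcube _ _) fl); [exact: bdm_norm|exact: bdm_cst|move=> y Qy].
    have := HL y (x - y) l (ltW l0); rewrite [y + _]addrC subrK; apply => i.
    have := Qx i; have := Qy i; rewrite /= !in_itv/= => /andP[h1 h2] /andP[h3 h4].
    by rewrite !mxE ler_norml; apply/andP; split; lra.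
  have h0 : 0 < l / 2 by rewrite divr_gt0.
  apply: le_trans (HC a l phi l0 tp) _.
  have lp s : (l / 2) `^ s = 2 `^ (- s) * l `^ s.
    by rewrite (powRM _ (ltW l0)) ?invr_ge0// mulrC -powR_inv1// -powRrM mulN1r.
  have S1 : \sum_(s : ix) osc (child a l s) (l / 2) phi <=
      A * (2 `^ (- b) * l `^ b) * en a l phi `^ (q / 2)
      + 2 ^- m * (L `^ q * (2 `^ (- q) * l `^ (n%:R + q))).
    apply: le_trans; first by apply: ler_sum => s _; exact: (IH (child a l s) _ h0).
    rewrite big_split /= lerD//.
      rewrite -mulr_sumr lp; apply: ler_wpM2l.
        by apply: mulr_ge0 => //; apply: mulr_ge0; exact: powR_ge0.
      by rewrite (en_child a l0 tp); apply: powR_superadd => // s; exact: en_ge0.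
    (* The 2^n children contribute (l / 2)^(n + q) each, a gain of 2^-q in total. *)
    rewrite sumr_const card_ffun card_bool card_ord -[_ *+ _]mulr_natl natrX lp.
    rewrite opprD gt0_powRD//.
    rewrite [2 `^ (- n%:R)]powRN powR_mulrn//.
    rewrite le_eqVlt; apply/orP; left; apply/eqP.
    by field; rewrite !expf_neq0// pnatr_eq0.
  have {S1} := ler_wpM2l (ltW (lt_trans ltr01 k1)) S1.
  set S := \sum_s _; set P := l `^ b; set T := l `^ (_ + _); set E := en _ _ _ `^ _.
  move=> S1.
  have E0 : 0 <= E by exact: powR_ge0.
  have P0 : 0 <= P by exact: powR_ge0.
  have T0 : 0 <= L `^ q * T by rewrite mulr_ge0 ?powR_ge0.
  have kq : k * 2 `^ (- q) <= 2^-1.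
    have : 2 `^ (- q) <= 2 `^ (- 2%:R) :> R by apply: ler_powR; rewrite ?ler1n//; lra.
    rewrite [2 `^ (- 2%:R)]powRN powR_mulrn// => h.
    have := powR_ge0 2 (- q); nra.
  have m0 : 0 <= 2 ^- m :> R by rewrite invr_ge0 exprn_ge0.
  have -> : A * P * E + 2 ^- m.+1 * (L `^ q * T) =
     (k * (A * (2 `^ (- b) * P) * E) + C * P * E) + 2 ^- m * (L `^ q * T) * 2^-1.
    rewrite -{1}AE /r exprS invfM; ring.
  have : k * (2 ^- m * (L `^ q * (2 `^ (- q) * T))) <= 2 ^- m * (L `^ q * T) * 2^-1.
    have -> : k * (2 ^- m * (L `^ q * (2 `^ (- q) * T))) =  2 ^- m * (L `^ q * T) * (k * 2 `^ (- q)) by ring.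
    by rewrite ler_wpM2l// mulr_ge0.
  move: S1; rewrite mulrDr; lra.
apply: (@le_invn _ _ _ (L `^ q * l `^ (n%:R + q))) => m.
apply: le_trans (key m a l l0) _; rewrite lerD2l mulrC.
rewrite ler_wpM2l ?mulr_ge0 ?powR_ge0// lef_pV2 ?posrE ?exprn_gt0 ?ltr0n//.
by rewrite -natrX ler_nat ltn_expl.
Qed.

End SobolevPoincare.

(** * Poincare, Sobolev and Rellich for test functions on the ball *)

Section Compactness.
Variables (R : realType) (n : nat) (q : R).
Local Notation rV := 'rV[R]_n.
Local Notation mu := (lebesgue_rV R n).
Local Notation Om := (@unit_ball R n).
Local Notation test := (@test_function R n Om).
Local Notation ix := {ffun 'I_n -> bool}.
Implicit Types (phi : rV -> R) (a : rV) (l : R).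
Hypotheses (q2 : 2 <= q) (b0 : 0 < n%:R + q - n%:R * q / 2) (n0 : (0 < n)%N).

Let mcube a l : measurable (cube a l : set rV) := measurable_cube a l.
Let mO : measurable (Om : set rV) := @measurable_unit_ball R n.
Let fO : (mu Om < +oo)%E := @mu_unit_ball R n.

Definition dir phi := \int[mu]_(x in Om) gradsq phi x.

Lemma dir_ge0 phi : 0 <= dir phi.
Proof. by apply: Rintegral_ge0 => x _; exact: gradsq_ge0. Qed.

Lemma gradsq_out phi x : test phi -> ~ Om x -> gradsq phi x = 0.
Proof.
move=> tp nx; rewrite /gradsq big1// => i _.
by rewrite (test_out (test_partial i tp) nx) expr0n.
Qed.

(** A translation by 2 along the first axis moves the ball off itself, so phi (x + z) = 0 for x in
    the ball and [translation_estimate] with d = 2 bounds the integral of phi^2. *)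
Lemma poincare phi : test phi ->
  \int[mu]_(x in Om) (phi x ^+ 2) <= 4 * n%:R * dir phi.
Proof.
move=> tp; pose i0 : 'I_n := Ordinal n0.
pose z : rV := 2 *: delta_mx ord0 i0.
pose Q := cube (const_mx (-1) : rV) 4.
have OQ : Om `<=` Q.
  move=> x x1 k; rewrite /= in_itv/= !mxE.
  have := le_lt_trans (coord_le_enorm x k) x1; rewrite ltr_norml => /andP[h1 h2].
  by apply/andP; split; lra.
have -> : \int[mu]_(x in Om) (phi x ^+ 2) = \int[mu]_(x in Om) ((phi (x + z) - phi x) ^+ 2).
  apply: eq_Rintegral => x /set_mem Ox.
  rewrite (@test_out _ _ _ (x + z) tp) ?sub0r ?sqrrN// => Oz.
  have := le_lt_trans (coord_le_enorm x i0) Ox.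
  have := le_lt_trans (coord_le_enorm (x + z) i0) Oz.
  rewrite !mxE !eqxx mulr1 !ltr_norml => /andP[h1 h2] /andP[h3 h4]; lra.
rewrite /dir -[\int[mu]_(x in Om) gradsq phi x](Rint_support OQ); last by move=> x; exact: gradsq_out.
have -> : 4 * n%:R = n%:R * 2 ^+ 2 :> R by rewrite mulrC; congr (_ * _); rewrite -natrX.
apply: translation_estimate => //; [exact: mcube|exact: mu_cubey| |].
  move=> i; rewrite !mxE eqxx /=; case: eqP => _; rewrite ?mulr1 ?mulr0 ?normr0// ger0_norm//.
move=> x t x1 /andP[t0 t1] k; rewrite /= in_itv/= !mxE eqxx /=.
have := le_lt_trans (coord_le_enorm x k) x1; rewrite ltr_norml => /andP[h1 h2].
by case: eqP => _ /=; rewrite ?mulr1 ?mulr0 ?addr0; apply/andP; split; lra.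
Qed.

Lemma avg_sq_le a l phi : 0 < l -> test phi ->
  avg a l phi ^+ 2 <= (l ^+ n)^-1 * (4 * n%:R * dir phi).
Proof.
move=> l0 tp; have ln : 0 < l ^+ n by rewrite exprn_gt0.
have b2 : bdm (fun x => phi x ^+ 2) by apply: bdmX; exact: test_bdm.
apply: (@le_trans _ _ ((l ^+ n)^-1 * \int[mu]_(x in cube a l) (phi x ^+ 2))).
  rewrite /avg exprMn expr2 -mulrA ler_pM2l ?invr_gt0// ler_pdivrMl//.
  by rewrite -(fine_mu_cube a l0); apply: jensen2 => //; [exact: mu_cubey|exact: test_bdm].
rewrite ler_pM2l ?invr_gt0//; apply: le_trans (poincare tp).
(* The cube may stick out of the ball, so both integrals are compared with the one over the
   union. *)
pose D := cube a l `|` Om.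
have mD : measurable D by exact: measurableU.
have fD : (mu D < +oo)%E.
  by apply: le_lt_trans (measureU2 _ _ _) _ => //; rewrite lte_add_pinfty// mu_cubey.
apply: (@le_trans _ _ (\int[mu]_(x in D) (phi x ^+ 2))).
  by apply: Rint_subset => //; [move=> x Qx; left|move=> x; exact: sqr_ge0].
rewrite (@Rint_support _ _ Om D)//; first by move=> x Ox; right.
by move=> x nO; rewrite (test_out tp)// expr0n.
Qed.

Definition phi_pow phi := \int[mu]_(x in Om) (`|phi x| `^ q).

Lemma pow_bdm phi : test phi -> bdm (fun x => `|phi x| `^ q).
Proof.
by move=> tp; apply: bdm_powR; [exact: le_trans q2|exact: test_bdm].
Qed.

(* The averages of phi over the 2^(nk) subcubes of generation k are at most m in absolute value. *)
Fixpoint small k a l phi (m : R) : Prop :=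
  match k with
  | 0 => `|avg a l phi| <= m
  | k'.+1 => forall s : ix, small k' (child a l s) (l / 2) phi m
  end.

(** On each subcube of generation k, |phi|^q is bounded through the oscillation and m^q. The
    oscillations carry the weight (l / 2^k)^b, which tends to 0 as k grows; this is the source of
    compactness. *)
Lemma small_pow : exists2 A : R, 0 <= A & forall k a l phi m, 0 < l -> 0 <= m -> test phi ->
  small k a l phi m ->
  \int[mu]_(x in cube a l) (`|phi x| `^ q) <=
  A * (l / 2 ^+ k) `^ (n%:R + q - n%:R * q / 2) * en a l phi `^ (q / 2)
  + 2 `^ q * m `^ q * l ^+ n.
Proof.
have q0 : 0 <= q by exact: le_trans q2.
have [A A0 HA] := sobolev_poincare q2 b0.
exists (2 `^ q * A); first by rewrite mulr_ge0// powR_ge0.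
elim=> [|k IH] a l phi m l0 m0 tp /=.
  move=> H; rewrite expr0 divr1.
  have fQ := mu_cubey a l0.
  apply: (@le_trans _ _ (2 `^ q * (osc q a l phi + m `^ q * l ^+ n))).
    rewrite -(fine_mu_cube a l0) -(@Rint_cst _ _ _ (mcube _ _)).
    rewrite -(bdm_RintD (mcube _ _) fQ (osc_bdm q2 _ tp) (bdm_cst _ _)).
    have bb : bdm (fun x => `|phi x - avg a l phi| `^ q + m `^ q).
      by apply: bdmD; [exact: osc_bdm|exact: bdm_cst].
    rewrite -(bdm_RintZ (mcube _ _) fQ)//.
    apply: (bdm_le_Rint (mcube _ _) fQ); first exact: pow_bdm.
      by apply: bdmM => //; exact: bdm_cst.
    move=> x _; have := powR_add2 (phi x - avg a l phi) (avg a l phi) q0.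
    rewrite subrK => h; apply: le_trans h _; rewrite ler_wpM2l ?powR_ge0// lerD2l.
    by apply: ge0_ler_powR; rewrite ?nnegrE.
  rewrite mulrDr [2 `^ q * (m `^ q * _)]mulrA lerD2r.
  by have := ler_wpM2l (powR_ge0 2 q) (HA a l phi l0 tp); rewrite !mulrA.
move=> H; have h0 : 0 < l / 2 by rewrite divr_gt0.
rewrite (Rint_child a l0); last exact: pow_bdm.
apply: le_trans; first by apply: ler_sum => s _; exact: (IH (child a l s) _ _ _ h0 m0 tp (H s)).
rewrite big_split /= lerD//.
  rewrite -mulr_sumr.
  have -> : l / 2 / 2 ^+ k = l / 2 ^+ k.+1 by rewrite exprS invfM mulrA.
  apply: ler_wpM2l; first by rewrite !mulr_ge0 ?powR_ge0.
  rewrite (en_child a l0 tp); apply: powR_superadd => [|s]; last exact: en_ge0.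
  by rewrite ler_pdivlMr// mul1r.
rewrite sumr_const card_ffun card_bool card_ord -[_ *+ _]mulr_natl natrX.
rewrite le_eqVlt; apply/orP; left; apply/eqP.
by rewrite expr_div_n; field; rewrite expf_neq0// pnatr_eq0.
Qed.

Lemma Om_cube2 : Om `<=` cube (const_mx (-1) : rV) 2.
Proof. exact: unit_ball_cube. Qed.

Lemma en_dir phi : test phi -> en (const_mx (-1)) 2 phi = dir phi.
Proof.
by move=> tp; rewrite /en (Rint_support Om_cube2)// => x; exact: gradsq_out.
Qed.

Lemma pow_cube phi : test phi ->
  \int[mu]_(x in cube (const_mx (-1)) 2) (`|phi x| `^ q) = phi_pow phi.
Proof.
move=> tp; rewrite (Rint_support Om_cube2)// => x nO.
by rewrite (test_out tp nO) normr0 powR0// gt_eqF// (lt_le_trans _ q2).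
Qed.

(** Generation 0 of [small_pow] on the cube of side 2 around the ball, the average being bounded by
    [avg_sq_le]. *)
Lemma embedding : exists2 S : R, 0 <= S & forall phi, test phi ->
  phi_pow phi <= S * dir phi `^ (q / 2).
Proof.
have [A A0 HA] := small_pow.
pose c : R := (2 ^+ n)^-1 * (4 * n%:R).
have c0 : 0 <= c by rewrite mulr_ge0// invr_ge0 exprn_ge0.
pose b := n%:R + q - n%:R * q / 2.
exists (A * 2 `^ b + 2 `^ q * c `^ (q / 2) * 2 ^+ n).
  by rewrite addr_ge0// !mulr_ge0 ?powR_ge0// exprn_ge0.
move=> phi tp; have d0 := dir_ge0 phi.
have l0 : 0 < 2 :> R by [].
have cd : 0 <= c * dir phi by rewrite mulr_ge0.
have Hs : small 0 (const_mx (-1)) 2 phi (Num.sqrt (c * dir phi)).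
  by rewrite /= -sqrtr_sqr ler_wsqrtr// /c -mulrA avg_sq_le.
have := HA 0%N (const_mx (-1)) 2 phi _ l0 (sqrtr_ge0 _) tp Hs.
rewrite pow_cube// en_dir// expr0 divr1.
rewrite -powR12_sqrt// -powRrM [2^-1 * q]mulrC powRM//.
move=> H; apply: le_trans H _.
by rewrite le_eqVlt; apply/orP; left; apply/eqP; rewrite /b; ring.
Qed.

Lemma gradsqB_le phi psi x : test phi -> test psi ->
  gradsq (fun x => phi x - psi x) x <= 2 * (gradsq phi x + gradsq psi x).
Proof.
move=> t1 t2; rewrite /gradsq -big_split mulr_sumr; apply: ler_sum => i _.
have -> : (fun x => phi x - psi x) = (fun x => phi x + -1 * psi x).
  by apply/funext => y; rewrite mulN1r.
rewrite partialD; [|exact: test_smooth|by apply: test_smooth; exact: testZ].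
rewrite partialZ; last exact: test_smooth.
rewrite /=; set u := partial i phi x; set v := partial i psi x.
have -> : 2 * (u ^+ 2 + v ^+ 2) = (u + -1 * v) ^+ 2 + (u + v) ^+ 2 by ring.
by rewrite lerDl sqr_ge0.
Qed.

Lemma testB phi psi : test phi -> test psi -> test (fun x => phi x - psi x).
Proof.
move=> t1 t2; have -> : (fun x => phi x - psi x) = (fun x => phi x + -1 * psi x).
  by apply/funext => y; rewrite mulN1r.
by apply: testD => //; exact: testZ.
Qed.

Lemma dirB_le phi psi : test phi -> test psi ->
  dir (fun x => phi x - psi x) <= 2 * (dir phi + dir psi).
Proof.
move=> t1 t2; have b1 := gradsq_bdm t1; have b2 := gradsq_bdm t2.
rewrite /dir -bdm_RintD// -bdm_RintZ//; last exact: bdmD.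
apply: bdm_le_Rint => //; first exact/gradsq_bdm/testB.
  by apply: bdmM; [exact: bdm_cst|exact: bdmD].
by move=> x _; exact: gradsqB_le.
Qed.

Lemma avgB a l phi psi : 0 < l -> test phi -> test psi ->
  avg a l (fun x => phi x - psi x) = avg a l phi - avg a l psi.
Proof.
move=> l0 t1 t2; rewrite /avg (bdm_RintB (mcube _ _) (mu_cubey _ l0)) ?mulrBr//;
exact: test_bdm.
Qed.

(** By compactness of [-M, M] the image of the ultrafilter has a cluster point, and an ultrafilter
    converges to its cluster points. *)
Lemma ultra_real (T : Type) (U : set_system T) (f : T -> R) (M : R) : UltraFilter U ->
  (forall t, `|f t| <= M) ->
  exists c, forall e, 0 < e -> U [set t | `|f t - c| <= e].
Proof.
move=> UU fM; have PU : ProperFilter U by exact: ultra_proper.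
have HM : U (f @^-1` `[- M, M]%classic).
  by apply: filterS filterT => t _; rewrite /= in_itv/= -ler_norml; exact: fM.
have [c [_ cl]] := @segment_compact R (- M) M _ (fmap_proper_filter f PU) HM.
exists c => e e0.
have [//|H] := in_ultra_setVsetC [set t | `|f t - c| <= e] UU.
have HB : nbhs c (ball c e) by exact: nbhsx_ballx.
have HC : U (f @^-1` (f @` (~` [set t | `|f t - c| <= e]))).
  by apply: filterS H => t nt; exists t.
have [] := cl (f @` (~` [set t | `|f t - c| <= e])) (ball c e) HC HB.
move=> _ [[t nt <-]]; rewrite -ball_normE /= => h; exfalso; apply: nt => /=.
by rewrite distrC ltW.
Qed.

(** By [avg_sq_le] each average is bounded along the family, hence converges along [U]. Generation k
    involves finitely many averages, and a filter is closed under finite intersections. *)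
Lemma ultra_small (T : Type) (U : set_system T) (F : T -> rV -> R) (M : R) :
  UltraFilter U -> (forall t, test (F t)) -> (forall t, dir (F t) <= M) ->
  forall k a l m, 0 < l -> 0 < m -> exists2 D, U D &
    forall s t, D s -> D t -> small k a l (fun x => F s x - F t x) m.
Proof.
move=> UU tF FM; have PU : ProperFilter U by exact: ultra_proper.
elim => [|k IH] a l m l0 m0 /=.
  pose B : R := Num.sqrt ((l ^+ n)^-1 * (4 * n%:R * M)).
  have [|c Hc] := @ultra_real _ U (fun t => avg a l (F t)) B UU.
    move=> t; rewrite -sqrtr_sqr ler_wsqrtr//; apply: le_trans (avg_sq_le _ l0 (tF t)) _.
    by rewrite ler_wpM2l ?invr_ge0 ?exprn_ge0// ?(ltW l0)// ler_wpM2l// mulr_ge0.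
  exists [set t | `|avg a l (F t) - c| <= m / 2]; first by apply: Hc; rewrite divr_gt0.
  move=> s t /= Ds Dt; rewrite avgB//.
  by apply: le_trans (ler_distD c _ _) _; rewrite [m]splitr lerD// distrC.
have h0 : 0 < l / 2 by rewrite divr_gt0.
have H (s : ix) : exists D, U D /\
    forall t u, D t -> D u -> small k (child a l s) (l / 2) (fun x => F t x - F u x) m.
  by have [D UD HD] := IH (child a l s) (l / 2) m h0 m0; exists D.
have [D HD] := choice H.
exists [set t | forall s, D s t].
  by apply: (filter_forall (f := D)) => s; have [] := HD s.
by move=> t u Dt Du s; apply: (HD s).2.
Qed.

(* Rellich's theorem: along an ultrafilter a bounded family is Cauchy in L^q, because the finitely
   many averages of generation k converge and the oscillations are small for large k. *)
Lemma ultra_compact (T : Type) (U : set_system T) (F : T -> rV -> R) (M : R) :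
  UltraFilter U -> (forall t, test (F t)) -> (forall t, dir (F t) <= M) ->
  forall e, 0 < e -> exists2 D, U D &
    forall s t, D s -> D t -> phi_pow (fun x => F s x - F t x) <= e.
Proof.
move=> UU tF FM e e0.
have q0 : 0 < q by exact: lt_le_trans q2.
have [A A0 HA] := small_pow.
pose b := n%:R + q - n%:R * q / 2; have bp : 0 < b := b0; rewrite -/b in HA.
(* The difference of two members has Dirichlet integral at most 4 M by [dirB_le]. *)
pose W := A * `|4 * M| `^ (q / 2).
have W0 : 0 <= W by rewrite mulr_ge0// powR_ge0.
have W1 : 0 < W + 1 by apply: ltr_wpDl.
(* The side below which the oscillation term is at most e / 2; the denominator is W + 1 because W
   may be 0. *)
pose r := (e / 2 / (W + 1)) `^ b^-1.
have r0 : 0 < r by rewrite powR_gt0// !divr_gt0.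
have [k hk] : exists k : nat, 2 / 2 ^+ k <= r.
  exists (Num.truncn (2 / r)).+1; rewrite ler_pdivrMr ?exprn_gt0//.
  rewrite mulrC -ler_pdivrMr//; apply: le_trans (ltW (truncnS_gt _)) _.
  by rewrite -natrX ler_nat ltnW// ltn_expl.
have p0 : 0 < 2 `^ q * 2 ^+ n :> R by rewrite mulr_gt0// ?exprn_gt0// powR_gt0.
(* Chosen so that the average term 2^q m^q 2^n equals e / 2. *)
pose m := (e / 2 / (2 `^ q * 2 ^+ n)) `^ q^-1.
have m0 : 0 < m by rewrite powR_gt0// !divr_gt0.
have l2 : 0 < 2 :> R by [].
have [D UD HD] := ultra_small UU tF FM k (const_mx (-1)) l2 m0.
exists D => // s t Ds Dt.
have tst : test (fun x => F s x - F t x) by exact: testB.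
have := HA k (const_mx (-1)) 2 _ m l2 (ltW m0) tst (HD s t Ds Dt).
rewrite pow_cube// en_dir// => H; apply: le_trans H _.
rewrite [e]splitr lerD//.
  apply: (@le_trans _ _ (W * (e / 2 / (W + 1)))).
    rewrite /W mulrAC ler_pM ?mulr_ge0 ?powR_ge0//.
      rewrite ler_wpM2l//; apply: ge0_ler_powR; rewrite ?nnegrE ?dir_ge0 ?divr_ge0// ?(ltW q0)//.
      apply: le_trans (dirB_le _ _) _ => //.
      apply: le_trans (ler_norm _).
      by move: (FM s) (FM t); move: (dir (F s)) (dir (F t)) => u v hu hv; lra.
    have -> : e / 2 / (W + 1) = r `^ b.
      by rewrite /r -powRrM mulVf ?gt_eqF// powRr1// !divr_ge0// ltW.
    apply: ge0_ler_powR; [exact: ltW bp| | |exact: hk]; rewrite nnegrE.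
      by rewrite divr_ge0// exprn_ge0.
    exact: ltW.
  rewrite mulrCA ler_piMr ?divr_ge0 ?(ltW e0)//.
  by rewrite ler_pdivrMr// mul1r lerDl.
rewrite /m -powRrM mulVf ?gt_eqF// powRr1; last by rewrite !divr_ge0 ?(ltW e0) ?(ltW p0).
by rewrite mulrAC mulrC divfK// gt_eqF.
Qed.

End Compactness.

(** * The fundamental lemma of the calculus of variations *)

Section Fundamental.
Variables (R : realType) (n : nat).
Local Notation rV := 'rV[R]_n.
Local Notation RR := (measurableTypeR R).
Local Notation mu := (lebesgue_rV R n).
Local Notation Om := (@unit_ball R n).
Local Notation test := (@test_function R n Om).
Let mO : measurable (Om : set rV) := @measurable_unit_ball R n.
Let fO : (mu Om < +oo)%E := @mu_unit_ball R n.

(** Open orthants: their indicators are limits of products of one-variable functions of the kind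
    [step]. *)
Definition rays (c : rV) : set rV := box (fun i => `]c ord0 i, +oo[%classic).

Lemma measurable_rays c : measurable (rays c).
Proof. exact: measurable_box. Qed.

Lemma rays_setI c d : rays c `&` rays d = rays (\row_i Num.max (c ord0 i) (d ord0 i)).
Proof.
apply/seteqP; split => x /=.
  move=> [hc hd] i; have := hc i; have := hd i.
  by rewrite /= !in_itv/= !andbT mxE gt_max => -> ->.
move=> h; split => i; have := h i; rewrite /= !in_itv/= !andbT mxE gt_max => /andP[h1 h2];
  [exact: h1|exact: h2].
Qed.

(** The half-space x_i > a is the union over k of the orthants whose corner has i-th coordinate a
    and all others -k. *)
Lemma measurable_rays_gen : @measurable _ rV = <<s range rays >>.
Proof.
apply/seteqP; split; last first.
  apply: smallest_sub; first exact: sigma_algebra_measurable.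
  by move=> _ [c _ <-]; exact: measurable_rays.
have sa : sigma_algebra setT <<s range rays >> by exact: smallest_sigma_algebra.
have sC A : <<s range rays >> A -> <<s range rays >> (~` A) by exact: sigma_algebraC.
have sU (F : nat -> set rV) : (forall k, <<s range rays >> (F k)) -> <<s range rays >> (\bigcup_k F k).
  exact: sigma_algebra_bigcup.
apply: smallest_sub => //.
rewrite -bigcup_seq => A [i _ [B mB <-]] /=; rewrite setTI.
suff H : (@measurable _ RR) `<=` [set B | <<s range rays >> ((fun x : rV => x ord0 i) @^-1` B)].
  exact: H.
rewrite RGenOInfty.measurableE; apply: smallest_sub.
  split => /=.
  - by rewrite preimage_set0; exact: sigma_algebra0.
  - by move=> C HC; rewrite setTD preimage_setC; exact: sC.
  - by move=> F HF; rewrite preimage_bigcup; exact: sU.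
move=> _ [a ->] /=.
have -> : (fun x : rV => x ord0 i) @^-1` `]a, +oo[%classic =
    \bigcup_k rays (\row_j (if j == i then a else - k%:R)).
  apply/seteqP; split => x /=; last first.
    by move=> [k _ /(_ i)]; rewrite /= mxE eqxx.
  move=> ax.
  have [k hk] : exists k : nat, forall i, `|x ord0 i| < k%:R.
    exists (\max_i (Num.truncn `|x ord0 i|).+1)%N => j.
    apply: (lt_le_trans (truncnS_gt _)).
    by rewrite ler_nat; exact: (leq_bigmax (F := fun i => (Num.truncn `|x ord0 i|).+1)).
  exists k => // j; rewrite /= mxE; case: eqP => [->//|_].
  by rewrite in_itv/= andbT; have := hk j; rewrite ltr_norml => /andP[].
by apply: sU => k; apply: sub_sigma_algebra; exists (\row_j (if j == i then a else - k%:R)).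
Qed.

(** As [flat 0] takes values in [0, 1) and is positive exactly for t > 0, this tends to the
    indicator of t > 0. Being polynomial in [flat 0], it stays within [sm]. *)
Definition step k (t : R) : R := 1 - (1 - flat 0 t) ^+ k.

Lemma flat01 (t : R) : 0 <= flat 0 t < 1.
Proof.
rewrite flat_ge0 /= /flat; case: ifP => // t0.
by rewrite expr0 mul1r expR_lt1 oppr_lt0 invr_gt0.
Qed.

Lemma step01 k t : 0 <= step k t <= 1.
Proof.
have /andP[f0 f1] := flat01 t.
have h0 : 0 <= 1 - flat 0 t by lra.
rewrite /step subr_ge0 exprn_ile1//=; last by lra.
by rewrite gerBl exprn_ge0.
Qed.

Lemma step_le0 k t : t <= 0 -> step k t = 0.
Proof. by move=> t0; rewrite /step /flat ltNge t0 /= subr0 expr1n subrr. Qed.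

Lemma step_cvg t : 0 < t -> step k t @[k --> \oo] --> (1 : R).
Proof.
move=> t0; rewrite -[X in _ --> X]subr0; apply: cvgB; first exact: cvg_cst.
apply: cvg_expr; have /andP[_ f1] := flat01 t.
have f0 : 0 < flat 0 t by rewrite /flat t0 mulr_gt0 ?exprn_gt0 ?invr_gt0 ?expR_gt0.
by rewrite ger0_norm; lra.
Qed.

Lemma sm_step k (u : rV -> R) : sm u -> sm (fun x => step k (u x)).
Proof.
move=> su; have -> : (fun x => step k (u x)) =
    cst 1 + cst (-1) * \prod_(j < k) (cst 1 + cst (-1) * (flat 0 \o u)).
  apply/funext => x; rewrite !fctE prodr_const card_ord /step.
  have -> : forall (f : rV -> R) (m : nat), (f ^+ m) x = f x ^+ m.
    by move=> f; elim=> // m IH; rewrite !exprS -IH.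
  by rewrite /= !mulN1r.
apply: sm_add; first exact: sm_cst.
apply: sm_mul; first exact: sm_cst.
apply: sm_prod => _; apply: sm_add; first exact: sm_cst.
by apply: sm_mul; [exact: sm_cst|exact: sm_flat].
Qed.

Lemma test_of_support (r : R) (f : rV -> R) : 0 <= r < 1 -> smooth f ->
  (forall x, r < enorm x -> f x = 0) -> test f.
Proof.
move=> /andP[r0 r1] sf f0; split=> //.
exists [set x | enorm x <= r]; last by move=> x /= /negP; rewrite -ltNge => /f0.
split; last by move=> x /= /le_lt_trans; apply.
pose C : set rV := [set x | forall i, `[- r, r]%classic (x ord0 i)].
have cC : compact C.
  by apply: (@rV_compact _ _ (fun _ => `[- r, r]%classic)) => i; exact: segment_compact.
apply: (subclosed_compact _ cC).
  by apply: (@closed_comp _ _ (@enorm R n) [set y | y <= r]) => [x _|];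
    [exact: enorm_continuous|exact: closed_le].
move=> x /= xr i; rewrite /= in_itv/= -ler_norml.
exact: le_trans (coord_le_enorm x i) xr.
Qed.

Definition bump (r : R) (x : rV) : R := flat 0 (r ^+ 2 - enorm x ^+ 2).

Lemma smooth_bump r : smooth (bump r).
Proof.
apply: smP; have -> : bump r = flat 0 \o (cst (r ^+ 2) + cst (-1) *
    \sum_(i < n) ((fun x : rV => x ord0 i) * (fun x : rV => x ord0 i))).
  apply/funext => x; rewrite /bump enorm_sqr /= !fctE fct_sumE mulN1r.
  by congr (flat 0 (_ - _)); apply: eq_bigr => i _; rewrite expr2.
apply: sm_flat; apply: sm_add; first exact: sm_cst.
apply: sm_mul; first exact: sm_cst.
by apply: sm_big => i; apply: sm_mul; exact: sm_coord.
Qed.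

Lemma test_bump (r : R) : 0 <= r < 1 -> test (bump r).
Proof.
move=> r01; apply: (test_of_support r01); first exact: smooth_bump.
move=> x rx; rewrite /bump /flat ifF//; apply/negbTE; rewrite -leNgt subr_le0.
by case/andP: r01 => r0 _; rewrite lerXn2r// ?nnegrE// ?enorm_ge0// ltW.
Qed.

Lemma bump_gt0 r x : 0 <= r -> enorm x < r -> 0 < bump r x.
Proof.
move=> r0 xr; rewrite /bump /flat ifT ?expr0 ?mul1r ?expR_gt0//.
by rewrite subr_gt0 ltrXn2r// ?nnegrE// enorm_ge0.
Qed.

(* Products of the functions [step k] converge to indicators of [rays], a pi-system generating
   the Borel sets, on which Dynkin's lemma makes the integrals of h * bump vanish. *)
Lemma fundamental_lemma (h : rV -> R) : measurable_fun Om h ->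
  mu.-integrable Om (EFin \o h) ->
  (forall phi, test phi -> \int[mu]_(x in Om) (h x * phi x) = 0) ->
  {ae mu, forall x, Om x -> h x = 0}.
Proof.
move=> mh ih H.
have ibr (g : rV -> R) : bdm g -> mu.-integrable Om (EFin \o (h \* g)).
  move=> [mg [M HM]].
  apply: (@le_integrable _ _ _ mu _ mO _ (fun x => (`|M|%:E * (h x)%:E)%E)).
  - apply/measurable_EFinP; apply: measurable_funM => //.
    exact: measurable_funTS.
  - move=> x Ox; rewrite /= lee_fin !normrM mulrC normr_id ler_wpM2r//.
    exact: le_trans (HM x) (ler_norm _).
  - exact: integrableZl.
(* The bumps supply the compact support. Every point of the ball lies where the bump of radius 1 - 1
   / (k + 2) is positive for some k. *)
suff K (r : R) : 0 < r < 1 -> ae_eq mu Om (fun x => (h x * bump r x)%:E) (fun=> 0%E).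
  have K' : {ae mu, forall x (k : nat), Om x -> (h x * bump (1 - k.+2%:R^-1) x)%:E = 0%E}.
    apply: ae_foralln => k; apply: K.
    have k1 : 0 < k.+2%:R^-1 :> R by rewrite invr_gt0 ltr0n.
    have k2 : k.+2%:R^-1 < 1 :> R by rewrite invf_lt1 ?ltr0n// ltr1n.
    by rewrite subr_gt0 k2/= gtrBl.
  apply: filterS K' => x Hx Ox.
  have e0 : 0 < 1 - enorm x by rewrite subr_gt0.
  have [k hk] : exists k : nat, k.+2%:R^-1 < 1 - enorm x.
    exists (Num.truncn (1 - enorm x)^-1).
    rewrite invf_plt ?posrE//; apply: (lt_trans (truncnS_gt _)).
    by rewrite ltr_nat.
  have [hb] := Hx k Ox.
  have b0 : 0 < bump (1 - k.+2%:R^-1) x.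
    have k2 : k.+2%:R^-1 < 1 :> R by rewrite invf_lt1 ?ltr0n// ltr1n.
    by apply: bump_gt0; [rewrite subr_ge0 ltW|rewrite ltrBrDr -ltrBrDl].
  by move/eqP: hb; rewrite mulf_eq0 (gt_eqF b0) orbF => /eqP.
move=> /andP[r0 r1].
have r01 : 0 <= r < 1 by rewrite ltW.
have tb := test_bump r01.
pose f := h \* bump r.
have If : mu.-integrable Om (EFin \o f) by apply: ibr; exact: test_bdm.
have mf : measurable_fun Om (EFin \o f) by case/integrableP: If.
pose P (S : set rV) := (\int[mu]_(x in Om `&` S) (f x)%:E = 0)%E.
have PG c : P (rays c).
  pose g k (x : rV) := \prod_(i < n) step k (x ord0 i - c ord0 i).
  have tg k : test (fun x => g k x * bump r x).
    apply: testM => //; apply: smP.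
    have -> : g k = \prod_(i < n) (fun x : rV => step k (((fun x : rV => x ord0 i) + cst (- c ord0 i)) x)).
      apply/funext => x; rewrite /g.
      elim/big_rec2 : _ => //= i y1 y2 _ ->; first by rewrite !fctE.
    by apply: sm_prod => i; apply: sm_step; apply: sm_add; [exact: sm_coord|exact: sm_cst].
  have g01 k x : 0 <= g k x <= 1.
    rewrite /g; elim/big_ind : _ => [|a b /andP[a0 a1] /andP[b0 b1]|i _]; rewrite ?ler01 ?lexx//.
      by rewrite mulr_ge0//= mulr_ile1.
    exact: step01.
  have L := @dominated_cvg _ _ _ mu Om mO (fun k x => (h x * (g k x * bump r x))%:E)
      (fun x => (f x * \1_(rays c) x)%:E) (fun x => `|(f x)%:E|%E).
  have C1 : (\int[mu]_(x in Om) (h x * (g k x * bump r x))%:E)%E @[k --> \oo] -->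
      (\int[mu]_(x in Om) (f x * \1_(rays c) x)%:E)%E.
    apply: L.
    - move=> k; apply/measurable_EFinP; apply: measurable_funM => //.
      by apply: measurable_funTS; case: (test_bdm (tg k)).
    - move=> x Ox; apply: cvg_EFin; first by near=> k.
      rewrite (_ : _ \o _ = fun k => f x * g k x); last first.
        by apply/funext => k /=; rewrite /f /=; ring.
      apply: cvgM; first exact: cvg_cst.
      have [cx|ncx] := pselect (rays c x).
        rewrite indicE mem_set//.
        have -> : 1 = \prod_(i < n) (1 : R) by rewrite big1.
        rewrite /g; apply: cvg_big => [|i _]; first exact: mul_continuous.
        apply: step_cvg; rewrite subr_gt0.
        by have := cx i; rewrite /= in_itv/= andbT.
      rewrite indicE memNset//.
      have [i hi] : exists i, x ord0 i <= c ord0 i.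
        apply: contrapT => /forallNP hn; apply: ncx => i.
        by rewrite /= in_itv/= andbT ltNge; apply/negP; exact: hn.
      rewrite (_ : g ^~ x = fun=> 0); first exact: cvg_cst.
      apply/funext => k; rewrite /g (bigD1 i)//= step_le0 ?mul0r//.
      by rewrite subr_le0.
    - by [].
    - exact: integrable_abse.
    - move=> k x Ox; rewrite /= lee_fin /f /= mulrCA normrM ler_piMl//.
      by have /andP[g0 g1] := g01 k x; rewrite ger0_norm.
  have Z k : (\int[mu]_(x in Om) (h x * (g k x * bump r x))%:E = 0)%E.
    have := congr1 EFin (H _ (tg k)); rewrite /Rintegral fineK//.
    apply: integrable_fin_num => //; apply: ibr; exact: test_bdm.
  move: C1; under eq_fun do rewrite Z.
  move=> /(cvg_lim (@ereal_hausdorff R)); rewrite lim_cst//.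
  move=> E0; rewrite /P setIC integral_mkcondl E0.
  apply: eq_integral => x _; rewrite patchE indicE.
  by case: ifP => _; rewrite ?mulr1 ?mulr0.
(* The ball lies in the orthant with corner (-1, ..., -1). The complement step of Dynkin induction
   below relies on this. *)
have PT : P setT.
  have -> : P setT = P (rays (const_mx (-1))).
    rewrite /P setIT; congr (integral mu _ _ = _).
    apply/seteqP; split => x; last by case.
    move=> Ox; split => // i; have := unit_ball_cube Ox i.
    have := le_lt_trans (coord_le_enorm x i) Ox.
    by rewrite /= !in_itv/= mxE andbT ltr_norml => /andP[].
  exact: PG.
have PA (S : set rV) : measurable S -> P S.
  rewrite measurable_rays_gen.
  apply: (dynkin_induction measurable_rays_gen) => //.
  - by move=> _ _ [c _ <-] [d _ <-]; rewrite rays_setI; eexists.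
  - by move=> _ [c _ <-].
  - move=> A mA PA; rewrite /P -setDE.
    have E : (\int[mu]_(x in Om) (f x)%:E =
       \int[mu]_(x in Om `&` A) (f x)%:E + \int[mu]_(x in Om `\` A) (f x)%:E)%E.
      rewrite -integral_setU_EFin//.
      + by rewrite setUIDK.
      + exact: measurableI.
      + exact: measurableD.
      + by rewrite setUIDK; apply/measurable_EFinP.
      + by apply/disj_setPS => x [[_ Ax] [_ nAx]].
    by move: E; rewrite PA add0e; move: PT; rewrite /P setIT => ->.
  - move=> F mF tF PF; rewrite /P setI_bigcupr integral_bigcup//.
    + by rewrite eseries0// => k _ _; exact: PF.
    + exact: trivIset_setIl.
    + by move=> k; exact: measurableI.
    + rewrite -setI_bigcupr; apply: integrableS If => //.
      by apply: measurableI => //; exact: bigcup_measurable.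
apply: integral_ae_eq => //.
move=> E EO mE; rewrite integral0.
by have := PA E mE; rewrite /P setIC (setIidl EO).
Unshelve. all: by end_near.
Qed.

End Fundamental.

(** * The space L^2 on the ball *)

Section L2.
Variables (R : realType) (n : nat).
Local Notation rV := 'rV[R]_n.
Local Notation mu := (lebesgue_rV R n).
Local Notation Om := (@unit_ball R n).
Local Notation test := (@test_function R n Om).
Let mO : measurable (Om : set rV) := @measurable_unit_ball R n.
Let fO : (mu Om < +oo)%E := @mu_unit_ball R n.
Implicit Types (u v w f : rV -> R).

Definition integ f := mu.-integrable Om (EFin \o f).
Definition L2 u := @square_integrable R n Om u.
Definition sqn u := \int[mu]_(x in Om) (u x ^+ 2).
Definition ip u v := \int[mu]_(x in Om) (u x * v x).

Lemma int_measurable f : integ f -> measurable_fun Om f.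
Proof. by move=> /integrableP[/measurable_EFinP]. Qed.

Lemma int_le f g : measurable_fun Om f -> (forall x, Om x -> `|f x| <= g x) -> integ g -> integ f.
Proof.
move=> mf fg ig; apply: (le_integrable mO _ _ ig); first exact/measurable_EFinP.
move=> x Ox; rewrite /= lee_fin (le_trans (fg x Ox))//; exact: ler_norm.
Qed.

Lemma intD f g : integ f -> integ g -> integ (fun x => f x + g x).
Proof. by move=> i1 i2; exact: (integrableD mO i1 i2). Qed.

Lemma intZ c f : integ f -> integ (fun x => c * f x).
Proof. by move=> i1; exact: (integrableZl mO c i1). Qed.

Lemma intB f g : integ f -> integ g -> integ (fun x => f x - g x).
Proof. by move=> i1 i2; exact: (integrableB mO i1 i2). Qed.

Lemma int_norm f : integ f -> integ (fun x => `|f x|).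
Proof. by move=> i1; exact: (integrable_norm i1). Qed.

Lemma int_sum I (r : seq I) (F : I -> rV -> R) : (forall i, integ (F i)) ->
  integ (fun x => \sum_(i <- r) F i x).
Proof.
move=> H; elim: r => [|i r IH].
  under [fun x => _]eq_fun do rewrite big_nil.
  exact: integrable0.
by under [fun x => _]eq_fun do rewrite big_cons; exact: intD.
Qed.

Lemma RintD f g : integ f -> integ g ->
  \int[mu]_(x in Om) (f x + g x) = \int[mu]_(x in Om) f x + \int[mu]_(x in Om) g x.
Proof. by move=> i1 i2; rewrite RintegralD. Qed.

Lemma RintB f g : integ f -> integ g ->
  \int[mu]_(x in Om) (f x - g x) = \int[mu]_(x in Om) f x - \int[mu]_(x in Om) g x.
Proof. by move=> i1 i2; rewrite RintegralB. Qed.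

Lemma RintZ c f : integ f ->
  \int[mu]_(x in Om) (c * f x) = c * \int[mu]_(x in Om) f x.
Proof. by move=> i1; rewrite RintegralZl. Qed.

Lemma Rint_sum I (r : seq I) (F : I -> rV -> R) : (forall i, integ (F i)) ->
  \int[mu]_(x in Om) (\sum_(i <- r) F i x) = \sum_(i <- r) \int[mu]_(x in Om) F i x.
Proof.
move=> H; elim: r => [|i r IH].
  under eq_Rintegral do rewrite big_nil.
  by rewrite big_nil /Rintegral integral0.
under eq_Rintegral do rewrite big_cons.
by rewrite big_cons -IH RintD//; exact: int_sum.
Qed.

Lemma le_Rint f g : integ f -> integ g -> (forall x, Om x -> f x <= g x) ->
  \int[mu]_(x in Om) f x <= \int[mu]_(x in Om) g x.
Proof. by move=> i1 i2 H; exact: le_Rintegral. Qed.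

Lemma normr_Rint f : integ f ->
  `|\int[mu]_(x in Om) f x| <= \int[mu]_(x in Om) `|f x|.
Proof. by move=> i1; exact: le_normr_Rintegral. Qed.

Lemma EFin_Rint f : integ f -> (\int[mu]_(x in Om) f x)%:E = (\int[mu]_(x in Om) (f x)%:E)%E.
Proof. by move=> i1; rewrite /Rintegral fineK//; exact: integrable_fin_num. Qed.

Lemma bdm_int f : bdm f -> integ f.
Proof. exact: bdm_integrable. Qed.

Lemma int_ge0_lty f : measurable_fun Om f -> (forall x, Om x -> 0 <= f x) ->
  (\int[mu]_(x in Om) (f x)%:E < +oo)%E -> integ f.
Proof.
move=> mf f0 flt; apply/integrableP; split; first exact/measurable_EFinP.
rewrite (eq_integral (fun x => (f x)%:E))// => x /set_mem Ox /=.
by rewrite ger0_norm// f0.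
Qed.

Lemma bdm_L2 u : bdm u -> L2 u.
Proof.
move=> bu; split; first by apply: measurable_funTS; case: bu.
by apply: bdm_int; exact: bdmX.
Qed.

Lemma L2_int2 u : L2 u -> integ (fun x => u x ^+ 2). Proof. by case. Qed.

Lemma L2M u v : L2 u -> L2 v -> integ (fun x => u x * v x).
Proof.
move=> [mu1 i1] [mv i2]; apply: (@int_le _ (fun x => u x ^+ 2 + v x ^+ 2)).
- exact: measurable_funM.
- move=> x _; rewrite ler_norml; apply/andP; split.
    by have := sqr_ge0 (u x + v x); have := sqr_ge0 (u x); have := sqr_ge0 (v x); nra.
  by have := sqr_ge0 (u x - v x); have := sqr_ge0 (u x); have := sqr_ge0 (v x); nra.
- exact: intD.
Qed.

Lemma L2_int u : L2 u -> integ u.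
Proof.
move=> Lu; have := L2M Lu (bdm_L2 (bdm_cst n 1)).
by under [fun x => _ * _]eq_fun do rewrite mulr1.
Qed.

Lemma L2D u v : L2 u -> L2 v -> L2 (fun x => u x + v x).
Proof.
move=> Lu Lv; split; first by apply: measurable_funD; [case: Lu|case: Lv].
have -> : (fun x => ((u x + v x) ^+ 2)%:E) =
   EFin \o (fun x => (u x ^+ 2 + 2 * (u x * v x)) + v x ^+ 2).
  by apply/funext => x /=; congr EFin; ring.
apply: intD; last exact: L2_int2.
by apply: intD; [exact: L2_int2|apply: intZ; exact: L2M].
Qed.

Lemma L2Z c u : L2 u -> L2 (fun x => c * u x).
Proof.
move=> Lu; split; first by apply: measurable_funM; [exact: measurable_cst|case: Lu].
have -> : (fun x => ((c * u x) ^+ 2)%:E) = EFin \o (fun x => c ^+ 2 * u x ^+ 2).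
  by apply/funext => x /=; rewrite exprMn.
by apply: intZ; exact: L2_int2.
Qed.

Lemma L2B u v : L2 u -> L2 v -> L2 (fun x => u x - v x).
Proof.
move=> Lu Lv; have := L2D Lu (L2Z (-1) Lv).
by under [fun x => _ + _]eq_fun do rewrite mulN1r.
Qed.

Lemma sqn_ge0 u : 0 <= sqn u.
Proof. by apply: Rintegral_ge0 => x _; exact: sqr_ge0. Qed.

Lemma sqnD u v : L2 u -> L2 v -> sqn (fun x => u x + v x) = sqn u + 2 * ip u v + sqn v.
Proof.
move=> Lu Lv; rewrite /sqn /ip -RintZ; last exact: L2M.
have i1 := L2_int2 Lu; have i2 := L2_int2 Lv; have i3 := intZ 2 (L2M Lu Lv).
rewrite -RintD// -RintD//; last exact: intD.
by apply: eq_Rintegral => x _; ring.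
Qed.

Lemma sqnZ c u : L2 u -> sqn (fun x => c * u x) = c ^+ 2 * sqn u.
Proof.
move=> Lu; rewrite /sqn -RintZ; last exact: L2_int2.
by apply: eq_Rintegral => x _; rewrite exprMn.
Qed.

Lemma ip_Z c u v : L2 u -> L2 v -> ip (fun x => c * u x) v = c * ip u v.
Proof.
move=> Lu Lv; rewrite /ip -RintZ; last exact: L2M.
by apply: eq_Rintegral => x _; rewrite mulrA.
Qed.

Lemma ipC u v : ip u v = ip v u.
Proof. by apply: eq_Rintegral => x _; rewrite mulrC. Qed.

Lemma ip_D u v w : L2 u -> L2 v -> L2 w -> ip (fun x => u x + v x) w = ip u w + ip v w.
Proof.
move=> Lu Lv Lw; rewrite /ip -RintD; [|exact: L2M|exact: L2M].
by apply: eq_Rintegral => x _; rewrite mulrDl.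
Qed.

Lemma ip_B u v w : L2 u -> L2 v -> L2 w -> ip (fun x => u x - v x) w = ip u w - ip v w.
Proof.
move=> Lu Lv Lw; rewrite /ip -RintB; [|exact: L2M|exact: L2M].
by apply: eq_Rintegral => x _; rewrite mulrBl.
Qed.

Lemma cauchy_schwarz u v : L2 u -> L2 v -> ip u v ^+ 2 <= sqn u * sqn v.
Proof.
move=> Lu Lv.
have H c : 0 <= sqn u + 2 * (c * ip u v) + c ^+ 2 * sqn v.
  rewrite -(sqnZ c Lv) [ip u v]ipC -(ip_Z c Lv Lu) [ip _ u]ipC -sqnD//; last exact: L2Z.
  exact: sqn_ge0.
have Nv := sqn_ge0 v; have Nu := sqn_ge0 u.
set a := sqn u in H Nu *; set b := ip u v in H *; set d := sqn v in H Nv *.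
have [d0|d0] := eqVneq d 0.
  have [->|b0] := eqVneq b 0; first by rewrite expr0n mulr_ge0.
  (* If v has norm 0, the polynomial is affine in c and this c would give it the value -1. *)
  exfalso; have := H (- (a + 1) / (2 * b)); rewrite d0 mulr0 addr0.
  by have -> : 2 * (- (a + 1) / (2 * b) * b) = - (a + 1) by [field]; lra.
have dp : 0 < d by rewrite lt_neqAle eq_sym d0.
have := H (- b / d).
have -> : a + 2 * (- b / d * b) + (- b / d) ^+ 2 * d = (a * d - b ^+ 2) / d by field.
by rewrite pmulr_lge0 ?invr_gt0// subr_ge0.
Qed.

Lemma ip_le u v : L2 u -> L2 v -> `|ip u v| <= Num.sqrt (sqn u) * Num.sqrt (sqn v).
Proof.
move=> Lu Lv; rewrite -sqrtrM ?sqn_ge0// -sqrtr_sqr ler_wsqrtr//; exact: cauchy_schwarz.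
Qed.

Lemma sqn_triangle u v : L2 u -> L2 v -> sqn (fun x => u x + v x) <= 2 * (sqn u + sqn v).
Proof.
move=> Lu Lv; rewrite sqnD//.
have : 2 * ip u v <= sqn u + sqn v.
  rewrite /sqn /ip -RintZ; last exact: L2M.
  rewrite -RintD; [|exact: L2_int2|exact: L2_int2].
  apply: le_Rint; [by apply: intZ; exact: L2M|by apply: intD; exact: L2_int2|].
  by move=> x _; have := sqr_ge0 (u x - v x); nra.
lra.
Qed.

Definition aeq u v := {ae mu, forall x, Om x -> u x = v x}.

Lemma aeq_sym u v : aeq u v -> aeq v u.
Proof. by apply: filterS => x H Ox; rewrite H. Qed.

Lemma aeq_trans u v w : aeq u v -> aeq v w -> aeq u w.
Proof. by apply: filterS2 => x H1 H2 Ox; rewrite H1// H2. Qed.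

Lemma aeq_Rint f g : measurable_fun Om f -> measurable_fun Om g -> aeq f g ->
  \int[mu]_(x in Om) f x = \int[mu]_(x in Om) g x.
Proof.
move=> mf mg H; rewrite /Rintegral; congr fine; apply: ae_eq_integral => //.
- exact/measurable_EFinP.
- exact/measurable_EFinP.
- by apply: filterS H => x H Ox /=; rewrite H.
Qed.

(** Stated in the extended reals so that integrability of the limit can be deduced from it. *)
Lemma fatou_real (F : nat -> rV -> R) f (B : R) :
  (forall j, measurable_fun Om (F j)) -> measurable_fun Om f ->
  (forall j x, Om x -> 0 <= F j x) ->
  {ae mu, forall x, Om x -> F j x @[j --> \oo] --> f x} ->
  (\forall j \near \oo, (\int[mu]_(x in Om) (F j x)%:E <= B%:E)%E) ->
  (\int[mu]_(x in Om) (f x)%:E <= B%:E)%E.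
Proof.
move=> mF mf F0 cF HB.
have mF' j : measurable_fun Om (fun x => (F j x)%:E) by exact/measurable_EFinP.
have -> : (\int[mu]_(x in Om) (f x)%:E =
    \int[mu]_(x in Om) limn_einf (fun j => (F j x)%:E))%E.
  apply: ae_eq_integral => //.
  - exact/measurable_EFinP.
  - apply: (emeasurable_fun_cvg (fun k x => einfs (fun j => (F j x)%:E) k)).
      by move=> k; exact: measurable_fun_einfs.
    move=> x Ox; rewrite limn_einf_lim; exact: is_cvg_einfs.
  - apply: filterS cF => x cx Ox.
    have H : (F j x)%:E @[j --> \oo] --> (f x)%:E.
      by apply: cvg_EFin; [near=> j|exact: cx].
    by have [-> _] := cvg_limn_einf_sup H.
apply: (le_trans (fatou mu mO mF' _)) => [j x Ox|]; first by rewrite lee_fin F0.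
rewrite limn_einf_lim; apply: lime_le; first exact: is_cvg_einfs.
near=> k; apply: (@le_trans _ _ (\int[mu]_(x in Om) (F k x)%:E)%E); last by near: k.
by apply: ereal_inf_lbound; exists k => /=.
Unshelve. all: by end_near.
Qed.

(** By monotone convergence the sum of the series has integral at most 2 c, hence is finite almost
    everywhere. *)
Lemma ae_series (h : nat -> rV -> R) (c : R) :
  (forall k, measurable_fun Om (h k)) -> (forall k x, Om x -> 0 <= h k x) ->
  (forall k, (\int[mu]_(x in Om) (h k x)%:E <= (c / 2 ^+ k)%:E)%E) ->
  {ae mu, forall x, Om x -> cvgn (series (h ^~ x))}.
Proof.
move=> mh h0 Hh.
have mh' k : measurable_fun Om (fun x => (h k x)%:E) by exact/measurable_EFinP.
have h0' k x : Om x -> (0 <= (h k x)%:E)%E by move=> Ox; rewrite lee_fin h0.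
have c0 : 0 <= c.
  have := le_trans (integral_ge0 mu (fun x Ox => h0' 0%N x Ox)) (Hh 0%N).
  by rewrite lee_fin expr0 divr1.
pose G x := (\sum_(0 <= k <oo) (h k x)%:E)%E.
have mG : measurable_fun Om G by apply: ge0_emeasurable_sum => // k x Ox _; exact: h0'.
have G0 x : Om x -> (0 <= G x)%E by move=> Ox; apply: nneseries_ge0 => k _ _; exact: h0'.
have iG : mu.-integrable Om G.
  apply/integrableP; split => //.
  rewrite (eq_integral G); last by move=> x /set_mem Ox; rewrite gee0_abs// G0.
  rewrite integral_nneseries//.
  apply: (@le_lt_trans _ _ (2 * c)%:E); last exact: ltry.
  apply: lime_le; first by apply: is_cvg_nneseries => k _ _; apply: integral_ge0 => x; exact: h0'.
  near=> m.
  apply: (@le_trans _ _ (\sum_(0 <= k < m) (c / 2 ^+ k)%:E)%E); first exact: lee_sum.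
  rewrite sumEFin lee_fin -mulr_sumr mulrC ler_wpM2r//.
  elim: (m) => [|j IH]; first by rewrite big_nil.
  suff -> : forall j, \sum_(0 <= i < j) (2 ^+ i)^-1 = 2 - 2 * (2 ^+ j)^-1 :> R.
    by rewrite gerBl mulr_ge0// invr_ge0 exprn_ge0.
  elim=> [|i IHi]; first by rewrite big_nil expr0; field.
  by rewrite big_nat_recr//= IHi exprS; field; rewrite expf_neq0.
apply: filterS (integrable_ae mO iG) => x Hx Ox.
have Gf := Hx Ox; have hx0 k : 0 <= h k x by exact: h0.
apply: nondecreasing_is_cvgn.
  by apply/nondecreasing_seqP => k; rewrite /series /= big_nat_recr//= lerDl.
exists (fine (G x)) => _ [k _ <-].
rewrite -lee_fin fineK// /series /= -sumEFin.
by apply: nneseries_lim_ge => i _ _; rewrite lee_fin.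
Unshelve. all: by end_near.
Qed.

(** The series of the squares converges almost everywhere by [ae_series], so its terms tend to 0. *)
Lemma ae_cvg0 (f : nat -> rV -> R) (c : R) : (forall k, L2 (f k)) ->
  (forall k, sqn (f k) <= c / 2 ^+ k) ->
  {ae mu, forall x, Om x -> f k x @[k --> \oo] --> (0 : R)}.
Proof.
move=> Lf Nf.
have := @ae_series (fun k x => f k x ^+ 2) c.
move=> /(_ _ _ _)[].
- by move=> k; exact: (int_measurable (L2_int2 (Lf k))).
- by move=> k x _; exact: sqr_ge0.
- by move=> k; rewrite -EFin_Rint; [rewrite lee_fin; exact: Nf|exact: L2_int2].
move=> A [mA A0 HA]; exists A; split => //; apply: subset_trans HA => x /= nx Hx; apply: nx => Ox.
have /cvg_series_cvg_0 H := Hx Ox.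
apply/cvgrPdist_lt => e e0.
have e2 : 0 < e ^+ 2 by rewrite exprn_gt0.
move/cvgrPdist_lt : H => /(_ _ e2); apply: filterS => k.
rewrite !sub0r !normrN normrX ltr_pXn2r//; rewrite nnegrE//; exact: ltW.
Qed.

(** The rate 4^-k makes the increments summable in L^1, so the sequence itself converges almost
    everywhere; Fatou then gives the bounds for the limit. *)
Lemma riesz_fischer (f : nat -> rV -> R) : (forall k, L2 (f k)) ->
  (forall k j, (k <= j)%N -> sqn (fun x => f j x - f k x) <= 1 / 4 ^+ k) ->
  exists g, [/\ L2 g, {ae mu, forall x, Om x -> f k x @[k --> \oo] --> g x} &
    forall k, sqn (fun x => g x - f k x) <= 1 / 4 ^+ k].
Proof.
move=> Lf HN.
pose d k x := f k.+1 x - f k x.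
have Ld k : L2 (d k) by exact: L2B.
have mf k : measurable_fun Om (f k) by case: (Lf k).
pose m := fine (mu Om).
have A1 : {ae mu, forall x, Om x -> cvgn (series (fun k => `|d k x|))}.
  apply: (@ae_series _ (m + 1)) => [k|k x _|k].
  - by apply: measurableT_comp => //; case: (Ld k).
  - exact: normr_ge0.
  - have id2 := L2_int2 (Ld k); have i1 := intZ (2 ^+ k) id2.
    have i0 : integ (fun=> (2 ^+ k)^-1) by exact/bdm_int/bdm_cst.
    rewrite -EFin_Rint ?lee_fin; last by apply: int_norm; exact: L2_int.
    (* The inequality |y| <= 2^-k + 2^k y^2 passes from L^2 to L^1 on the ball, with the bound (m +
       1) 2^-k. *)
    apply: (@le_trans _ _ (\int[mu]_(x in Om) ((2 ^+ k)^-1 + 2 ^+ k * d k x ^+ 2))).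
      apply: le_Rint; [by apply: int_norm; exact: L2_int|exact: intD|move=> x _].
      have p0 : 0 < 2 ^+ k :> R by rewrite exprn_gt0.
      rewrite -(real_normK (num_real (d k x))); set y := `|d k x|.
      have := sqr_ge0 (2 ^+ k * y - 1) => h.
      have y0 : 0 <= y by exact: normr_ge0.
      rewrite -(ler_pM2l p0) mulrDr divff ?gt_eqF//.
      set z := 2 ^+ k * y in h *; have z0 : 0 <= z by rewrite mulr_ge0// ltW.
      have -> : 2 ^+ k * (2 ^+ k * y ^+ 2) = z ^+ 2 by rewrite /z; ring.
      nra.
    rewrite RintD// RintZ// Rint_cst// -/m.
    have := HN k k.+1 (leqnSn k); rewrite -/(d k) => h.
    rewrite mulrDl mul1r mulrC lerD2l.
    have p0 : 0 < 2 ^+ k :> R by rewrite exprn_gt0.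
    apply: le_trans (ler_wpM2l (ltW p0) h) _.
    have -> : 4 ^+ k = 2 ^+ k * 2 ^+ k :> R by rewrite -exprMn; congr (_ ^+ _); ring.
    by rewrite invfM mul1r mulrA divff ?gt_eqF// mul1r.
have A2 : {ae mu, forall x, Om x -> cvgn (f ^~ x)}.
  apply: filterS A1 => x Hx Ox.
  have cs : cvgn (series (fun k => d k x)) by apply: normed_cvg; exact: Hx.
  have -> : f ^~ x = fun k => f 0%N x + series (fun k => d k x) k.
    apply/funext => k; rewrite /series /= /d.
    by rewrite (telescope_sumr (fun k => f k x))// addrC subrK.
  by apply: is_cvgD => //; exact: is_cvg_cst.
(* The upper limit is measurable whether or not the sequence converges at x, and [fine] sends
   infinite values to 0. *)
pose g x := fine (limn_esup (fun k => (f k x)%:E)).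
have mg : measurable_fun Om g.
  apply: measurableT_comp; first exact: fine_measurable.
  by apply: measurable_fun_limn_esup => k; exact/measurable_EFinP.
have Hg : {ae mu, forall x, Om x -> f k x @[k --> \oo] --> g x}.
  apply: filterS A2 => x Hx Ox; have cx := Hx Ox.
  suff -> : g x = limn (f ^~ x) by [].
  have H : (f j x)%:E @[j --> \oo] --> (limn (f ^~ x))%:E.
    by apply: cvg_EFin; [near=> j|exact: cx].
  by rewrite /g; have [_ ->] := cvg_limn_einf_sup H.
have HF k : (\int[mu]_(x in Om) ((g x - f k x) ^+ 2)%:E <= (1 / 4 ^+ k)%:E)%E.
  apply: (@fatou_real (fun j x => (f j x - f k x) ^+ 2)).
  - by move=> j; exact: (int_measurable (L2_int2 (L2B (Lf j) (Lf k)))).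
  - by apply: measurable_funX; exact: measurable_funB.
  - by move=> j x _; exact: sqr_ge0.
  - apply: filterS Hg => x Hx Ox.
    have c1 : (f j x - f k x) @[j --> \oo] --> g x - f k x.
      by apply: cvgB; [exact: Hx|exact: cvg_cst].
    rewrite expr2; under eq_fun do rewrite expr2.
    exact: cvgM.
  - exists k => // j /= kj.
    rewrite -EFin_Rint ?lee_fin; last by apply: L2_int2; exact: L2B.
    exact: HN.
have Lg k : L2 (fun x => g x - f k x).
  split; first exact: measurable_funB.
  apply: (@int_ge0_lty (fun x => (g x - f k x) ^+ 2)).
  - by apply: measurable_funX; exact: measurable_funB.
  - by move=> x _; exact: sqr_ge0.
  - exact: le_lt_trans (HF k) (ltry _).
exists g; split => //.
  have := L2D (Lg 0%N) (Lf 0%N).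
  by under [fun x => _ + _]eq_fun do rewrite subrK.
move=> k; rewrite -lee_fin; apply: le_trans (HF k).
by rewrite -EFin_Rint//; exact: L2_int2.
Unshelve. all: by end_near.
Qed.

End L2.

(** * Weak gradients and H^1_0 *)

Section WeakGradient.
Variables (R : realType) (n : nat).
Local Notation rV := 'rV[R]_n.
Local Notation mu := (lebesgue_rV R n).
Local Notation Om := (@unit_ball R n).
Local Notation test := (@test_function R n Om).
Let mO : measurable (Om : set rV) := @measurable_unit_ball R n.
Let fO : (mu Om < +oo)%E := @mu_unit_ball R n.
Implicit Types (u v w phi psi : rV -> R) (g h : rV -> rV).
Local Notation weak := (@is_weak_gradient R n Om).
Local Notation co g i := (fun x => g x ord0 i).

Definition grad phi (x : rV) : rV := \row_i partial i phi x.
Definition nrm2 g := \sum_(i < n) sqn (co g i).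

Lemma nrm2_ge0 g : 0 <= nrm2 g.
Proof. by apply: sumr_ge0 => i _; exact: sqn_ge0. Qed.

Lemma test_L2 phi : test phi -> L2 phi.
Proof. by move=> tp; apply: bdm_L2; exact: test_bdm. Qed.

Lemma partial_L2 i phi : test phi -> L2 (partial i phi).
Proof. by move=> tp; apply: test_L2; exact: test_partial. Qed.

Lemma co_grad phi i : co (grad phi) i = partial i phi.
Proof. by apply/funext => x; rewrite mxE. Qed.

Lemma nrm2_grad phi : test phi -> nrm2 (grad phi) = dir phi.
Proof.
move=> tp; rewrite /nrm2 /dir /gradsq Rint_sum.
  by apply: eq_bigr => i _; rewrite co_grad.
by move=> i; apply: L2_int2; exact: partial_L2.
Qed.

Lemma weak_test phi : test phi -> weak phi (grad phi).
Proof.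
move=> tp i; rewrite co_grad; split; first exact: partial_L2.
move=> psi tpsi; rewrite test_ibp//; congr (- _).
by apply: eq_Rintegral => x _; rewrite mxE.
Qed.

Lemma weak_lin (c : R) u v g h : L2 u -> L2 v -> weak u g -> weak v h ->
  weak (fun x => u x + c * v x) (fun x => g x + c *: h x).
Proof.
move=> Lu Lv wg wh i; have [Lg Hg] := wg i; have [Lh Hh] := wh i.
have -> : co (fun x => g x + c *: h x) i = fun x => g x ord0 i + c * h x ord0 i.
  by apply/funext => x; rewrite !mxE.
split; first by apply: L2D => //; exact: L2Z.
move=> psi tpsi.
have Lp := test_L2 tpsi; have Lpi := partial_L2 i tpsi.
have -> : \int[mu]_(x in Om) ((g x + c *: h x) ord0 i * psi x) =
    ip (fun x => g x ord0 i + c * h x ord0 i) psi.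
  by apply: eq_Rintegral => x _; rewrite !mxE.
rewrite -[LHS]/(ip _ _) (ip_D Lu (L2Z c Lv) Lpi) (ip_D Lg (L2Z c Lh) Lp).
rewrite (ip_Z _ Lv Lpi) (ip_Z _ Lh Lp).
by rewrite /ip (Hg psi tpsi) (Hh psi tpsi); ring.
Qed.

(** The difference of two weak gradients integrates to 0 against every test function. *)
Lemma weak_unique u g h : weak u g -> weak u h -> forall i, aeq (co g i) (co h i).
Proof.
move=> wg wh i; have [Lg Hg] := wg i; have [Lh Hh] := wh i.
have Lgh := L2B Lg Lh.
have := @fundamental_lemma R n _ (int_measurable (L2_int Lgh)) (L2_int Lgh).
move=> H; apply: filterS (H _) => [x Hx Ox|psi tpsi].
  by apply/eqP; rewrite -subr_eq0; apply/eqP; exact: Hx.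
have E := ip_B Lg Lh (test_L2 tpsi); rewrite /ip in E; rewrite E.
apply/eqP; rewrite subr_eq0 -eqr_opp; apply/eqP.
by rewrite -(Hg psi tpsi) -(Hh psi tpsi).
Qed.

Lemma wgrad_weak u g : weak u g -> weak u (wgrad Om u).
Proof. by move=> wg; apply: (@getPex _ [set g | weak u g]); exists g. Qed.

Lemma wgrad_aeq u g : weak u g -> forall i, aeq (co (wgrad Om u) i) (co g i).
Proof. by move=> wg; apply: weak_unique => //; exact: wgrad_weak wg. Qed.

Lemma aeq_sqn u v : L2 u -> L2 v -> aeq u v -> sqn u = sqn v.
Proof.
move=> Lu Lv H; apply: aeq_Rint; first exact: (int_measurable (L2_int2 Lu)).
  exact: (int_measurable (L2_int2 Lv)).
by apply: filterS H => x Hx Ox; rewrite Hx.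
Qed.

Lemma nrm2_wgrad u g : weak u g -> nrm2 (wgrad Om u) = nrm2 g.
Proof.
move=> wg; apply: eq_bigr => i _; apply: aeq_sqn; last exact: wgrad_aeq.
  by have [] := wgrad_weak wg i.
by have [] := wg i.
Qed.

Lemma nrm2E g : (forall i, L2 (co g i)) ->
  nrm2 g = \int[mu]_(x in Om) (enorm (g x) ^+ 2).
Proof.
move=> Lg; rewrite /nrm2 -Rint_sum; last by move=> i; exact: L2_int2.
by apply: eq_Rintegral => x _; rewrite enorm_sqr.
Qed.

Lemma enorm_int g : (forall i, L2 (co g i)) -> integ (fun x => enorm (g x) ^+ 2).
Proof.
move=> Lg; have -> : (fun x => enorm (g x) ^+ 2) = fun x => \sum_(i < n) g x ord0 i ^+ 2.
  by apply/funext => x; rewrite enorm_sqr.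
by apply: int_sum => i; exact: L2_int2.
Qed.

Lemma H1_normE u g : L2 u -> weak u g -> H1_norm Om u = Num.sqrt (sqn u + nrm2 g).
Proof.
move=> Lu wg; rewrite /H1_norm; congr Num.sqrt.
have Lw i : L2 (co (wgrad Om u) i) by have [] := wgrad_weak wg i.
rewrite -(nrm2_wgrad wg) nrm2E// -RintD//; first exact: L2_int2.
exact: enorm_int.
Qed.

(* v belongs to H^1_0 with gradient g; unlike [wgrad], g is linear in v on the nose. *)
Definition inH10 v g := [/\ L2 v, forall i, L2 (co g i) &
  forall e, 0 < e -> exists2 phi, test phi &
    sqn (fun x => v x - phi x) <= e /\ forall i, sqn (fun x => g x ord0 i - partial i phi x) <= e].

Lemma inH10_test phi : test phi -> inH10 phi (grad phi).
Proof.
move=> tp; split; first exact: test_L2.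
  by move=> i; rewrite co_grad; exact: partial_L2.
have N0 (u : rV -> R) : sqn (fun x => u x - u x) = 0.
  rewrite /sqn; under eq_Rintegral do rewrite subrr expr0n.
  by rewrite Rint_cst// mul0r.
move=> e e0; exists phi => //; rewrite N0; split; first exact: ltW.
by move=> i; rewrite -[partial i phi]co_grad N0 ltW.
Qed.

Lemma inH10_lin c v w g h : inH10 v g -> inH10 w h -> inH10 (fun x => v x + c * w x) (fun x => g x + c *: h x).
Proof.
move=> [Lv Lg Hg] [Lw Lh Hh].
have E i : co (fun x => g x + c *: h x) i = fun x => g x ord0 i + c * h x ord0 i.
  by apply/funext => x; rewrite !mxE.
split; first by apply: L2D => //; exact: L2Z.
  by move=> i; rewrite E; apply: L2D => //; exact: L2Z.
(* Chosen so that 2 (d + c^2 d) = e, the bound that [sqn_triangle] produces. *)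
move=> e e0; pose d := e / (2 + 2 * c ^+ 2).
have c2 : 0 <= c ^+ 2 by exact: sqr_ge0.
have dd0 : 0 < 2 + 2 * c ^+ 2 by lra.
have d0 : 0 < d by rewrite divr_gt0.
have [p tp [Np Npi]] := Hg d d0; have [r tr [Nr Nri]] := Hh d d0.
have key (a b a' b' : rV -> R) : L2 a -> L2 b -> L2 a' -> L2 b' ->
    sqn (fun x => a x - a' x) <= d -> sqn (fun x => b x - b' x) <= d ->
    sqn (fun x => a x + c * b x - (a' x + c * b' x)) <= e.
  move=> La Lb La' Lb' h1 h2.
  have -> : (fun x => a x + c * b x - (a' x + c * b' x)) =
     fun x => (a x - a' x) + c * (b x - b' x) by apply/funext => x; ring.
  apply: le_trans (sqn_triangle _ _) _; [exact: L2B|by apply: L2Z; exact: L2B|].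
  rewrite sqnZ; last exact: L2B.
  have -> : e = 2 * (d + c ^+ 2 * d) by rewrite /d; field; rewrite gt_eqF.
  by rewrite ler_wpM2l// lerD// ler_wpM2l.
exists (fun x => p x + c * r x); first by apply: testD => //; exact: testZ.
split; first by apply: key => //; exact: test_L2.
move=> i.
have -> : (fun x => (g x + c *: h x) ord0 i - partial i (fun y => p y + c * r y) x) =
   fun x => g x ord0 i + c * h x ord0 i - (partial i p x + c * partial i r x).
  apply/funext => x; rewrite !mxE partialD; [|exact: test_smooth|by apply: test_smooth; exact: testZ].
  by rewrite partialZ//; exact: test_smooth.
by apply: key => //; exact: partial_L2.
Qed.

Lemma abs_le0 (x C : R) : (forall e, 0 < e -> `|x| <= C * e) -> x = 0.
Proof.
move=> H; apply/eqP; rewrite -normr_le0; apply: (@le_invn _ _ _ C) => m.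
by rewrite add0r; apply: H; rewrite invr_gt0 ltr0n.
Qed.

(** Integration by parts holds for the approximating test functions, and by Cauchy-Schwarz both
    sides are continuous in L^2. *)
Lemma inH10_weak v g : inH10 v g -> weak v g.
Proof.
move=> [Lv Lg Hg] i; split; [exact: Lg|move=> psi tpsi].
have Lp := test_L2 tpsi; have Lpi := partial_L2 i tpsi.
apply/eqP; rewrite -addr_eq0; apply/eqP.
apply: (@abs_le0 _ (Num.sqrt (sqn (partial i psi)) + Num.sqrt (sqn psi))) => e e0.
have [phi tp [h1 h2]] := Hg (e ^+ 2) (exprn_gt0 _ e0).
have Lf := test_L2 tp; have Lfi := partial_L2 i tp.
have -> : \int[mu]_(x in Om) (v x * partial i psi x) + \int[mu]_(x in Om) (g x ord0 i * psi x)
   = ip (fun x => v x - phi x) (partial i psi) + ip (fun x => g x ord0 i - partial i phi x) psi.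
  rewrite ip_B// ip_B// -![Rintegral _ _ _]/(ip _ _).
  have := test_ibp i tp tpsi; rewrite -![Rintegral _ _ _]/(ip _ _) => ->; ring.
have sq (x : R) : x <= e ^+ 2 -> Num.sqrt x <= e.
  by move=> hx; rewrite -(ger0_norm (ltW e0)) -sqrtr_sqr ler_wsqrtr.
apply: le_trans (ler_normD _ _) _; rewrite mulrDl lerD//.
  apply: le_trans (ip_le (L2B Lv Lf) Lpi) _; rewrite mulrC ler_wpM2l ?sqrtr_ge0// sq//.
apply: le_trans (ip_le (L2B (Lg i) Lfi) Lp) _; rewrite mulrC ler_wpM2l ?sqrtr_ge0// sq//.
Qed.

Lemma inH10_H10 v g : inH10 v g -> H10 Om v.
Proof.
move=> Wv; have wv := inH10_weak Wv; have [Lv Lg Hg] := Wv.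
split; first by split => //; exists g.
(* The n + 1 squared errors, of the function and its n partial derivatives, add up to at most (e /
   2)^2. *)
move=> e e0; pose d := (e / 2) ^+ 2 / (n%:R + 1).
have n1 : 0 < n%:R + 1 :> R by rewrite ltr_wpDl.
have d0 : 0 < d by rewrite divr_gt0// exprn_gt0// divr_gt0.
have [phi tp [h1 h2]] := Hg d d0; exists phi => //.
have E1 : (fun x => v x - phi x) = fun x => v x + -1 * phi x.
  by apply/funext => x; rewrite mulN1r.
have wd := weak_lin (-1) Lv (test_L2 tp) wv (weak_test tp).
rewrite E1 (H1_normE _ wd); last first.
  by rewrite -E1; apply: L2B => //; exact: test_L2.
rewrite -E1; apply: (@le_lt_trans _ _ (e / 2)); last by lra.
have e2 : 0 <= e / 2 by rewrite divr_ge0// ltW.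
rewrite -(ger0_norm e2) -sqrtr_sqr ler_wsqrtr//.
have -> : (e / 2) ^+ 2 = d + \sum_(i < n) d.
  by rewrite sumr_const card_ord -[_ *+ _]mulr_natl /d; field; rewrite gt_eqF.
rewrite lerD// ler_sum// => i _; apply: le_trans (h2 i).
rewrite le_eqVlt; apply/orP; left; apply/eqP; congr sqn; apply/funext => x.
by rewrite !mxE mulN1r.
Qed.

Lemma H10_inH10 v : H10 Om v -> inH10 v (wgrad Om v).
Proof.
move=> [[Lv [g wg]] Hv]; have ww := wgrad_weak wg.
have Lw i : L2 (co (wgrad Om v) i) by have [] := ww i.
split => // e e0.
have se : 0 < Num.sqrt e by rewrite sqrtr_gt0.
have [phi tp Hp] := Hv _ se; exists phi => //.
have E1 : (fun x => v x - phi x) = fun x => v x + -1 * phi x.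
  by apply/funext => x; rewrite mulN1r.
have wd := weak_lin (-1) Lv (test_L2 tp) ww (weak_test tp).
move: Hp; rewrite E1 (H1_normE _ wd); last first.
  by rewrite -E1; apply: L2B => //; exact: test_L2.
rewrite ltr_sqrt// -E1 => Hp.
set A := sqn _ in Hp *; set B := nrm2 _ in Hp.
have A0 : 0 <= A by exact: sqn_ge0.
have B0 : 0 <= B by exact: nrm2_ge0.
split; first by lra.
move=> i; apply: (@le_trans _ _ B); last by lra.
rewrite /B /nrm2 (bigD1 i)//= -[leLHS]addr0 lerD//; last by apply: sumr_ge0 => j _; exact: sqn_ge0.
rewrite le_eqVlt; apply/orP; left; apply/eqP; congr sqn; apply/funext => x.
by rewrite !mxE mulN1r.
Qed.

Lemma nrm2_triangle g h : (forall i, L2 (co g i)) -> (forall i, L2 (co h i)) ->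
  nrm2 (fun x => g x + h x) <= 2 * (nrm2 g + nrm2 h).
Proof.
move=> Lg Lh; rewrite /nrm2 -big_split mulr_sumr; apply: ler_sum => i _ /=.
have -> : (fun x => (g x + h x) ord0 i) = fun x => g x ord0 i + h x ord0 i.
  by apply/funext => x; rewrite mxE.
exact: sqn_triangle.
Qed.

End WeakGradient.

(** Away from 0 continuity follows from differentiability; for l = 0 it follows from monotonicity of
    the power. *)
Lemma powR_cvg (R : realType) (q : R) (f : nat -> R) (l : R) : 0 < q -> f k @[k --> \oo] --> l ->
  (`|f k| `^ q) @[k --> \oo] --> (`|l| `^ q).
Proof.
move=> q0 fl.
have fl' : `|f k| @[k --> \oo] --> `|l| by exact: cvg_norm.
have [l0|l0] := eqVneq l 0.
  rewrite l0 normr0 powR0 ?gt_eqF//; apply/cvgrPdist_lt => e e0.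
  move: fl'; rewrite l0 normr0 => /cvgrPdist_lt /(_ _ (powR_gt0 q^-1 e0)).
  apply: filterS => k; rewrite !sub0r !normrN normr_id => h.
  rewrite ger0_norm ?powR_ge0//.
  have -> : e = (e `^ q^-1) `^ q by rewrite -powRrM mulVf ?gt_eqF// powRr1// ltW.
  by apply: gt0_ltr_powR; rewrite ?nnegrE ?powR_ge0.
have lp : 0 < `|l| by rewrite normr_gt0.
have C : {for `|l|, continuous (fun y : R => y `^ q)}.
  apply: differentiable_continuous; apply/derivable1_diffP.
  by apply: derivable_powR; rewrite in_itv/= andbT.
exact: (continuous_cvg _ C fl').
Qed.

(** * Sobolev inequality on H^1_0 *)

Section SobolevW.
Variables (R : realType) (n : nat) (q : R).
Local Notation rV := 'rV[R]_n.
Local Notation mu := (lebesgue_rV R n).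
Local Notation Om := (@unit_ball R n).
Local Notation test := (@test_function R n Om).
Hypotheses (q2 : 2 <= q) (b0 : 0 < n%:R + q - n%:R * q / 2) (n0 : (0 < n)%N).
Let mO : measurable (Om : set rV) := @measurable_unit_ball R n.
Let fO : (mu Om < +oo)%E := @mu_unit_ball R n.

Lemma powq_measurable (v : rV -> R) : measurable_fun Om v ->
  measurable_fun Om (fun x => `|v x| `^ q).
Proof.
move=> mv; apply: (measurableT_comp (measurable_powR q)) => //.
exact: measurableT_comp.
Qed.

(** Apply Fatou along test functions whose L^2 errors are at most 2^-k, so that they converge almost
    everywhere, while the gradient error [d] is kept fixed. The choice d = [nrm2 g] / n afterwards
    produces the factor 4. *)
Lemma sobolev_H10 : exists2 S : R, 0 <= S & forall (v : rV -> R) (g : rV -> rV), inH10 v g ->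
  integ (fun x => `|v x| `^ q) /\
  \int[mu]_(x in Om) (`|v x| `^ q) <= S * nrm2 g `^ (q / 2).
Proof.
have q0 : 0 < q by exact: lt_le_trans q2.
have q20 : 0 < q / 2 by rewrite divr_gt0.
have nR : 0 < n%:R :> R by rewrite ltr0n.
have [S S0 HS] := embedding q2 b0 n0.
exists (S * 4 `^ (q / 2)); first by rewrite mulr_ge0// powR_ge0.
move=> v g Wv; have [Lv Lg Hg] := Wv; have mv : measurable_fun Om v by case: Lv.
have D0 := nrm2_ge0 g.
have main (d : R) : 0 < d ->
    (\int[mu]_(x in Om) (`|v x| `^ q)%:E <= (S * (2 * nrm2 g + 2 * (n%:R * d)) `^ (q / 2))%:E)%E.
  move=> d0.
  have HH k : exists phi, test phi /\ sqn (fun x => v x - phi x) <= 1 / 2 ^+ k /\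
      forall i, sqn (fun x => g x ord0 i - partial i phi x) <= d.
    have m0 : 0 < Num.min (1 / 2 ^+ k) d by rewrite lt_min d0 divr_gt0// exprn_gt0.
    have [phi tp [h1 h2]] := Hg _ m0; exists phi; split=> //; split.
      by apply: le_trans h1 _; rewrite ge_min lexx.
    by move=> i; apply: le_trans (h2 i) _; rewrite ge_min lexx orbT.
  have [p Hp] := choice HH.
  have tp k : test (p k) by have [] := Hp k.
  have := @ae_cvg0 R n (fun k x => v x - p k x) 1.
  move=> /(_ (fun k => L2B Lv (test_L2 (tp k))) (fun k => (Hp k).2.1)) cv.
  apply: (@fatou_real R n (fun k x => `|p k x| `^ q)).
  - by move=> k; apply: powq_measurable; case: (test_L2 (tp k)).
  - exact: powq_measurable.
  - by move=> k x _; exact: powR_ge0.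
  - apply: filterS cv => x Hx Ox; apply: powR_cvg => //.
    have -> : p ^~ x = fun k => v x - (v x - p k x) by apply/funext => k; rewrite opprB addrC subrK.
    rewrite -[X in _ --> X]subr0; apply: cvgB; [exact: cvg_cst|exact: Hx].
  - near=> k.
    rewrite -EFin_Rint; last by apply: bdm_int; exact: pow_bdm.
    rewrite lee_fin; apply: le_trans (HS _ (tp k)) _; rewrite ler_wpM2l//.
    apply: ge0_ler_powR; rewrite ?nnegrE ?dir_ge0//; first exact: ltW.
      by rewrite addr_ge0// mulr_ge0// mulr_ge0// ltW.
    rewrite -nrm2_grad//.
    have -> : grad (p k) = fun x => g x + (grad (p k) x - g x).
      by apply/funext => x; rewrite addrC subrK.
    have Eco i : (fun x => (grad (p k) x - g x) ord0 i) = fun x => -1 * (g x ord0 i - partial i (p k) x).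
      by apply/funext => x; rewrite !mxE; ring.
    have Lgp i : L2 (fun x => g x ord0 i - partial i (p k) x).
      by apply: L2B => //; exact: partial_L2.
    apply: le_trans (nrm2_triangle Lg _) _ => [i|].
      by rewrite Eco; apply: L2Z.
    rewrite -mulrDr ler_wpM2l// lerD2l.
    apply: (@le_trans _ _ (\sum_(i < n) d)).
      apply: ler_sum => i _; rewrite Eco sqnZ//.
      by rewrite sqrrN expr1n mul1r; have [_ [_]] := Hp k; apply.
    by rewrite sumr_const card_ord mulr_natl.
have iv : integ (fun x => `|v x| `^ q).
  apply: int_ge0_lty; first exact: powq_measurable.
    by move=> x _; exact: powR_ge0.
  exact: le_lt_trans (main 1 ltr01) (ltry _).
split => //.
have {}main (d : R) : 0 < d -> \int[mu]_(x in Om) (`|v x| `^ q) <=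
    S * (2 * nrm2 g + 2 * (n%:R * d)) `^ (q / 2).
  by move=> d0; rewrite -lee_fin EFin_Rint//; exact: main.
have [g0|gn0] := eqVneq (nrm2 g) 0.
  rewrite g0 powR0 ?gt_eqF// mulr0.
  apply: (@le_invn _ _ _ S) => m; rewrite add0r.
  have m0 : 0 < m.+1%:R^-1 :> R by rewrite invr_gt0 ltr0n.
  set r : R := m.+1%:R^-1 in m0 *.
  (* With gradient 0 this d gives the bound S r^q, which is at most S r; r = 1 / (m + 1) is
     arbitrarily small. *)
  apply: le_trans (main (r ^+ 2 / (2 * n%:R)) _) _.
    by rewrite divr_gt0 ?exprn_gt0 ?mulr_gt0.
  rewrite g0 mulr0 add0r; have -> : 2 * (n%:R * (r ^+ 2 / (2 * n%:R))) = r ^+ 2.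
    by field; rewrite gt_eqF.
  rewrite ler_wpM2l// -powR_mulrn ?(ltW m0)// -powRrM mulrC divfK//.
  apply: ge1r_powR; last by apply: le_trans q2; rewrite ler1n.
  by rewrite m0 /= invf_le1 ?ltr0n// ler1n.
have gp : 0 < nrm2 g by rewrite lt_neqAle eq_sym gn0.
have := main (nrm2 g / n%:R) (divr_gt0 gp nR).
have -> : 2 * nrm2 g + 2 * (n%:R * (nrm2 g / n%:R)) = 4 * nrm2 g by field; rewrite gt_eqF.
by rewrite powRM// mulrA.
Unshelve. all: by end_near.
Qed.

End SobolevW.

(** * The nonlinear functional and its derivative *)

Section PowRem.
Variables (R : realType).
Implicit Types (q a b x : R).

(** The minimum and maximum let it apply whichever of s and t is larger. *)
Lemma powR_mvt (r s t : R) : 0 < s -> 0 < t -> exists z, [/\ Num.min s t <= z, z <= Num.max s t &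
  s `^ r - t `^ r = r * z `^ (r - 1) * (s - t)].
Proof.
wlog st : s t / s < t.
  move=> H s0 t0; have [->|] := eqVneq s t.
    by exists t; rewrite minxx maxxx !subrr mulr0; split.
  rewrite neq_lt => /orP[st|ts]; first exact: H.
  have [z [h1 h2 h3]] := H t s ts t0 s0; exists z; split; [by rewrite minC|by rewrite maxC|].
  by rewrite -opprB h3; ring.
move=> s0 t0; rewrite (min_idPl (ltW st)) (max_idPr (ltW st)).
have D x : 0 < x -> is_derive x (1 : R) (fun y : R => y `^ r) (r * x `^ (r - 1)).
  move=> x0; apply: DeriveDef; first by apply: derivable_powR; rewrite in_itv/= andbT.
  by rewrite -derive1E powR_derive1// in_itv/= andbT.
have [||z] := @MVT _ (fun y : R => y `^ r) (fun y => r * y `^ (r - 1)) s t st.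
- by move=> x; rewrite in_itv/= => /andP[sx _]; apply: D; exact: lt_trans sx.
- apply: derivable_within_continuous => x; rewrite in_itv/= => /andP[sx _].
  by have [] := D x (lt_le_trans s0 sx).
rewrite in_itv/= => /andP[h1 h2 h3]; exists z; split; try exact: ltW.
by rewrite -opprB h3; ring.
Qed.

(** For |x| >= 1 / 2 the three terms are bounded separately, with constant [C1]. For |x| < 1 / 2 two
    uses of the mean value theorem give q (q - 1) y^(q - 2) (z - 1) x with |z - 1| <= |x|, hence
    [C2]. *)
Lemma pow_rem1 q : 2 <= q -> exists2 C : R, 0 <= C & forall x : R,
  `| `|1 + x| `^ q - 1 - q * x| <= C * (x ^+ 2 + `|x| `^ q).
Proof.
move=> q2; have q0 : 0 < q by lra.
pose C1 := 3 `^ q + 4 + 2 * q; pose C2 := q * (q - 1) * 2 `^ (q - 2).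
have p3 := powR_ge0 3 q; have p2 := powR_ge0 2 (q - 2).
have C10 : 0 <= C1 by rewrite /C1; lra.
have C20 : 0 <= C2 by rewrite /C2 !mulr_ge0//; lra.
exists (C1 + C2); first exact: addr_ge0.
move=> x; have xq := powR_ge0 `|x| q; have x2 := sqr_ge0 x.
have [hx|hx] := leP 2^-1 `|x|.
  apply: (@le_trans _ _ (C1 * (x ^+ 2 + `|x| `^ q))); last first.
    by rewrite ler_wpM2r ?addr_ge0// lerDl.
  have hx2 : 4^-1 <= x ^+ 2.
    rewrite -(real_normK (num_real x)); nra.
  have h1 : `|1 + x| `^ q <= 3 `^ q * `|x| `^ q.
    rewrite -powRM//; apply: ge0_ler_powR; rewrite ?nnegrE ?mulr_ge0//; first exact: ltW.
    by apply: le_trans (ler_normD _ _) _; rewrite normr1; lra.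
  have h2 : `|q * x| <= 2 * q * x ^+ 2.
    rewrite normrM (gtr0_norm q0) -(real_normK (num_real x)).
    have -> : 2 * q * `|x| ^+ 2 = q * `|x| + q * `|x| * (2 * `|x| - 1) by ring.
    by rewrite lerDl mulr_ge0 ?(mulr_ge0 (ltW q0))//; lra.
  have h4 := powR_ge0 `|1 + x| q.
  apply: le_trans (ler_normB _ _) _; apply: (@le_trans _ _ ((3 `^ q * `|x| `^ q + 1) + 2 * q * x ^+ 2)).
    rewrite lerD//; apply: le_trans (ler_normB _ _) _; rewrite normr1 lerD2r ger0_norm//.
  rewrite /C1; nra.
have /ltr_normlP[hx1 hx2] := hx.
have x1 : 0 < 1 + x by lra.
rewrite (gtr0_norm x1).
have [z [z1 z2 z3]] := powR_mvt q x1 ltr01.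
have zb : 2^-1 <= z /\ z <= 3 / 2 /\ `|z - 1| <= `|x|.
  have [xp|xn] := leP 0 x.
    rewrite (ger0_norm xp) in hx *.
    have m1 : Num.min (1 + x) 1 = 1 by apply/min_idPr; lra.
    have m2 : Num.max (1 + x) 1 = 1 + x by apply/max_idPl; lra.
    rewrite m1 in z1; rewrite m2 in z2.
    by split; [lra|split; [lra|rewrite ger0_norm; lra]].
  rewrite (ltr0_norm xn) in hx *.
  have m1 : Num.min (1 + x) 1 = 1 + x by apply/min_idPl; lra.
  have m2 : Num.max (1 + x) 1 = 1 by apply/max_idPr; lra.
  rewrite m1 in z1; rewrite m2 in z2.
  by split; [lra|split; [lra|rewrite ler0_norm; lra]].
have [zb1 [zb2 zb3]] := zb.
have z0 : 0 < z by lra.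
have [y [y1 y2 y3]] := powR_mvt (q - 1) z0 ltr01.
have y0 : 0 <= y <= 2.
  have : Num.max z 1 <= 2 by rewrite ge_max; apply/andP; split; lra.
  have : 0 <= Num.min z 1 by rewrite le_min; apply/andP; split; lra.
  by move=> h1 h2; apply/andP; split; [exact: le_trans y1|exact: le_trans h2].
have {y0} /andP[y0 y02] := y0.
have E : (1 + x) `^ q - 1 - q * x = q * (q - 1) * y `^ (q - 2) * (z - 1) * x.
  rewrite powR1 in z3; rewrite z3 powR1 in y3 *.
  have -> : (1 + x - 1) = x by ring.
  have -> : q * z `^ (q - 1) * x - q * x = q * (z `^ (q - 1) - 1) * x by ring.
  rewrite y3; have -> : q - 1 - 1 = q - 2 by ring.
  ring.
rewrite E !normrM.
have hy : `|y `^ (q - 2)| <= 2 `^ (q - 2).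
  rewrite ger0_norm ?powR_ge0//; apply: ge0_ler_powR; rewrite ?nnegrE//; lra.
have q1 : 0 <= q - 1 by lra.
rewrite (gtr0_norm q0) (ger0_norm q1).
apply: (@le_trans _ _ (C2 * x ^+ 2)).
  rewrite -(real_normK (num_real x)) expr2 [leRHS]mulrA.
  rewrite ler_wpM2r// /C2 ler_pM//; first by rewrite !mulr_ge0// ltW.
  by rewrite ler_wpM2l// mulr_ge0// ltW.
by apply: ler_pM => //; lra.
Qed.

Lemma powq_split q a : 2 <= q -> `|a| `^ (q - 2) * a ^+ 2 = `|a| `^ q.
Proof.
move=> q2; have [->|a0] := eqVneq a 0.
  by rewrite expr0n mulr0 normr0 powR0// gt_eqF// (lt_le_trans _ q2).
have ap : 0 < `|a| by rewrite normr_gt0.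
rewrite -(real_normK (num_real a)) -powR_mulrn ?(ltW ap)// -gt0_powRD//.
by congr (_ `^ _); ring.
Qed.

(** By homogeneity: for a <> 0 put b = a x and multiply [pow_rem1] by |a|^q. *)
Lemma pow_rem q : 2 <= q -> exists2 C : R, 0 <= C & forall a b : R,
  `| `|a + b| `^ q - `|a| `^ q - q * (`|a| `^ (q - 2) * a * b)| <=
  C * (`|a| `^ (q - 2) * b ^+ 2 + `|b| `^ q).
Proof.
move=> q2; have q0 : 0 < q by lra.
have [C C0 HC] := pow_rem1 q2.
exists (C + 1); first by rewrite addr_ge0.
move=> a b; have [->|a0] := eqVneq a 0.
  rewrite add0r normr0 [0 `^ q]powR0 ?gt_eqF// !mulr0 mul0r mulr0 !subr0.
  rewrite ger0_norm ?powR_ge0// mulrDl mul1r.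
  apply: (@le_trans _ _ (0 `^ (q - 2) * b ^+ 2 + `|b| `^ q)).
    by rewrite lerDr mulr_ge0 ?powR_ge0 ?sqr_ge0.
  rewrite lerDr; apply: mulr_ge0 => //; apply: addr_ge0; last exact: powR_ge0.
  by apply: mulr_ge0; [exact: powR_ge0|exact: sqr_ge0].
have ap : 0 < `|a| by rewrite normr_gt0.
have [x ->] : exists x, b = a * x by exists (b / a); rewrite mulrC divfK.
have -> : a + a * x = a * (1 + x) by ring.
rewrite !normrM !powRM// exprMn.
have -> : `|a| `^ (q - 2) * a * (a * x) = `|a| `^ q * x by rewrite -(powq_split a q2); ring.
have -> : `|a| `^ (q - 2) * (a ^+ 2 * x ^+ 2) = `|a| `^ q * x ^+ 2 by rewrite mulrA powq_split.
set P := `|a| `^ q.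
have P0 : 0 <= P by exact: powR_ge0.
have -> : P * `|1 + x| `^ q - P - q * (P * x) = P * (`|1 + x| `^ q - 1 - q * x) by ring.
have -> : (C + 1) * (P * x ^+ 2 + P * `|x| `^ q) = P * ((C + 1) * (x ^+ 2 + `|x| `^ q)) by ring.
rewrite normrM (ger0_norm P0) ler_wpM2l//.
apply: le_trans (HC x) _; rewrite ler_wpM2r//; last by rewrite lerDl.
by rewrite addr_ge0 ?powR_ge0 ?sqr_ge0.
Qed.

(** A form of Young's inequality with constant 1, seen by replacing the smaller of |a| and |b| by
    the larger. *)
Lemma powq_young1 q a b : 2 <= q -> `|a| `^ (q - 2) * `|a| * `|b| <= `|a| `^ q + `|b| `^ q.
Proof.
move=> q2; have pa := powR_ge0 `|a| q; have pb := powR_ge0 `|b| q.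
have paa := powR_ge0 `|a| (q - 2).
have [ba|ab] := leP `|b| `|a|.
  apply: (@le_trans _ _ (`|a| `^ q)); last by rewrite lerDl.
  rewrite -(powq_split a q2) -(real_normK (num_real a)) expr2 mulrA.
  by rewrite ler_wpM2l// mulr_ge0.
apply: (@le_trans _ _ (`|b| `^ q)); last by rewrite lerDr.
rewrite -(powq_split b q2) -(real_normK (num_real b)) expr2 mulrA ler_wpM2r//.
apply: ler_pM => //; last exact: ltW.
by apply: ge0_ler_powR; rewrite ?nnegrE ?(ltW ab)//; lra.
Qed.

Lemma powq_young2 q a b : 2 <= q -> `|a| `^ (q - 2) * b ^+ 2 <= `|a| `^ q + `|b| `^ q.
Proof.
move=> q2; have pa := powR_ge0 `|a| q; have pb := powR_ge0 `|b| q.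
have [ba|ab] := leP `|b| `|a|.
  apply: (@le_trans _ _ (`|a| `^ q)); last by rewrite lerDl.
  rewrite -(powq_split a q2) ler_wpM2l ?powR_ge0//.
  by rewrite -(real_normK (num_real a)) -(real_normK (num_real b)) lerXn2r// nnegrE.
apply: (@le_trans _ _ (`|b| `^ q)); last by rewrite lerDr.
rewrite -(powq_split b q2) ler_wpM2r ?sqr_ge0//.
by apply: ge0_ler_powR; rewrite ?nnegrE ?(ltW ab)//; lra.
Qed.

End PowRem.

Section Frechet.
Variables (R : realType) (n : nat) (q : R).
Local Notation rV := 'rV[R]_n.
Local Notation mu := (lebesgue_rV R n).
Local Notation Om := (@unit_ball R n).
Local Notation test := (@test_function R n Om).
Let mO : measurable (Om : set rV) := @measurable_unit_ball R n.
Let fO : (mu Om < +oo)%E := @mu_unit_ball R n.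
Variables (Kx : rV -> R) (M : R).
Hypotheses (q2 : 2 <= q) (mK : measurable_fun Om Kx)
  (HK : forall x, Om x -> 0 <= Kx x <= M).
Implicit Types (v w : rV -> R).

Definition Lq v := measurable_fun Om v /\ integ (fun x => `|v x| `^ q).
Definition Fq v := \int[mu]_(x in Om) (Kx x * `|v x| `^ q).
(** The derivative of [Fq] at w in the direction v, divided by q. *)
Definition Aq w v := \int[mu]_(x in Om) (Kx x * (`|w x| `^ (q - 2) * w x * v x)).

Let M0 : 0 <= `|M|. Proof. exact: normr_ge0. Qed.
Let KM x : Om x -> `|Kx x| <= `|M|.
Proof. by move=> /HK /andP[k0 km]; rewrite (ger0_norm k0) (le_trans km)// ler_norm. Qed.

Lemma pow_meas s v : measurable_fun Om v -> measurable_fun Om (fun x => `|v x| `^ s).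
Proof.
move=> mv; apply: (measurableT_comp (measurable_powR s)) => //.
exact: measurableT_comp.
Qed.

Lemma intK (f g : rV -> R) : measurable_fun Om f -> (forall x, Om x -> `|f x| <= g x) -> integ g ->
  integ (fun x => Kx x * f x).
Proof.
move=> mf fg ig; apply: (@int_le _ _ _ (fun x => `|M| * g x)).
- exact: measurable_funM.
- by move=> x Ox; rewrite normrM ler_pM//; [exact: KM|exact: fg].
- exact: intZ.
Qed.

Lemma Fq_int v : Lq v -> integ (fun x => Kx x * `|v x| `^ q).
Proof.
move=> [mv iv]; apply: (intK _ _ iv); first exact: pow_meas.
by move=> x _; rewrite ger0_norm// powR_ge0.
Qed.

Lemma Aq_meas w v : measurable_fun Om w -> measurable_fun Om v ->
  measurable_fun Om (fun x => `|w x| `^ (q - 2) * w x * v x).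
Proof.
move=> mw mv; apply: measurable_funM => //; apply: measurable_funM => //.
exact: pow_meas.
Qed.

Lemma Aq_int w v : Lq w -> Lq v -> integ (fun x => Kx x * (`|w x| `^ (q - 2) * w x * v x)).
Proof.
move=> [mw iw] [mv iv]; apply: (intK _ _ (intD iw iv)); first exact: Aq_meas.
move=> x _; rewrite !normrM (ger0_norm (powR_ge0 _ _)).
exact: powq_young1.
Qed.

Lemma Lq_lin c v w : Lq v -> Lq w -> Lq (fun x => v x + c * w x).
Proof.
move=> [mv iv] [mw iw].
have q0 : 0 <= q by exact: le_trans q2.
have m1 : measurable_fun Om (fun x => v x + c * w x).
  by apply: measurable_funD => //; exact: measurable_funM.
split => //.
apply: (@int_le _ _ _ (fun x => 2 `^ q * (`|v x| `^ q + `|c| `^ q * `|w x| `^ q))).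
- exact: pow_meas.
- move=> x _; rewrite ger0_norm ?powR_ge0//.
  by apply: le_trans (powR_add2 _ _ q0) _; rewrite normrM powRM.
- by apply: intZ; apply: intD => //; exact: intZ.
Qed.

Lemma test_Lq phi : test phi -> Lq phi.
Proof.
move=> tp; split; first by case: (test_L2 tp).
by apply: bdm_int; exact: pow_bdm.
Qed.

Lemma Aq_add w v v' c : Lq w -> Lq v -> Lq v' ->
  Aq w (fun x => v x + c * v' x) = Aq w v + c * Aq w v'.
Proof.
move=> Lw Lv Lv'; rewrite /Aq -RintZ; last exact: Aq_int.
rewrite -RintD; [|exact: Aq_int|by apply: intZ; exact: Aq_int].
by apply: eq_Rintegral => x _; ring.
Qed.

(** Here t bounds the L^q norm of v. The constant depends on w alone, so the expansion is uniform
    over all directions of norm at most 1. *)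
Lemma frechet w : Lq w -> exists2 C : R, 0 <= C & forall v t, Lq v -> 0 <= t <= 1 ->
  \int[mu]_(x in Om) (`|v x| `^ q) <= t `^ q ->
  `|Aq w v| <= C * t /\ `|Fq (fun x => w x + v x) - Fq w - q * Aq w v| <= C * t ^+ 2.
Proof.
move=> Lw; have [mw iw] := Lw.
have q0 : 0 < q by exact: lt_le_trans q2.
have [C0 C00 HC] := pow_rem q2.
pose B := \int[mu]_(x in Om) (`|w x| `^ q).
have B0 : 0 <= B by apply: Rintegral_ge0 => x _; exact: powR_ge0.
pose C := `|M| * (B + 1) + `|M| * C0 * (B + 2).
have CC0 : 0 <= C by rewrite addr_ge0// !mulr_ge0// addr_ge0.
exists C => //.
have main v t : Lq v -> 0 < t <= 1 -> \int[mu]_(x in Om) (`|v x| `^ q) <= t `^ q ->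
    `|Aq w v| <= C * t /\ `|Fq (fun x => w x + v x) - Fq w - q * Aq w v| <= C * t ^+ 2.
  move=> Lv /andP[t0 t1] vt; have [mv iv] := Lv.
  have tq : 0 < t `^ q by exact: powR_gt0.
  have ic := intZ ((t `^ q)^-1) iv.
  have c1 : \int[mu]_(x in Om) ((t `^ q)^-1 * `|v x| `^ q) <= 1.
    by rewrite RintZ// mulrC ler_pdivrMr// mul1r.
  (* Young's inequality is applied to w and v / t, which have comparable norms; the powers of t are
     then factored out. *)
  have cE x : `|v x / t| `^ q = (t `^ q)^-1 * `|v x| `^ q.
    rewrite normrM powRM// mulrC; congr (_ * _).
    by rewrite gtr0_norm ?invr_gt0// -[t^-1]powR_inv1 ?(ltW t0)// -powRrM mulN1r powRN.
  have iA := Aq_int Lw Lv.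
  split.
    apply: (@le_trans _ _ (`|M| * (B + 1) * t)); last first.
      by rewrite ler_wpM2r ?(ltW t0)// lerDl !mulr_ge0// addr_ge0.
    apply: le_trans (normr_Rint iA) _.
    have i3 : integ (fun x => `|M| * t * (`|w x| `^ q + (t `^ q)^-1 * `|v x| `^ q)).
      by apply: intZ; exact: intD.
    apply: (@le_trans _ _ (\int[mu]_(x in Om) (`|M| * t * (`|w x| `^ q + (t `^ q)^-1 * `|v x| `^ q)))).
      apply: le_Rint => //; first exact: int_norm.
      move=> x Ox; rewrite normrM -[`|M| * t * _]mulrA; apply: ler_pM => //; first exact: KM.
      rewrite !normrM (ger0_norm (powR_ge0 _ _)) -cE.
      have -> : `|w x| `^ (q - 2) * `|w x| * `|v x| = t * (`|w x| `^ (q - 2) * `|w x| * `|v x / t|).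
        by rewrite normrM [`|t^-1|]gtr0_norm ?invr_gt0//; field; rewrite gt_eqF.
      by rewrite ler_wpM2l ?(ltW t0)//; exact: powq_young1.
    rewrite RintZ; last exact: intD.
    rewrite RintD// mulrAC ler_wpM2r ?(ltW t0)// ler_wpM2l// lerD2l.
    exact: c1.
  have Lwv : Lq (fun x => w x + v x).
    by have := Lq_lin 1 Lw Lv; under [fun x => _ + _]eq_fun do rewrite mul1r.
  rewrite /Fq /Aq -RintZ// -RintB; [|exact: Fq_int|exact: Fq_int].
  rewrite -RintB; [|by apply: intB; exact: Fq_int|exact: intZ].
  have iR : integ (fun x => Kx x * `|w x + v x| `^ q - Kx x * `|w x| `^ q
       - q * (Kx x * (`|w x| `^ (q - 2) * w x * v x))).
    by apply: intB; [apply: intB; exact: Fq_int|exact: intZ].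
  apply: le_trans (normr_Rint iR) _.
  have i3 : integ (fun x => `|M| * C0 * t ^+ 2 * (`|w x| `^ q + 2 * ((t `^ q)^-1 * `|v x| `^ q))).
    by apply: intZ; apply: intD => //; exact: intZ.
  apply: (@le_trans _ _ (\int[mu]_(x in Om)
     (`|M| * C0 * t ^+ 2 * (`|w x| `^ q + 2 * ((t `^ q)^-1 * `|v x| `^ q))))).
    apply: le_Rint => //; first exact: int_norm.
    move=> x Ox.
    have -> : Kx x * `|w x + v x| `^ q - Kx x * `|w x| `^ q
       - q * (Kx x * (`|w x| `^ (q - 2) * w x * v x)) =
       Kx x * (`|w x + v x| `^ q - `|w x| `^ q - q * (`|w x| `^ (q - 2) * w x * v x)) by ring.
    have -> : forall y : R, `|M| * C0 * t ^+ 2 * y = `|M| * (C0 * (t ^+ 2 * y)) by move=> y; ring.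
    rewrite normrM; apply: ler_pM => //; first exact: KM.
    apply: le_trans (HC _ _) _; rewrite ler_wpM2l//.
    have h1 := powq_young2 (w x) (v x / t) q2.
    have h2 : `|w x| `^ (q - 2) * v x ^+ 2 = t ^+ 2 * (`|w x| `^ (q - 2) * (v x / t) ^+ 2).
      by field; rewrite gt_eqF.
    (* Uses t <= 1 and q >= 2: the factor t^q is at most t^2. *)
    have h3 : `|v x| `^ q <= t ^+ 2 * `|v x / t| `^ q.
      have -> : `|v x| `^ q = t `^ q * `|v x / t| `^ q.
        by rewrite cE mulrA mulfV ?mul1r// gt_eqF.
      rewrite ler_wpM2r ?powR_ge0// -powR_mulrn ?(ltW t0)//.
      by apply: ger_powR => //; rewrite t0.
    rewrite -cE h2.
    have -> : t ^+ 2 * (`|w x| `^ q + 2 * `|v x / t| `^ q) =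
       t ^+ 2 * (`|w x| `^ q + `|v x / t| `^ q) + t ^+ 2 * `|v x / t| `^ q by ring.
    by rewrite lerD// ler_wpM2l// sqr_ge0.
  rewrite RintZ; last by apply: intD => //; exact: intZ.
  rewrite RintD//; last exact: intZ.
  rewrite RintZ// -/B mulrAC ler_wpM2r ?sqr_ge0//.
  apply: (@le_trans _ _ (`|M| * C0 * (B + 2))); last by rewrite lerDr mulr_ge0// addr_ge0.
  by rewrite ler_wpM2l ?mulr_ge0// lerD2l; lra.
move=> v t Lv /andP[t0 t1] vt.
have [tz|tn] := eqVneq t 0; last first.
  by apply: main => //; rewrite t1 lt_neqAle eq_sym tn t0.
(* For t = 0 the norm of v is 0, so [main] applies with t = 1 / (m + 1) for every m. *)
rewrite tz powR0 ?gt_eqF// in vt.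
have vs s : 0 < s <= 1 -> \int[mu]_(x in Om) (`|v x| `^ q) <= s `^ q.
  by move=> _; apply: le_trans vt (powR_ge0 _ _).
have H (m : nat) : 0 < (m.+1%:R : R)^-1 <= 1 by rewrite invr_gt0 ltr0n/= invf_le1 ?ltr0n// ler1n.
rewrite tz expr0n /= !mulr0; split.
  apply: (@le_invn _ _ _ C) => m; rewrite add0r.
  by have [] := main v _ Lv (H m) (vs _ (H m)).
apply: (@le_invn _ _ _ C) => m; rewrite add0r.
have [_ h] := main v _ Lv (H m) (vs _ (H m)); apply: le_trans h _.
rewrite ler_wpM2l// expr2; have /andP[s0 s1] := H m.
by rewrite ler_piMr// ltW.
Qed.

End Frechet.

(** * Maximizers in a linear class of test functions *)

Section Dirichlet.
Variables (R : realType) (n : nat).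
Local Notation rV := 'rV[R]_n.
Local Notation mu := (lebesgue_rV R n).
Local Notation Om := (@unit_ball R n).
Local Notation test := (@test_function R n Om).
Implicit Types (phi psi : rV -> R).

Definition bil phi psi := \sum_(i < n) ip (partial i phi) (partial i psi).

Lemma dirE phi : test phi -> dir phi = bil phi phi.
Proof.
move=> tp; rewrite -nrm2_grad// /nrm2 /bil; apply: eq_bigr => i _.
by rewrite co_grad; apply: eq_Rintegral => x _; rewrite expr2.
Qed.

Lemma bilC phi psi : bil phi psi = bil psi phi.
Proof. by apply: eq_bigr => i _; rewrite ipC. Qed.

Lemma partial_lin i (c : R) phi psi : test phi -> test psi ->
  partial i (fun x => phi x + c * psi x) = fun x => partial i phi x + c * partial i psi x.
Proof.
move=> t1 t2; apply/funext => x.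
rewrite partialD; [|exact: test_smooth|by apply: test_smooth; exact: testZ].
by rewrite partialZ//; exact: test_smooth.
Qed.

Lemma bil_lin (c : R) phi psi chi : test phi -> test psi -> test chi ->
  bil (fun x => phi x + c * psi x) chi = bil phi chi + c * bil psi chi.
Proof.
move=> t1 t2 t3; rewrite /bil mulr_sumr -big_split; apply: eq_bigr => i _ /=.
rewrite partial_lin// ip_D; [|exact: partial_L2|by apply: L2Z; exact: partial_L2|exact: partial_L2].
by rewrite ip_Z//; exact: partial_L2.
Qed.

Lemma dir_lin (c : R) phi psi : test phi -> test psi ->
  dir (fun x => phi x + c * psi x) = dir phi + 2 * c * bil phi psi + c ^+ 2 * dir psi.
Proof.
move=> t1 t2; have t3 : test (fun x => phi x + c * psi x) by apply: testD => //; exact: testZ.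
rewrite (dirE t3) bil_lin// (bilC phi (fun x => _ + _)) (bilC psi (fun x => _ + _)).
rewrite (bil_lin c t1 t2 t1) (bil_lin c t1 t2 t2) (bilC psi phi) (dirE t1) (dirE t2).
by move: (bil phi phi) (bil phi psi) (bil psi psi) => x y z; ring.
Qed.

Lemma dirZ (c : R) phi : test phi -> dir (fun x => c * phi x) = c ^+ 2 * dir phi.
Proof.
move=> tp; rewrite /dir -bdm_RintZ; [|exact: measurable_unit_ball|exact: mu_unit_ball|exact: gradsq_bdm].
apply: eq_Rintegral => x _; rewrite /gradsq mulr_sumr; apply: eq_bigr => i _.
by rewrite partialZ ?exprMn//; exact: test_smooth.
Qed.

Lemma dir_sub phi psi : test phi -> test psi ->
  dir (fun x => phi x + -1 * psi x) = dir phi - 2 * bil phi psi + dir psi.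
Proof.
move=> t1 t2; rewrite dir_lin//.
by move: (dir phi) (bil phi psi) (dir psi) => x y z; ring.
Qed.

Lemma dir_mid phi psi : test phi -> test psi ->
  dir (fun x => psi x + 2^-1 * (phi x + -1 * psi x)) =
  4^-1 * dir phi + 2^-1 * bil phi psi + 4^-1 * dir psi.
Proof.
move=> t1 t2; have t3 : test (fun x => phi x + -1 * psi x) by apply: testD => //; exact: testZ.
rewrite (dir_lin _ t2 t3) (dir_sub t1 t2) (bilC psi (fun x => _ + _)) (bil_lin _ t1 t2 t2) (dirE t2).
by move: (dir phi) (bil phi psi) (bil psi psi) => x y z; field.
Qed.

End Dirichlet.

Section MidpointAux.
Variable R : realType.
Implicit Types (x y z a d S : R).

(** In this and the next lemma x, y, z stand for [dir f], [bil f h], [dir h]; the sum x / 4 + y / 2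
    + z / 4 is the Dirichlet integral of the midpoint and x - 2 y + z that of the difference. *)
Lemma mid_aux1 x y z : x <= 1 -> z <= 1 -> 0 <= x - 2 * y + z ->
  4^-1 * x + 2^-1 * y + 4^-1 * z <= 1.
Proof. by move=> *; lra. Qed.

Lemma mid_aux2 x y z a : x <= 1 -> z <= 1 ->
  1 - 3 * a <= 4^-1 * x + 2^-1 * y + 4^-1 * z -> x - 2 * y + z <= 12 * a.
Proof. by move=> *; lra. Qed.

(** Here f and m are the values of the functional at a near-maximizer and at the midpoint, d is the
    Dirichlet integral of the midpoint and p the L^q error between the two. *)
Lemma mid_aux3 f m p S a d : 0 < S -> 0 < a -> f <= (1 + a) * m + p -> p <= S * a ->
  S - S * a < f -> m <= S * d -> 1 - 3 * a <= d.
Proof.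
move=> S0 a0 h1 h2 h3 h4.
have a1 : 0 < 1 + a by lra.
have h5 : (1 + a) * m <= (1 + a) * (S * d) by rewrite ler_pM2l.
have h6 : S * (1 - 2 * a) <= S * ((1 + a) * d) by lra.
rewrite ler_pM2l// in h6.
have : (1 + a) * (1 - 3 * a) <= (1 + a) * d by apply: le_trans h6; nra.
by rewrite ler_pM2l.
Qed.

End MidpointAux.

Section Maximizer.
Variables (R : realType) (n : nat) (q : R).
Local Notation rV := 'rV[R]_n.
Local Notation mu := (lebesgue_rV R n).
Local Notation Om := (@unit_ball R n).
Local Notation test := (@test_function R n Om).
Let mO : measurable (Om : set rV) := @measurable_unit_ball R n.
Let fO : (mu Om < +oo)%E := @mu_unit_ball R n.
Variables (Kx : rV -> R) (M : R).
Hypotheses (q2 : 2 <= q) (b0 : 0 < n%:R + q - n%:R * q / 2) (n0 : (0 < n)%N).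
Hypotheses (mK : measurable_fun Om Kx) (HK : forall x, Om x -> 0 <= Kx x <= M).
(** Later the class of test functions antisymmetric under a rotation; linearity is what lets
    midpoints and variations compete. *)
Variable Cl : (rV -> R) -> Prop.
Hypotheses (Cl_test : forall phi, Cl phi -> test phi)
  (Cl_lin : forall c phi psi, Cl phi -> Cl psi -> Cl (fun x => phi x + c * psi x))
  (Cl_ex : exists2 phi, Cl phi & 0 < Fq q Kx phi).
Local Notation F := (Fq q Kx).
Local Notation A := (Aq q Kx).
Implicit Types (phi psi u v w : rV -> R).

Let q0 : 0 < q. Proof. exact: lt_le_trans q2. Qed.

(** [sobolev_H10] in the form in which [frechet] takes its smallness hypothesis, with t = c times
    the gradient norm. *)
Lemma pow_small_H10 : exists2 c : R, 0 <= c & forall v g, inH10 v g -> Lq q v /\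
  \int[mu]_(x in Om) (`|v x| `^ q) <= (c * Num.sqrt (nrm2 g)) `^ q.
Proof.
have [S S0 HS] := sobolev_H10 q2 b0 n0.
exists (S `^ q^-1); first exact: powR_ge0.
move=> v g Wv; have [iv vS] := HS v g Wv; split.
  by split => //; have [[]] := Wv.
apply: le_trans vS _; have g0 := nrm2_ge0 g.
rewrite powRM ?powR_ge0// -powRrM mulVf ?gt_eqF// powRr1//.
by rewrite -powR12_sqrt// -powRrM [2^-1 * q]mulrC.
Qed.

Lemma Fq_le v : Lq q v -> F v <= `|M| * \int[mu]_(x in Om) (`|v x| `^ q).
Proof.
move=> Lv; have [mv iv] := Lv; rewrite /Fq -RintZ//; apply: le_Rint.
- exact: (Fq_int mK HK Lv).
- exact: intZ.
- move=> x /HK /andP[k0 km]; rewrite ler_wpM2r ?powR_ge0//.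
  exact: le_trans km (ler_norm _).
Qed.

Lemma Fq_ge0 v : 0 <= F v.
Proof.
apply: Rintegral_ge0 => x /HK /andP[k0 _]; rewrite mulr_ge0// powR_ge0//.
Qed.

Lemma Fq_Z c v : Lq q v -> F (fun x => c * v x) = `|c| `^ q * F v.
Proof.
move=> Lv; rewrite /Fq -RintZ; last exact: (Fq_int mK HK Lv).
by apply: eq_Rintegral => x _; rewrite normrM powRM//; ring.
Qed.

Lemma Fq_conv k : 1 < k -> exists2 C : R, 0 <= C & forall v w, Lq q v -> Lq q w ->
  F (fun x => v x + w x) <= k * F v + C * \int[mu]_(x in Om) (`|w x| `^ q).
Proof.
move=> k1; have [C C0 HC] := @powR_conv R k q k1 (le_trans (ler1n _ 2) q2).
exists (C * `|M|); first by rewrite mulr_ge0.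
move=> v w Lv Lw; have [mw iw] := Lw.
have Lvw : Lq q (fun x => v x + w x).
  by have := Lq_lin q2 1 Lv Lw; under [fun x => _ + _]eq_fun do rewrite mul1r.
have iF := Fq_int mK HK Lv.
apply: (@le_trans _ _ (\int[mu]_(x in Om) (k * (Kx x * `|v x| `^ q) + C * `|M| * `|w x| `^ q))).
  apply: le_Rint.
  - exact: (Fq_int mK HK Lvw).
  - by apply: intD; apply: intZ.
  - move=> x /HK /andP[k0 km].
    apply: le_trans (ler_wpM2l k0 (HC _ _)) _.
    have -> : Kx x * (k * `|v x| `^ q + C * `|w x| `^ q) =
       k * (Kx x * `|v x| `^ q) + C * `|w x| `^ q * Kx x by ring.
    rewrite lerD2l -!mulrA ler_wpM2l// [leLHS]mulrC ler_wpM2r ?powR_ge0//.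
    exact: le_trans km (ler_norm _).
rewrite RintD; [|exact: intZ|exact: intZ].
by rewrite RintZ// RintZ.
Qed.

Definition values := [set F phi | phi in [set phi | Cl phi /\ dir phi <= 1]].
Definition supval := sup values.
Local Notation S := supval.

Lemma Cl0 : Cl (fun=> 0).
Proof.
have [phi cp _] := Cl_ex; have := Cl_lin (-1) cp cp.
by congr Cl; apply/funext => x; rewrite mulN1r subrr.
Qed.

Lemma ClZ c phi : Cl phi -> Cl (fun x => c * phi x).
Proof.
move=> cp; have := Cl_lin c Cl0 cp.
by congr Cl; apply/funext => x; rewrite add0r.
Qed.

Lemma F_dir : exists2 B : R, 0 <= B & forall phi, test phi -> F phi <= B * dir phi `^ (q / 2).
Proof.
have [B B0 HB] := embedding q2 b0 n0.
exists (`|M| * B); first by rewrite mulr_ge0.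
move=> phi tp; apply: le_trans (Fq_le (test_Lq q2 tp)) _.
by rewrite -mulrA ler_wpM2l//; exact: HB.
Qed.

Lemma values_sup : has_sup values.
Proof.
split.
  have [phi cp Fp] := Cl_ex.
  exists (F (fun=> 0)), (fun=> 0) => //; split; first exact: Cl0.
  have t0 := Cl_test Cl0.
  have := dirZ 0 t0; under [fun x => _ * _]eq_fun do rewrite mul0r.
  by move=> ->; rewrite expr0n mul0r.
have [B B0 HB] := F_dir; exists B => _ [phi [cp dp] <-].
apply: le_trans (HB _ (Cl_test cp)) _; rewrite ler_piMr//.
apply: (@le_trans _ _ (1 `^ (q / 2))); last by rewrite powR1.
apply: ge0_ler_powR; rewrite ?nnegrE ?dir_ge0//.
by rewrite divr_ge0// ltW.
Qed.

Lemma F_le_S phi : Cl phi -> dir phi <= 1 -> F phi <= S.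
Proof. by move=> cp dp; apply: sup_upper_bound; [exact: values_sup|exists phi]. Qed.

Lemma S_gt0 : 0 < S.
Proof.
have [phi cp Fp] := Cl_ex; have tp := Cl_test cp; have d0 := dir_ge0 phi.
pose c := (1 + dir phi)^-1.
have c0 : 0 < c by rewrite invr_gt0; lra.
apply: (@lt_le_trans _ _ (F (fun x => c * phi x))).
  by rewrite Fq_Z ?mulr_gt0 ?powR_gt0 ?normr_gt0 ?gt_eqF//; exact: (test_Lq q2).
apply: F_le_S; first exact: ClZ.
rewrite dirZ// /c exprVn mulrC ler_pdivrMr ?mul1r ?exprn_gt0//; nra.
Qed.

(** Rescaling to Dirichlet integral 1 removes the constraint. If the integral is 0 no rescaling is
    possible, and [F_dir] shows that F vanishes. *)
Lemma F_hom phi : Cl phi -> F phi <= S * dir phi `^ (q / 2).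
Proof.
move=> cp; have tp := Cl_test cp; have d0 := dir_ge0 phi.
have [dz|dn] := eqVneq (dir phi) 0.
  have [B B0 HB] := F_dir; apply: le_trans (HB _ tp) _.
  by rewrite dz powR0 ?mulr0// gt_eqF// divr_gt0.
have dp : 0 < dir phi by rewrite lt_neqAle eq_sym dn.
pose s := Num.sqrt (dir phi); have s0 : 0 < s by rewrite sqrtr_gt0.
have := @F_le_S _ (ClZ s^-1 cp).
rewrite dirZ// Fq_Z; last exact: (test_Lq q2).
rewrite exprVn sqr_sqrtr// mulVf// lexx => /(_ isT).
rewrite gtr0_norm ?invr_gt0// -[s^-1]powR_inv1 ?(ltW s0)// -powRrM mulN1r powRN.
rewrite mulrC ler_pdivrMr ?powR_gt0//.
by rewrite /s -powR12_sqrt// -powRrM [2^-1 * q]mulrC.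
Qed.

Let T := {phi : rV -> R | Cl phi /\ dir phi <= 1}.
Let B (d : R) : set T := [set t | S - d < F (sval t)].

(** Replaces a maximizing sequence: by definition of the supremum the sets [B d] generate a proper
    filter, and [ultra_compact] applies to an ultrafilter above it without extraction of
    subsequences. *)
Lemma max_ultra : exists2 U : set_system T, UltraFilter U & forall d, 0 < d -> U (B d).
Proof.
pose G := filter_from [set d : R | 0 < d] B.
have PG : ProperFilter G.
  apply: filter_from_proper.
    apply: filter_from_filter; first by exists 1 => /=.
    move=> i j /= i0 j0; exists (Num.min i j); first by rewrite /= lt_min i0.
    move=> t; rewrite /B /= => h; split; apply: le_lt_trans h; rewrite lerD2l lerN2 ge_min lexx ?orbT//.
  move=> d /= d0; have [_ [phi [cp dp] <-] h] := sup_adherent d0 values_sup.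
  by exists (exist _ phi (conj cp dp)).
have [U [UU GU]] := @ultraFilterLemma T G PG.
by exists U => // d d0; apply: GU; exists d.
Qed.

(* Near-maximizers s, t that are L^q-close have a near-maximal midpoint, whose Dirichlet norm must
   be close to 1; by the parallelogram identity s and t are then close in H^1_0. *)
Lemma max_cauchy (U : set_system T) : UltraFilter U -> (forall d, 0 < d -> U (B d)) ->
  forall e, 0 < e -> exists2 D, U D &
    forall s t, D s -> D t -> dir (fun x => sval s x - sval t x) <= e.
Proof.
move=> UU UB e e0; have PU : ProperFilter U by exact: ultra_proper.
have S0 := S_gt0.
(* The factor 12 is the one of [mid_aux2]. *)
have [a a0 ea] : exists2 a : R, 0 < a & e = 12 * a.
  by exists (e / 12); [rewrite divr_gt0|field].
have k1 : 1 < 1 + a by lra.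
have [C C0 HC] := Fq_conv k1.
have Sa : 0 < S * a by rewrite mulr_gt0.
have C1 : 0 < C + 1 by lra.
(* Makes the L^q error term C ep at most S a. *)
pose ep := S * a / (C + 1); have ep0 : 0 < ep by rewrite divr_gt0.
have tT (t : T) : test (sval t) by apply: Cl_test; case: (svalP t).
have dT (t : T) : dir (sval t) <= 1 by case: (svalP t).
have [D UD HD] := @ultra_compact R n q q2 b0 n0 T U (fun t => sval t) 1 UU tT dT ep ep0.
exists (D `&` B (S * a)); first by apply: filterI => //; exact: UB.
move=> s t [Ds Bs] [Dt Bt].
have cf : Cl (sval s) by case: (svalP s).
have ch : Cl (sval t) by case: (svalP t).
have := HD s t Ds Dt.
move: Bs Bt cf ch (tT s) (tT t) (dT s) (dT t); rewrite /B /=.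
move: (sval s) (sval t) => f h F4 _ cf ch tf th df dh Pfh.
pose m := fun x => h x + 2^-1 * (f x + -1 * h x).
have tfh : test (fun x => f x + -1 * h x) by apply: testD => //; exact: testZ.
have cm : Cl m by apply: Cl_lin => //; exact: Cl_lin.
have tm := Cl_test cm.
have -> : (fun x => f x - h x) = fun x => f x + -1 * h x by apply/funext => x; rewrite mulN1r.
have E1 := dir_sub tf th.
have E2 : dir m = 4^-1 * dir f + 2^-1 * bil f h + 4^-1 * dir h by exact: dir_mid.
have dm0 := dir_ge0 m; have d10 := dir_ge0 (fun x => f x + -1 * h x).
have d10' : 0 <= dir f - 2 * bil f h + dir h by rewrite -E1; exact: d10.
have dm1 : dir m <= 1 by rewrite E2; exact: (mid_aux1 df dh d10').
(* As [dir m] <= 1 and q / 2 >= 1, the bound of [F_hom] becomes linear in [dir m]. *)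
have dmq : dir m `^ (q / 2) <= dir m.
  have [->|dmn] := eqVneq (dir m) 0; first by rewrite powR0// gt_eqF// divr_gt0.
  by apply: ge1r_powR; [rewrite lt_neqAle eq_sym dmn dm0|rewrite ler_pdivlMr// mul1r].
have P1 : \int[mu]_(x in Om) (`|f x - m x| `^ q) <= ep.
  apply: le_trans Pfh; rewrite /phi_pow.
  have t1 : test (fun x => f x - m x) by exact: testB.
  have t2 : test (fun x => f x - h x) by exact: testB.
  apply: le_Rint; [by apply: bdm_int; exact: pow_bdm|by apply: bdm_int; exact: pow_bdm|].
  move=> x _; apply: ge0_ler_powR; rewrite ?nnegrE//; first exact: ltW.
  have -> : f x - m x = 2^-1 * (f x - h x) by rewrite /m; field.
  by rewrite normrM ger0_norm// ler_piMl// invf_le1// ler1n.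
have := HC m (fun x => f x - m x) (test_Lq q2 tm) (test_Lq q2 (testB tf tm)).
have -> : (fun x => m x + (f x - m x)) = f by apply/funext => x; rewrite addrC subrK.
move=> F1.
have F2 : F m <= S * dir m.
  by apply: le_trans (F_hom cm) _; rewrite ler_wpM2l// ltW.
have F3 : C * \int[mu]_(x in Om) (`|f x - m x| `^ q) <= S * a.
  apply: le_trans (ler_wpM2l C0 P1) _.
  by rewrite /ep mulrCA ler_piMr ?(ltW Sa)// ler_pdivrMr// mul1r lerDl.
have F6 := mid_aux3 S0 a0 F1 F3 F4 F2.
rewrite E2 in F6; rewrite ea E1; exact: (mid_aux2 df dh F6).
Qed.

End Maximizer.

Section ELAux.
Variable R : realType.

(** Take t of the sign of X, divide by |t| and let t tend to 0. *)
Lemma el_aux (X C t0 : R) : 0 < t0 -> 0 <= C ->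
  (forall t, `|t| <= t0 -> t * X <= C * t ^+ 2) -> X = 0.
Proof.
move=> t00 C0 H; apply: (@abs_le0 _ _ C) => e e0.
pose s := Num.min e t0; have s0 : 0 < s by rewrite lt_min e0.
have st : s <= t0 by rewrite ge_min lexx orbT.
have se : s <= e by rewrite ge_min lexx.
apply: (@le_trans _ _ (C * s)); last by rewrite ler_wpM2l.
have key : s * `|X| <= C * s ^+ 2.
  have [X0|X0] := leP 0 X.
    by rewrite (ger0_norm X0); apply: H; rewrite gtr0_norm.
  have := H (- s); rewrite normrN gtr0_norm// => /(_ st); rewrite sqrrN.
  by rewrite (ltr0_norm X0) mulrN mulNr.
by rewrite -(ler_pM2l s0); apply: le_trans key _; rewrite expr2 mulrCA.
Qed.

Lemma pow_upper (q : R) : 2 <= q -> exists2 C : R, 0 <= C & forall b c t : R,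
  0 <= c -> `|t| <= 1 -> 0 <= 1 + 2 * t * b + t ^+ 2 * c -> `|t| * (2 * `|b| + c) <= 2 ->
  (1 + 2 * t * b + t ^+ 2 * c) `^ (q / 2) <=
  1 + q * t * b + (q * c + C * (2 * `|b| + c) ^+ 2) * t ^+ 2.
Proof.
move=> q2; have [C C0 HC] := pow_rem1 q2; exists C => // b c t c0 t1 x0 hs.
have q0 : 0 < q by lra.
pose y := t * b + t ^+ 2 * c / 2.
have yE : 1 + 2 * t * b + t ^+ 2 * c = 1 + 2 * y by rewrite /y; field.
rewrite yE in x0 *.
have y1 : 0 <= 1 + y by lra.
have yb : `|y| <= `|t| * (2 * `|b| + c) / 2.
  apply: le_trans (ler_normD _ _) _; rewrite !normrM [`|2^-1|]ger0_norm// (ger0_norm c0).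
  have := normr_ge0 t; have := normr_ge0 b; move: (`|t|) (`|b|) t1 => u v t1 v0 u0.
  have : u * u * c <= u * c by rewrite -mulrA ler_piMl// mulr_ge0.
  lra.
have y2 : `|y| <= 1 by lra.
have yq : `|y| `^ q <= y ^+ 2.
  rewrite -(real_normK (num_real y)).
  have [->|yn] := eqVneq `|y| 0; first by rewrite powR0 ?gt_eqF// expr0n.
  rewrite -powR_mulrn//; apply: ger_powR => //.
  by rewrite y2 andbT lt_neqAle eq_sym yn normr_ge0.
have h1 : (1 + 2 * y) `^ (q / 2) <= `|1 + y| `^ q.
  have -> : `|1 + y| `^ q = ((1 + y) ^+ 2) `^ (q / 2).
    by rewrite (ger0_norm y1) -powR_mulrn// -powRrM mulrC divfK.
  apply: ge0_ler_powR; rewrite ?nnegrE ?sqr_ge0//; first by rewrite divr_ge0// ltW.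
  by have := sqr_ge0 y; lra.
apply: (le_trans h1).
have := HC y => /ler_normlP [_ h2].
have h3 : C * (y ^+ 2 + `|y| `^ q) <= C * (2 * y ^+ 2) by rewrite ler_wpM2l//; lra.
have h4 : 2 * y ^+ 2 <= (2 * `|b| + c) ^+ 2 * t ^+ 2.
  have : `|y| ^+ 2 <= (`|t| * (2 * `|b| + c) / 2) ^+ 2.
    by rewrite lerXn2r// nnegrE// !mulr_ge0// addr_ge0// mulr_ge0.
  rewrite real_normK ?num_real// => h.
  have -> : (2 * `|b| + c) ^+ 2 * t ^+ 2 = 4 * (`|t| * (2 * `|b| + c) / 2) ^+ 2.
    by rewrite -[t ^+ 2](real_normK (num_real t)); field.
  have := sqr_ge0 (`|t| * (2 * `|b| + c) / 2); lra.
have h5 := ler_wpM2l C0 h4.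
have h6 : q * y <= q * t * b + q * c * t ^+ 2.
  have -> : q * y = q * t * b + q * c * t ^+ 2 / 2 by rewrite /y; field.
  have : 0 <= q * c * t ^+ 2 by apply: mulr_ge0; [apply: mulr_ge0 => //; exact: ltW|exact: sqr_ge0].
  lra.
lra.
Qed.

Lemma small_eventually (a d : R) : 0 <= a -> 0 < d -> \forall k \near \oo, a / 2 ^+ k <= d.
Proof.
move=> a0 d0; exists (Num.truncn (a / d)).+1 => // k /= hk.
rewrite ler_pdivrMr ?exprn_gt0// mulrC -ler_pdivrMr//.
apply: le_trans (ltW (truncnS_gt _)) _.
rewrite -natrX ler_nat; apply: (leq_trans hk); exact: ltnW (ltn_expl _ _).
Qed.

End ELAux.

(** * Convergence of a maximizing sequence *)

Section EulerLagrange.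
Variables (R : realType) (n : nat) (q : R).
Local Notation rV := 'rV[R]_n.
Local Notation mu := (lebesgue_rV R n).
Local Notation Om := (@unit_ball R n).
Local Notation test := (@test_function R n Om).
Let mO : measurable (Om : set rV) := @measurable_unit_ball R n.
Let fO : (mu Om < +oo)%E := @mu_unit_ball R n.
Variables (Kx : rV -> R) (M : R).
Hypotheses (q2 : 2 <= q) (b0 : 0 < n%:R + q - n%:R * q / 2) (n0 : (0 < n)%N).
Hypotheses (mK : measurable_fun Om Kx) (HK : forall x, Om x -> 0 <= Kx x <= M).
Variable Cl : (rV -> R) -> Prop.
Hypotheses (Cl_test : forall phi, Cl phi -> test phi)
  (Cl_lin : forall c phi psi, Cl phi -> Cl psi -> Cl (fun x => phi x + c * psi x))
  (Cl_ex : exists2 phi, Cl phi & 0 < Fq q Kx phi).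
Local Notation F := (Fq q Kx).
Local Notation A := (Aq q Kx).
Local Notation co g i := (fun x => g x ord0 i).
Local Notation S := (supval q Kx Cl).
Implicit Types (phi psi u v w : rV -> R) (g : rV -> rV).

Let q0 : 0 < q. Proof. exact: lt_le_trans q2. Qed.

Lemma Aq_Z w v c : Lq q w -> Lq q v -> A w (fun x => c * v x) = c * A w v.
Proof.
move=> Lw Lv; rewrite /Aq -RintZ; last exact: (Aq_int q2 mK HK).
by apply: eq_Rintegral => x _; ring.
Qed.

(** The k-th function is picked in the intersection of the first k + 1 sets [D], so that for k <= j
    both functions lie in [D k]. The divisor is the Poincare constant 4 n plus 1: the functions and
    their gradients are then both Cauchy at the rate 4^-k. *)
Lemma max_seq : exists phi : nat -> rV -> R, [/\ forall k, Cl (phi k), forall k, dir (phi k) <= 1,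
  forall k, S - k.+1%:R^-1 < F (phi k) &
  forall k j, (k <= j)%N -> dir (fun x => phi j x - phi k x) <= 1 / 4 ^+ k / (4 * n%:R + 1)].
Proof.
have [U UU UB] := max_ultra q2 b0 n0 mK HK Cl_test Cl_lin Cl_ex.
have PU : ProperFilter U by exact: ultra_proper.
have n1 : 0 < 4 * n%:R + 1 :> R by rewrite ltr_wpDl// mulr_ge0.
have HD (k : nat) : exists D, U D /\ forall s t, D s -> D t ->
    dir (fun x => sval s x - sval t x) <= 1 / 4 ^+ k / (4 * n%:R + 1).
  have e0 : 0 < 1 / 4 ^+ k / (4 * n%:R + 1) :> R by rewrite !divr_gt0// exprn_gt0.
  have [D UD H] := max_cauchy q2 b0 n0 mK HK Cl_test Cl_lin Cl_ex UU UB e0.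
  by exists D.
have {HD}[D HD] := choice HD.
have Ht (k : nat) : exists t : {phi : rV -> R | Cl phi /\ dir phi <= 1},
    (forall j : 'I_k.+1, D j t) /\ S - k.+1%:R^-1 < F (sval t).
  apply: (@filter_ex _ U _); apply: filterI.
    by apply: (filter_forall (f := fun j : 'I_k.+1 => D j)) => j; have [] := HD j.
  by apply: UB; rewrite invr_gt0 ltr0n.
have {Ht}[t Ht] := choice Ht.
exists (fun k => sval (t k)); split.
- by move=> k; case: (svalP (t k)).
- by move=> k; case: (svalP (t k)).
- by move=> k; have [] := Ht k.
- move=> k j kj; apply: (HD k).2.
    by have [h _] := Ht j; have := h (inord k); rewrite inordK// ltnS.
  by have [h _] := Ht k; have := h ord_max.
Qed.

Lemma max_limit (phi : nat -> rV -> R) : (forall k, test (phi k)) ->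
  (forall k j, (k <= j)%N -> dir (fun x => phi j x - phi k x) <= 1 / 4 ^+ k / (4 * n%:R + 1)) ->
  exists u g, [/\ inH10 u g, forall k, sqn (fun x => u x - phi k x) <= 1 / 4 ^+ k &
    forall k i, sqn (fun x => g x ord0 i - partial i (phi k) x) <= 1 / 4 ^+ k].
Proof.
move=> tp Hd.
have n1 : 0 < 4 * n%:R + 1 :> R by rewrite ltr_wpDl// mulr_ge0.
have p4 (k : nat) : 0 < 1 / 4 ^+ k :> R by rewrite divr_gt0// exprn_gt0.
have dn k j : (k <= j)%N -> (4 * n%:R + 1) * dir (fun x => phi j x - phi k x) <= 1 / 4 ^+ k.
  by move=> kj; rewrite mulrC -ler_pdivlMr//; exact: Hd.
have [u [Lu _ Nu]] : exists u, [/\ L2 u, {ae mu, forall x, Om x -> phi k x @[k --> \oo] --> u x} &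
    forall k, sqn (fun x => u x - phi k x) <= 1 / 4 ^+ k].
  apply: riesz_fischer => [k|k j kj]; first exact: test_L2.
  apply: le_trans (poincare n0 (testB (tp j) (tp k))) _.
  apply: le_trans (dn k j kj); rewrite ler_wpM2r ?lerDl//; exact: dir_ge0.
have Hg (i : 'I_n) : exists h, L2 h /\
    forall k, sqn (fun x => h x - partial i (phi k) x) <= 1 / 4 ^+ k.
  have [h [Lh _ Nh]] : exists u, [/\ L2 u,
      {ae mu, forall x, Om x -> partial i (phi k) x @[k --> \oo] --> u x} &
      forall k, sqn (fun x => u x - partial i (phi k) x) <= 1 / 4 ^+ k].
    apply: riesz_fischer => [k|k j kj]; first exact: partial_L2.
    have -> : (fun x => partial i (phi j) x - partial i (phi k) x) =
       partial i (fun x => phi j x + -1 * phi k x).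
      by rewrite partial_lin//; apply/funext => x; rewrite mulN1r.
    have tjk : test (fun x => phi j x + -1 * phi k x) by apply: testD => //; exact: testZ.
    apply: le_trans (dn k j kj).
    have -> : (fun x => phi j x - phi k x) = fun x => phi j x + -1 * phi k x.
      by apply/funext => x; rewrite mulN1r.
    apply: (@le_trans _ _ (dir (fun x => phi j x + -1 * phi k x))).
      rewrite -nrm2_grad// /nrm2 (bigD1 i)//= co_grad lerDl sumr_ge0// => l _; exact: sqn_ge0.
    by rewrite ler_peMl ?dir_ge0// lerDr mulr_ge0.
  by exists h.
have {Hg}[h Hh] := choice Hg.
pose g x : rV := \row_i h i x.
have Eg i : co g i = h i by apply/funext => x; rewrite mxE.
have Ng k i : sqn (fun x => g x ord0 i - partial i (phi k) x) <= 1 / 4 ^+ k.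
  have -> : (fun x => g x ord0 i - partial i (phi k) x) = fun x => h i x - partial i (phi k) x.
    by apply/funext => x; rewrite mxE.
  exact: (Hh i).2.
exists u, g; split => //; split => //; first by move=> i; rewrite Eg; exact: (Hh i).1.
move=> e e0.
have [k hk] : exists k : nat, 1 / 4 ^+ k <= e.
  exists (Num.truncn e^-1).+1; rewrite mul1r invf_ple ?posrE ?exprn_gt0//.
  apply: le_trans (ltW (truncnS_gt _)) _.
  by rewrite -natrX ler_nat ltnW// ltn_expl.
exists (phi k) => //; split; first exact: le_trans (Nu k) hk.
by move=> i; exact: le_trans (Ng k i) hk.
Qed.

(** The differences tend to 0 in L^q at the rate 2^-k, and [frechet] gives continuity of F at w. It
    is used for w = u and for w = u + t psi. *)
Lemma F_seq (phi : nat -> rV -> R) u g w : (forall k, test (phi k)) -> inH10 u g -> Lq q w ->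
  (forall k i, sqn (fun x => g x ord0 i - partial i (phi k) x) <= 1 / 4 ^+ k) ->
  F (fun x => w x + (phi k x + -1 * u x)) @[k --> \oo] --> F w.
Proof.
move=> tp Wu Lw Ng; have [c c0 Hc] := pow_small_H10 q2 b0 n0.
have [C C0 HC] := frechet q2 mK HK Lw.
pose a := c * Num.sqrt n%:R; have a0 : 0 <= a by rewrite mulr_ge0// sqrtr_ge0.
have Hv k : Lq q (fun x => phi k x + -1 * u x) /\
    \int[mu]_(x in Om) (`|phi k x + -1 * u x| `^ q) <= (a / 2 ^+ k) `^ q.
  have Wk := inH10_lin (-1) (inH10_test (tp k)) Wu.
  have [Lv vs] := Hc _ _ Wk; split => //; apply: le_trans vs _.
  have cs h : 0 <= c * Num.sqrt h by rewrite mulr_ge0// sqrtr_ge0.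
  apply: ge0_ler_powR; rewrite ?nnegrE ?cs ?divr_ge0 ?exprn_ge0//; first exact: ltW.
  rewrite /a -mulrA ler_wpM2l//.
  have -> : Num.sqrt n%:R / 2 ^+ k = Num.sqrt (n%:R * (1 / 4 ^+ k)) :> R.
    have -> : 1 / 4 ^+ k = (2 ^+ k)^-1 ^+ 2 :> R.
      by rewrite mul1r exprVn -exprM mulnC exprM; congr (_ ^+ _)^-1; ring.
    by rewrite sqrtrM// sqrtr_sqr ger0_norm// invr_ge0 exprn_ge0.
  apply: ler_wsqrtr.
  apply: (@le_trans _ _ (\sum_(i < n) (1 / 4 ^+ k))); last first.
    by rewrite sumr_const card_ord mulr_natl.
  apply: ler_sum => i _; apply: le_trans (Ng k i).
  rewrite le_eqVlt; apply/orP; left; apply/eqP; apply: eq_Rintegral => x _.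
  by rewrite !mxE; ring.
apply/cvgrPdist_le => e e0.
have qC0 : 0 < q * C + C + 1 by rewrite ltr_wpDl// addr_ge0// mulr_ge0// ltW.
pose d := Num.min 1 (e / (q * C + C + 1)).
have d0 : 0 < d by rewrite lt_min ltr01 divr_gt0.
have d1 : d <= 1 by rewrite ge_min lexx.
have de : (q * C + C + 1) * d <= e.
  by rewrite mulrC -ler_pdivlMr// ge_min lexx orbT.
apply: filterS (small_eventually a0 d0) => k hk.
have [Lv vs] := Hv k; set v := fun x => _ + _ in Lv vs *.
pose s := a / 2 ^+ k; have s0 : 0 <= s by rewrite divr_ge0// exprn_ge0.
have s1 : s <= 1 by exact: le_trans d1.
have [|h1 h2] := HC v s Lv _ vs; first by rewrite s0.
rewrite distrC.
have -> : F (fun x => w x + v x) - F w = (F (fun x => w x + v x) - F w - q * A w v) + q * A w v.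
  by rewrite subrK.
apply: le_trans (ler_normD _ _) _.
have h3 : `|q * A w v| <= q * (C * s) by rewrite normrM gtr0_norm// ler_wpM2l// ltW.
apply: le_trans (lerD h2 h3) _.
have h4 : C * s ^+ 2 <= C * s by rewrite expr2 ler_wpM2l// ler_piMr.
apply: le_trans de; apply: (@le_trans _ _ ((q * C + C + 1) * s)).
  have -> : (q * C + C + 1) * s = C * s + q * (C * s) + s by ring.
  by rewrite -[leLHS]addr0 lerD// lerD2r.
by rewrite ler_wpM2l// ltW.
Qed.

End EulerLagrange.

(** * The maximizer and its Euler-Lagrange equation *)

Section MaximizerThm.
Variables (R : realType) (n : nat) (q : R).
Local Notation rV := 'rV[R]_n.
Local Notation mu := (lebesgue_rV R n).
Local Notation Om := (@unit_ball R n).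
Local Notation test := (@test_function R n Om).
Let mO : measurable (Om : set rV) := @measurable_unit_ball R n.
Let fO : (mu Om < +oo)%E := @mu_unit_ball R n.
Variables (Kx : rV -> R) (M : R).
Hypotheses (q2 : 2 <= q) (b0 : 0 < n%:R + q - n%:R * q / 2) (n0 : (0 < n)%N).
Hypotheses (mK : measurable_fun Om Kx) (HK : forall x, Om x -> 0 <= Kx x <= M).
Variable Cl : (rV -> R) -> Prop.
Hypotheses (Cl_test : forall phi, Cl phi -> test phi)
  (Cl_lin : forall c phi psi, Cl phi -> Cl psi -> Cl (fun x => phi x + c * psi x))
  (Cl_ex : exists2 phi, Cl phi & 0 < Fq q Kx phi).
Local Notation F := (Fq q Kx).
Local Notation A := (Aq q Kx).
Local Notation co g i := (fun x => g x ord0 i).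
Local Notation S := (supval q Kx Cl).
Implicit Types (phi psi u v w : rV -> R) (g : rV -> rV).

Let q0 : 0 < q. Proof. exact: lt_le_trans q2. Qed.

Definition wbil g psi := \sum_(i < n) ip (co g i) (partial i psi).

Lemma bil_cvg (phi : nat -> rV -> R) g psi : (forall k, test (phi k)) -> test psi ->
  (forall i, L2 (co g i)) ->
  (forall k i, sqn (fun x => g x ord0 i - partial i (phi k) x) <= 1 / 4 ^+ k) ->
  bil (phi k) psi @[k --> \oo] --> wbil g psi.
Proof.
move=> tp tpsi Lg Ng; rewrite /wbil /bil.
apply: cvg_big => [|i _]; first exact: add_continuous.
apply/cvgrPdist_le => e e0.
pose a := Num.sqrt (sqn (partial i psi)); have a0 : 0 <= a by exact: sqrtr_ge0.
apply: filterS (small_eventually a0 e0) => k hk.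
have Lp := partial_L2 i (tp k); have Ls := partial_L2 i tpsi.
rewrite -ip_B//; apply: le_trans (ip_le (L2B (Lg i) Lp) Ls) _.
rewrite -/a mulrC; apply: le_trans hk; rewrite ler_wpM2l//.
have -> : (2 ^+ k)^-1 = Num.sqrt (1 / 4 ^+ k) :> R.
  have -> : 1 / 4 ^+ k = (2 ^+ k)^-1 ^+ 2 :> R.
    by rewrite mul1r exprVn -exprM mulnC exprM; congr (_ ^+ _)^-1; ring.
  by rewrite sqrtr_sqr ger0_norm// invr_ge0 exprn_ge0.
by apply: ler_wsqrtr; exact: Ng.
Qed.

(* Compare F (u + t psi) with S times the q-th power of its norm, with equality at t = 0. *)
Theorem maximizer : exists u g (phi : nat -> rV -> R),
  [/\ inH10 u g, F u = S, forall k, Cl (phi k),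
    forall k, sqn (fun x => u x - phi k x) <= 1 / 4 ^+ k /\
      forall i, sqn (fun x => g x ord0 i - partial i (phi k) x) <= 1 / 4 ^+ k &
    forall psi, Cl psi -> A u psi = S * wbil g psi].
Proof.
have [phi [cp dp Fp Hd]] := max_seq q2 b0 n0 mK HK Cl_test Cl_lin Cl_ex.
have tp k := Cl_test (cp k).
have [u [g [Wu Nu Ng]]] := max_limit n0 tp Hd.
have [Lu Lg _] := Wu.
have [c c0 Hc] := pow_small_H10 q2 b0 n0.
have [Lqu _] := Hc u g Wu.
have SL phi0 : Cl phi0 -> dir phi0 <= 1 -> F phi0 <= S.
  exact: (F_le_S q2 b0 n0 mK HK Cl_test Cl_lin Cl_ex).
have S0 : 0 < S := S_gt0 q2 b0 n0 mK HK Cl_test Cl_lin Cl_ex.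
have Fu : F u = S.
  have c1 : F (phi k) @[k --> \oo] --> F u.
    have := F_seq q2 b0 n0 mK HK tp Wu Lqu Ng.
    have -> : (fun k => F (fun x => u x + (phi k x + -1 * u x))) = fun k => F (phi k).
      apply/funext => k; congr (Fq q Kx _); apply/funext => x.
      by move: (phi k x) (u x) => a b; ring.
    by [].
  have c2 : F (phi k) @[k --> \oo] --> S.
    apply: (@squeeze_cvgr _ _ _ _ (fun k : nat => S - k.+1%:R^-1) (fun=> S)).
    - by near=> k; rewrite ltW//= SL.
    - rewrite -[X in _ --> X]subr0; apply: cvgB; [exact: cvg_cst|exact: cvg_harmonic].
    - exact: cvg_cst.
  exact: (cvg_unique _ c1 c2).
exists u, g, phi; split => // psi cpsi.
have tpsi := Cl_test cpsi.
have Lpsi := test_Lq q2 tpsi.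
pose bg := wbil g psi; pose d := dir psi.
have d0 : 0 <= d by exact: dir_ge0.
have q20 : 0 < q / 2 by rewrite divr_gt0.
(* The approximants phi k + t psi lie in [Cl], so [F_hom] holds for them, and the bound for u + t
   psi is its limit. In [r], the Dirichlet integral of phi k is replaced by its bound 1. *)
have upper t : 0 <= 1 + 2 * t * bg + t ^+ 2 * d /\
    F (fun x => u x + t * psi x) <= S * (1 + 2 * t * bg + t ^+ 2 * d) `^ (q / 2).
  have Lut : Lq q (fun x => u x + t * psi x) by exact: Lq_lin.
  have c1 : F (fun x => phi k x + t * psi x) @[k --> \oo] --> F (fun x => u x + t * psi x).
    have := F_seq q2 b0 n0 mK HK tp Wu Lut Ng.
    have -> : (fun k => F (fun x => u x + t * psi x + (phi k x + -1 * u x))) =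
        fun k => F (fun x => phi k x + t * psi x).
      apply/funext => k; congr (Fq q Kx _); apply/funext => x.
      by move: (phi k x) (u x) (psi x) => a b e; ring.
    by [].
  pose r k := 1 + 2 * t * bil (phi k) psi + t ^+ 2 * d.
  have c2 : r k @[k --> \oo] --> 1 + 2 * t * bg + t ^+ 2 * d.
    apply: cvgD; last exact: cvg_cst.
    apply: cvgD; first exact: cvg_cst.
    by apply: cvgM; [exact: cvg_cst|exact: bil_cvg].
  have dr k : 0 <= dir (fun x => phi k x + t * psi x) <= r k.
    rewrite dir_ge0/= dir_lin// /r /d.
    by rewrite 2!lerD2r; exact: dp.
  have r0 k : 0 <= r k by have /andP[h1 h2] := dr k; exact: le_trans h2.
  have x0 : 0 <= 1 + 2 * t * bg + t ^+ 2 * d.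
    by apply: (ler_cvg_to (cvg_cst 0) c2); near=> k.
  split => //.
  have c3 : S * `|r k| `^ (q / 2) @[k --> \oo] --> S * `|1 + 2 * t * bg + t ^+ 2 * d| `^ (q / 2).
    by apply: cvgM; [exact: cvg_cst|exact: powR_cvg].
  rewrite -[X in X `^ _](ger0_norm x0).
  apply: (ler_cvg_to c1 c3); near=> k.
  have ck : Cl (fun x => phi k x + t * psi x) by exact: Cl_lin.
  apply: le_trans (F_hom q2 b0 n0 mK HK Cl_test Cl_lin Cl_ex ck) _.
  rewrite ler_wpM2l ?(ltW S0)//; have /andP[h1 h2] := dr k.
  by apply: ge0_ler_powR; rewrite ?nnegrE ?(ltW q20)// ger0_norm.
have [C C0 HC] := frechet q2 mK HK Lqu.
pose P := \int[mu]_(x in Om) (`|psi x| `^ q).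
have P0 : 0 <= P by apply: Rintegral_ge0 => x _; exact: powR_ge0.
pose p := P `^ q^-1; have p0 : 0 <= p by exact: powR_ge0.
have pP : p `^ q = P by rewrite /p -powRrM mulVf ?gt_eqF// powRr1.
have lower t : `|t| * p <= 1 -> F u + q * (t * A u psi) <= F (fun x => u x + t * psi x) + C * (`|t| * p) ^+ 2.
  move=> tp1.
  have Lt : Lq q (fun x => t * psi x).
    have := Lq_lin q2 (t - 1) Lpsi Lpsi.
    by congr Lq; apply/funext => x; ring.
  have [||_ h] := HC (fun x => t * psi x) (`|t| * p) Lt.
  - by rewrite tp1 mulr_ge0.
  - rewrite powRM// pP /P -RintZ; last by case: Lpsi.
    apply: le_Rint => //.
    + by case: Lt.
    + by apply: intZ; case: Lpsi.
    + by move=> x _; rewrite normrM powRM.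
  move: h; rewrite (Aq_Z q2 mK HK _ Lqu Lpsi) => /ler_normlP[h _].
  move: h; move: (F _) (F _) (q * _) (C * _) => a b r s h; lra.
have [E E0 HE] := pow_upper q2.
(* The quadratic errors of the upper and the lower bound together. *)
pose D := S * (q * d + E * (2 * `|bg| + d) ^+ 2) + C * p ^+ 2.
have D0 : 0 <= D.
  rewrite addr_ge0//; last by rewrite mulr_ge0// sqr_ge0.
  rewrite mulr_ge0 ?(ltW S0)// addr_ge0//; first by rewrite mulr_ge0// ltW.
  by rewrite mulr_ge0// sqr_ge0.
(* Small enough for the three smallness conditions of [pow_upper] and [lower]. *)
pose t0 := (1 + p + (2 * `|bg| + d))^-1.
have B0 : 0 <= 2 * `|bg| + d by rewrite addr_ge0// mulr_ge0.
have t00 : 0 < t0 by rewrite invr_gt0; lra.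
have t0b : (1 + p + (2 * `|bg| + d)) * t0 = 1 by rewrite mulfV// gt_eqF//; lra.
suff : q * (A u psi - S * bg) = 0.
  by move/eqP; rewrite mulf_eq0 gt_eqF//= subr_eq0 => /eqP.
apply: (el_aux t00 D0) => t ht.
have t1 : `|t| <= 1 by apply: le_trans ht _; nra.
have t2 : `|t| * p <= 1 by apply: (@le_trans _ _ (t0 * p)); [rewrite ler_wpM2r|nra].
have t3 : `|t| * (2 * `|bg| + d) <= 2.
  by apply: (@le_trans _ _ (t0 * (2 * `|bg| + d))); [rewrite ler_wpM2r|nra].
have [x0 up] := upper t.
have h1 := lower t t2; rewrite Fu in h1.
have h2 := ler_wpM2l (ltW S0) (HE bg d t d0 t1 x0 t3).
have h3 := le_trans h1 (lerD (le_trans up h2) (lexx _)).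
rewrite -subr_ge0; move: h3; rewrite -subr_ge0.
have -> : (`|t| * p) ^+ 2 = t ^+ 2 * p ^+ 2 by rewrite exprMn real_normK// num_real.
congr (0 <= _); rewrite /D; ring.
Unshelve. all: by end_near.
Qed.

End MaximizerThm.

(** * Antisymmetric maximizers *)

Section Orthogonal.
Variables (R : realType) (n : nat) (Q : 'M[R]_n).
Local Notation rV := 'rV[R]_n.
Local Notation mu := (lebesgue_rV R n).
Local Notation Om := (@unit_ball R n).
Local Notation test := (@test_function R n Om).
Local Notation T := (fun x : rV => x *m Q).
Hypotheses (QQ : Q *m Q^T = 1%:M) (HT : mpres T).
Implicit Types (phi psi : rV -> R).

Let QQ' : Q^T *m Q = 1%:M. Proof. exact: mulmx1C. Qed.

Lemma dot_orth (a b : 'cV[R]_n) :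
  \sum_i (Q *m a) i ord0 * (Q *m b) i ord0 = \sum_i a i ord0 * b i ord0.
Proof.
have H (c d : 'cV[R]_n) : \sum_i c i ord0 * d i ord0 = (c^T *m d) ord0 ord0.
  by rewrite mxE; apply: eq_bigr => i _; rewrite mxE.
by rewrite !H trmx_mul -mulmxA (mulmxA Q^T) QQ' mul1mx.
Qed.

Lemma enorm_orth (x : rV) : enorm (x *m Q) = enorm x.
Proof.
have H (y : rV) : \sum_(i < n) y ord0 i ^+ 2 = (y *m y^T) ord0 ord0.
  by rewrite mxE; apply: eq_bigr => i _; rewrite mxE expr2.
by rewrite /enorm !H trmx_mul mulmxA -(mulmxA x) QQ mulmx1.
Qed.

Lemma preimage_orth : T @^-1` Om = Om.
Proof. by apply/seteqP; split => x; rewrite /unit_ball /= enorm_orth. Qed.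

Lemma Rint_orth (f : rV -> R) : measurable_fun Om f ->
  \int[mu]_(x in Om) f (T x) = \int[mu]_(x in Om) f x.
Proof.
move=> mf; rewrite -[in LHS]preimage_orth; apply: (Rint_mpres HT) => //.
exact: measurable_unit_ball.
Qed.

Lemma smooth_orth phi : smooth phi -> smooth (fun x => phi (T x)).
Proof. by move=> sphi; apply: smP; apply: sm_mulmx; exact: sm_smooth. Qed.

Lemma test_orth phi : test phi -> test (fun x => phi (T x)).
Proof.
move=> [sphi [C [cC CO] phi0]]; split; first exact: smooth_orth.
exists ((fun x : rV => x *m Q^T) @` C); last first.
  by move=> x nx; apply: phi0 => CTx; apply: nx; exists (T x) => //; rewrite -mulmxA QQ mulmx1.
split.
  apply: continuous_compact => //; apply: continuous_subspaceT => x.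
  by apply: differentiable_continuous; exact: differentiable_mulmx.
move=> _ [y Cy <-]; have := CO _ Cy; rewrite /unit_ball/= => y1.
by rewrite -enorm_orth -mulmxA QQ' mulmx1.
Qed.

(** By the chain rule the gradient of phi o T is [Q] applied to the gradient at T x; [Q] preserves
    dot products and T preserves the measure. *)
Lemma bil_orth phi psi : test phi -> test psi ->
  bil (fun x => phi (T x)) (fun x => psi (T x)) = bil phi psi.
Proof.
move=> tphi tpsi.
have E a b : test a -> test b -> bil a b =
    \int[mu]_(x in Om) (\sum_(i < n) partial i a x * partial i b x).
  by move=> ta tb; rewrite /bil Rint_sum// => i; apply: L2M; exact: partial_L2.
have E1 := E _ _ (test_orth tphi) (test_orth tpsi).
have E2 := E _ _ tphi tpsi.
rewrite {}E1 {}E2 -[RHS]Rint_orth; last first.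
  apply: int_measurable; apply: int_sum => i; apply: L2M; exact: partial_L2.
apply: eq_Rintegral => x _.
pose a := \col_i partial i phi (T x); pose b := \col_i partial i psi (T x).
transitivity (\sum_i a i ord0 * b i ord0); last by apply: eq_bigr => i _; rewrite !mxE.
rewrite -dot_orth; apply: eq_bigr => i _; rewrite !mxE.
rewrite (partial_mulmx _ _ _ (test_smooth tphi)) (partial_mulmx _ _ _ (test_smooth tpsi)).
by congr (_ * _); apply: eq_bigr => k _; rewrite mxE.
Qed.

End Orthogonal.

Section Symmetric.
Variables (R : realType) (n : nat) (Q : 'M[R]_n) (m : nat) (q : R).
Local Notation rV := 'rV[R]_n.
Local Notation mu := (lebesgue_rV R n).
Local Notation Om := (@unit_ball R n).
Local Notation test := (@test_function R n Om).
Local Notation T := (fun x : rV => x *m Q).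
Let mO : measurable (Om : set rV) := @measurable_unit_ball R n.
Let fO : (mu Om < +oo)%E := @mu_unit_ball R n.
Hypotheses (QQ : Q *m Q^T = 1%:M) (HT : mpres T).
(** The sign changes along an orbit are consistent because the period is even. *)
Hypotheses (m0 : (0 < m)%N) (me : ~~ odd m) (Tm : forall x, iter m T x = x).
Variables (Kx : rV -> R) (M : R).
Hypotheses (q2 : 2 <= q) (b0 : 0 < n%:R + q - n%:R * q / 2) (n0 : (0 < n)%N).
Hypotheses (mK : measurable_fun Om Kx) (HK : forall x, Om x -> 0 <= Kx x <= M).
Hypothesis KT : forall x, Kx (T x) = Kx x.
Implicit Types (phi psi u v w : rV -> R) (g : rV -> rV).
Local Notation co g i := (fun x => g x ord0 i).

Lemma wbil_lin c g phi psi : (forall i, L2 (co g i)) -> test phi -> test psi ->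
  wbil g (fun x => phi x + c * psi x) = wbil g phi + c * wbil g psi.
Proof.
move=> Lg t1 t2; rewrite /wbil mulr_sumr -big_split; apply: eq_bigr => i _ /=.
have L1 := partial_L2 i t1; have L2 := partial_L2 i t2.
rewrite (partial_lin _ _ t1 t2) ipC (ip_D L1 (L2Z c L2) (Lg i)) (ip_Z c L2 (Lg i)).
by rewrite (ipC (partial i phi)) (ipC (partial i psi)).
Qed.

Definition anti phi := test phi /\ forall x, phi (T x) = - phi x.

Lemma anti_test phi : anti phi -> test phi. Proof. by case. Qed.

Lemma anti_lin c phi psi : anti phi -> anti psi -> anti (fun x => phi x + c * psi x).
Proof.
move=> [t1 a1] [t2 a2]; split; first by apply: testD => //; exact: testZ.
by move=> x; rewrite a1 a2 mulrN opprD.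
Qed.

(* [alt psi i x] is the sum of (-1)^j psi (T^j x) over j <= i; for i = m - 1 it is m times the
   projection of psi on the antisymmetric functions. *)
Fixpoint alt psi i : rV -> R :=
  if i is j.+1 then fun x => psi x + -1 * alt psi j (T x) else psi.

Lemma test_alt psi i : test psi -> test (alt psi i).
Proof.
move=> tpsi; elim: i => //= i IH; apply: testD => //; apply: testZ.
exact: (test_orth QQ (phi := alt psi i)).
Qed.

Lemma altS psi i x : alt psi i.+1 x = alt psi i x + (-1) ^+ i.+1 * psi (iter i.+1 T x).
Proof.
elim: i x => [|i IH] x; first by rewrite /= expr1.
have -> : alt psi i.+2 x = psi x + -1 * alt psi i.+1 (T x) by [].
rewrite IH -iterSr mulrDr addrA; congr (_ + _); by rewrite mulrA -exprS.
Qed.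

(** Compare two values of [alt psi m]: the recursion gives psi - (alt psi m.-1) o T, and [altS]
    gives alt psi m.-1 + psi, since m is even and T^m is the identity. *)
Lemma anti_alt psi : test psi -> anti (alt psi m.-1).
Proof.
move=> tpsi; split; first exact: test_alt.
have [k mk] : exists k, m = k.+1 by exists m.-1; rewrite prednK.
have Tk x : iter k.+1 T x = x by rewrite -mk Tm.
have ek : (-1) ^+ k.+1 = 1 :> R by rewrite -signr_odd -mk (negbTE me).
move=> x; rewrite mk -pred_Sn; have := altS psi k x.
have -> : alt psi k.+1 x = psi x + -1 * alt psi k (T x) by [].
rewrite Tk ek; move: (alt psi k (T x)) (alt psi k x) (psi x) => a b c; lra.
Qed.

(** As phi k is antisymmetric, u o T + u equals (u - phi k) o T + (u - phi k), and composition with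
    T preserves the L^2 norm. *)
Lemma anti_limit u (phi : nat -> rV -> R) : L2 u -> (forall k, anti (phi k)) ->
  (forall k, sqn (fun x => u x - phi k x) <= 1 / 4 ^+ k) ->
  aeq (fun x => u (T x)) (fun x => - u x).
Proof.
move=> Lu ap Nu.
have L2T v : L2 v -> L2 (fun x => v (T x)).
  move=> [mv iv]; split.
    by have := measurable_fun_mpres HT mO mv; rewrite (preimage_orth QQ).
  by have := integrable_mpres HT mO iv; rewrite (preimage_orth QQ).
have NT v : L2 v -> sqn (fun x => v (T x)) = sqn v.
  move=> Lv; apply: (Rint_orth QQ HT (f := fun x => v x ^+ 2)).
  by apply: int_measurable; exact: L2_int2.
pose w x := u (T x) + u x; have Lw : L2 w by apply: L2D => //; exact: L2T.
have Nw : sqn w = 0.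
  apply: (@abs_le0 _ _ 4) => e e0.
  have [k hk] := filter_ex (small_eventually (ler01 : 0 <= 1 :> R) e0).
  rewrite (ger0_norm (sqn_ge0 _)).
  have Lk : L2 (fun x => u x - phi k x) by apply: L2B => //; apply: test_L2; case: (ap k).
  have -> : w = fun x => (u (T x) - phi k (T x)) + (u x - phi k x).
    by apply/funext => x; rewrite /w (ap k).2; move: (u (T x)) (u x) (phi k x) => a b c; ring.
  apply: le_trans (sqn_triangle (L2T _ Lk) Lk) _.
  rewrite (NT _ Lk); have := Nu k.
  have : 1 / 4 ^+ k <= 1 / 2 ^+ k :> R.
    by rewrite ler_pM2l// lef_pV2 ?posrE ?exprn_gt0// lerXn2r ?nnegrE ?ler0n ?ler_nat.
  move: (sqn _) (1 / 4 ^+ k) (1 / 2 ^+ k) hk => a b c; lra.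
have i2 := L2_int2 Lw.
have : ae_eq mu Om (EFin \o (fun x => w x ^+ 2)) (cst 0%E).
  apply/(ae_eq_integral_abs mu mO) => //; first by apply/measurable_EFinP; exact: int_measurable.
  under eq_integral => x _ do rewrite /= ger0_norm ?sqr_ge0//.
  by rewrite -EFin_Rint// -/(sqn w) Nw.
apply: filterS => x /[swap] Ox /(_ Ox) [/eqP]; rewrite sqrf_eq0 /w addr_eq0.
by move/eqP.
Qed.

Hypothesis anti_ex : exists2 phi, anti phi & 0 < Fq q Kx phi.

(* Principle of symmetric criticality: the Euler-Lagrange functional changes sign under T, so it
   takes on psi the value (1/m) times that on [alt psi m.-1], which is 0. *)
Theorem symmetric_maximizer : exists u g (S : R),
  [/\ inH10 u g, 0 < S, Fq q Kx u = S, aeq (fun x => u (T x)) (fun x => - u x) &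
      forall psi, test psi -> Aq q Kx u psi = S * wbil g psi].
Proof.
have S0 := S_gt0 q2 b0 n0 mK HK anti_test anti_lin anti_ex.
have [u [g [phi [Wu Fu ap Np EL]]]] := maximizer q2 b0 n0 mK HK anti_test anti_lin anti_ex.
set S := supval _ _ _ in S0 Fu EL.
have [Lu Lg _] := Wu.
have uT := anti_limit Lu ap (fun k => (Np k).1).
have [c c0 Hc] := pow_small_H10 q2 b0 n0; have [Lqu _] := Hc u g Wu.
exists u, g, S; split => //.
have Aanti psi : test psi -> Aq q Kx u (fun x => psi (T x)) = - Aq q Kx u psi.
  move=> tpsi; have Lp := test_Lq q2 tpsi; have Lp' := test_Lq q2 (test_orth QQ tpsi).
  have I1 := Aq_int q2 mK HK Lqu Lp; have I2 := Aq_int q2 mK HK Lqu Lp'.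
  have mI := int_measurable I1.
  have -> : Aq q Kx u psi = \int[mu]_(x in Om)
      (Kx (T x) * (`|u (T x)| `^ (q - 2) * u (T x) * psi (T x))).
    by rewrite /Aq -(Rint_orth QQ HT mI).
  rewrite -[RHS]mulN1r -RintZ; last first.
    by have := integrable_mpres HT mO I1; rewrite (preimage_orth QQ).
  apply: aeq_Rint; first exact: int_measurable I2.
    apply: measurable_funM; first exact: measurable_cst.
    by have := measurable_fun_mpres HT mO mI; rewrite (preimage_orth QQ).
  apply: filterS uT => x /= H Ox; rewrite H// KT normrN.
  by rewrite mulN1r mulrN mulNr mulrN opprK.
(* Proved for the test functions phi k by [bil_orth] and carried to the limit, which avoids
   transforming the weak gradient g. *)
have Banti psi : test psi -> wbil g (fun x => psi (T x)) = - wbil g psi.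
  move=> tpsi; have tpsi' := test_orth QQ tpsi.
  have c1 := bil_cvg (fun k => (ap k).1) tpsi Lg (fun k => (Np k).2).
  have c2 := bil_cvg (fun k => (ap k).1) tpsi' Lg (fun k => (Np k).2).
  have E k : bil (phi k) (fun x => psi (T x)) = - bil (phi k) psi.
    have [tk ak] := ap k.
    rewrite -[in RHS](bil_orth QQ HT tk tpsi).
    have tk' := test_orth QQ tk.
    (* The coefficient -2 expresses phi k = - phi k o T in the form that [bil_lin] accepts. *)
    have := bil_lin (-2) tk' tk' tpsi'.
    have -> : (fun x => phi k (T x) + -2 * phi k (T x)) = phi k.
      by apply/funext => x; rewrite ak; move: (phi k x) => a; ring.
    by move=> ->; move: (bil _ _) => a; ring.
  apply: (cvg_unique _ c2) => //.
  have -> : (fun k => bil (phi k) (fun x => psi (T x))) = fun k => - bil (phi k) psi by apply/funext.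
  exact: (cvgN c1).
move=> psi tpsi.
have ta i := test_alt i tpsi; have ta' i := test_orth QQ (ta i).
(* The signs in [alt] cancel those of [Aanti] and [Banti], so each recursion step adds one copy of G
   psi. *)
pose G chi := Aq q Kx u chi - S * wbil g chi.
have GS i : G (alt psi i.+1) = G psi + G (alt psi i).
  rewrite /G /= (Aq_add q2 mK HK _ Lqu (test_Lq q2 tpsi) (test_Lq q2 (ta' i))).
  rewrite (wbil_lin _ Lg tpsi (ta' i)) (Aanti _ (ta i)) (Banti _ (ta i)).
  by move: (Aq _ _ _ _) (Aq _ _ _ _) (wbil _ _) (wbil _ _) => a b d e; ring.
have key (a : R) (f : nat -> R) : f 0%N = a -> (forall i, f i.+1 = a + f i) ->
    forall i, f i = i.+1%:R * a.
  by move=> f0 fS; elim=> [|i IH]; rewrite ?f0 ?mul1r// fS IH -[i.+2%:R]natr1 mulrDl mul1r addrC.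
have GE := key (G psi) (fun i => G (alt psi i)) erefl GS m.-1.
have G0 : G (alt psi m.-1) = 0 by rewrite /G (EL _ (anti_alt tpsi)) subrr.
move: GE; rewrite {}G0 => /esym/eqP; rewrite mulf_eq0 pnatr_eq0 /= => /eqP.
by move=> /subr0_eq.
Qed.

End Symmetric.

(** * From maximizers to solutions *)

Section Dirichlet.
Variables (R : realType) (n : nat) (p : R) (K : R -> R) (M : R).
Local Notation rV := 'rV[R]_n.
Local Notation mu := (lebesgue_rV R n).
Local Notation Om := (@unit_ball R n).
Local Notation test := (@test_function R n Om).
Let mO : measurable (Om : set rV) := @measurable_unit_ball R n.
Let fO : (mu Om < +oo)%E := @mu_unit_ball R n.
Local Notation q := (p + 1).
Local Notation Kx := (fun x : rV => K (enorm x)).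
Hypotheses (p1 : 1 < p) (b0 : 0 < n%:R + q - n%:R * q / 2) (n0 : (0 < n)%N).
Hypotheses (mK : measurable_fun Om Kx) (HK : forall x, Om x -> 0 <= Kx x <= M).
Implicit Types (phi psi u v w : rV -> R) (g h k : rV -> rV).
Local Notation co g i := (fun x => g x ord0 i).
Local Notation F := (Fq q Kx).
Local Notation A := (Aq q Kx).

Let q2 : 2 <= q. Proof. by have := p1 => p1'; lra. Qed.

Definition dot g h := \sum_(i < n) ip (co g i) (co h i).

Lemma nrm2D g h : (forall i, L2 (co g i)) -> (forall i, L2 (co h i)) ->
  nrm2 (fun x => g x + h x) = nrm2 g + 2 * dot g h + nrm2 h.
Proof.
move=> Lg Lh; rewrite /nrm2 /dot mulr_sumr -!big_split; apply: eq_bigr => i _ /=.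
by rewrite -(sqnD (Lg i) (Lh i)); congr sqn; apply/funext => x; rewrite mxE.
Qed.

Lemma energyE v g : inH10 v g -> energy Om K p v = 2^-1 * nrm2 g - q^-1 * F v.
Proof.
move=> Wv; have wv := inH10_weak Wv.
have [c c0 Hc] := pow_small_H10 q2 b0 n0; have [Lv _] := Hc v g Wv.
have I1 := Fq_int mK HK Lv.
have Lw i : L2 (co (wgrad Om v) i) by have [] := wgrad_weak wv i.
have I2 := enorm_int Lw.
rewrite -(nrm2_wgrad wv) (nrm2E Lw) /Fq -(RintZ _ I1) -(RintZ _ I2) -(RintB (intZ _ I2) (intZ _ I1)).
by apply: eq_Rintegral => x _; rewrite mulrA.
Qed.

Section WeakSolution.
Variables (w : rV -> R) (h : rV -> rV).
Hypotheses (Ww : inH10 w h) (EL : forall psi, test psi -> A w psi = wbil h psi).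

Let Lqw : Lq q w.
Proof. by have [c c0 Hc] := pow_small_H10 q2 b0 n0; have [] := Hc w h Ww. Qed.
Let Lh i : L2 (co h i). Proof. by case: Ww. Qed.

Lemma weak_equation_H10 : weak_equation Om K p w.
Proof.
move=> phi tphi; have Lphi := test_Lq q2 tphi.
have I1 := Aq_int q2 mK HK Lqw Lphi.
have ww := inH10_weak Ww.
have Lw i : L2 (co (wgrad Om w) i) by have [] := wgrad_weak ww i.
have I2 i := L2M (Lw i) (partial_L2 i tphi).
have -> : \int[mu]_(x in Om) (K (enorm x) * `|w x| `^ (p - 1) * w x * phi x -
    \sum_(i < n) wgrad Om w x ord0 i * partial i phi x) =
    A w phi - \sum_(i < n) ip (co (wgrad Om w) i) (partial i phi).
  rewrite /Aq /ip -(Rint_sum _ I2) -(RintB I1 (int_sum _ I2)).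
  apply: eq_Rintegral => x _; congr (_ - _).
  have -> : p + 1 - 2 = p - 1 by ring.
  by rewrite !mulrA.
rewrite (EL tphi) /wbil; apply/eqP; rewrite subr_eq0; apply/eqP/eq_bigr => i _.
apply: aeq_Rint.
- exact: int_measurable (L2M (Lh i) (partial_L2 i tphi)).
- exact: int_measurable (I2 i).
- by apply: filterS (wgrad_aeq ww i) => x H Ox; rewrite H.
Qed.

(** Extends the equation from test functions to H^1_0 by density: the left side is continuous by the
    first bound of [frechet], the right side by Cauchy-Schwarz. *)
Lemma euler_lagrange_H10 v k : inH10 v k -> A w v = dot h k.
Proof.
move=> Wv; have [Lv Lk Hv] := Wv.
have [c c0 Hc] := pow_small_H10 q2 b0 n0.
have [C C0 HC] := frechet q2 mK HK Lqw.
pose B := \sum_(i < n) Num.sqrt (sqn (co h i)).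
have B0 : 0 <= B by apply: sumr_ge0 => i _; exact: sqrtr_ge0.
pose a := c * Num.sqrt n%:R; have a0 : 0 <= a by rewrite mulr_ge0// sqrtr_ge0.
suff : A w v - dot h k = 0 by move/subr0_eq.
apply: (@abs_le0 _ _ (C * a + B)) => e e0.
(* The second bound keeps a d <= 1, as [frechet] requires. *)
pose d := Num.min e (a + 1)^-1.
have a1 : 0 < a + 1 by rewrite ltr_wpDl.
have d0 : 0 < d by rewrite lt_min e0 invr_gt0.
have de : d <= e by rewrite ge_min lexx.
have ad : a * d <= 1.
  apply: (@le_trans _ _ ((a + 1) * d)); first by rewrite ler_wpM2r ?lerDl// ltW.
  by rewrite mulrC -ler_pdivlMr// div1r ge_min lexx orbT.
have [phi tphi [Np Npi]] := Hv (d ^+ 2) (exprn_gt0 _ d0).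
have Wp := inH10_lin (-1) Wv (inH10_test tphi).
set z := (fun x => v x + -1 * phi x) in Wp; set kz := (fun x => k x + -1 *: grad phi x) in Wp.
have [Lz zs] := Hc _ _ Wp.
have Lkz i : L2 (co kz i) by case: Wp.
have kzE i : co kz i = fun x => k x ord0 i - partial i phi x.
  by apply/funext => x; rewrite /kz !mxE mulN1r.
have Nk i : Num.sqrt (sqn (co kz i)) <= d.
  rewrite -[leRHS]ger0_norm ?(ltW d0)// -sqrtr_sqr ler_wsqrtr// kzE; exact: Npi.
have nk : c * Num.sqrt (nrm2 kz) <= a * d.
  rewrite /a -mulrA ler_wpM2l//.
  have -> : Num.sqrt n%:R * d = Num.sqrt (n%:R * d ^+ 2).
    by rewrite sqrtrM// sqrtr_sqr gtr0_norm.
  rewrite ler_wsqrtr//; apply: (@le_trans _ _ (\sum_(i < n) d ^+ 2)).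
    by apply: ler_sum => i _; rewrite kzE; exact: Npi.
  by rewrite sumr_const card_ord mulr_natl.
have cs0 : 0 <= c * Num.sqrt (nrm2 kz) by rewrite mulr_ge0// sqrtr_ge0.
have [|h1 _] := HC z _ Lz _ zs; first by rewrite cs0 (le_trans nk).
have h2 : `|dot h kz| <= B * d.
  rewrite /B mulr_suml; apply: le_trans (ler_norm_sum _ _ _) _; apply: ler_sum => i _.
  apply: le_trans (ip_le (Lh i) (Lkz i)) _.
  by rewrite ler_wpM2l// sqrtr_ge0.
have Lqv : Lq q v by have [] := Hc _ _ Wv.
have e1 : A w z = A w v - A w phi.
  by rewrite /z (Aq_add q2 mK HK _ Lqw Lqv (test_Lq q2 tphi)) mulN1r.
have e2 : dot h kz = dot h k - wbil h phi.
  rewrite /dot /wbil -sumrB; apply: eq_bigr => i _; rewrite kzE ipC.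
  by rewrite (ip_B (Lk i) (partial_L2 i tphi) (Lh i)) ipC (ipC (partial i phi)).
have -> : A w v - dot h k = A w z - dot h kz.
  by rewrite e1 e2 (EL tphi); move: (A w v) (dot h k) (wbil h phi) => x y t; ring.
apply: le_trans (ler_normB _ _) _; rewrite mulrDl.
apply: lerD; last by apply: le_trans h2 _; rewrite ler_wpM2l.
apply: le_trans h1 _; rewrite -mulrA ler_wpM2l//; apply: le_trans nk _.
by rewrite ler_wpM2l.
Qed.

(** The first-order terms cancel by [euler_lagrange_H10]; the rest is bounded by D times the squared
    H^1 norm of v. *)
Lemma critical_point_H10 : critical_point Om (energy Om K p) w.
Proof.
move=> e e0.
have [c c0 Hc] := pow_small_H10 q2 b0 n0.
have [C C0 HC] := frechet q2 mK HK Lqw.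
pose D := 2^-1 + C * c ^+ 2.
have D0 : 0 <= D by rewrite addr_ge0// mulr_ge0// sqr_ge0.
have D1 : 0 < D + 1 by rewrite ltr_wpDl.
have c1 : 0 < c + 1 by rewrite ltr_wpDl.
(* The first bound gives D H <= e, the second c H <= 1 for [frechet]. *)
exists (Num.min (e / (D + 1)) (c + 1)^-1); first by rewrite lt_min divr_gt0// invr_gt0.
move=> v Hv; rewrite lt_min => /andP[hd1 hd2].
have Wv := H10_inH10 Hv; set k := wgrad Om v in Wv.
have [Lv Lk _] := Wv.
have vH : H1_norm Om v = Num.sqrt (sqn v + nrm2 k) by apply: H1_normE => //; exact: inH10_weak.
pose H := H1_norm Om v; have H0 : 0 <= H by exact: sqrtr_ge0.
have kH : Num.sqrt (nrm2 k) <= H by rewrite /H vH ler_wsqrtr// lerDr sqn_ge0.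
have DH : D * H <= e.
  apply: (@le_trans _ _ ((D + 1) * H)); first by rewrite ler_wpM2r ?lerDl.
  by rewrite mulrC -ler_pdivlMr// ltW.
have cH : c * H <= 1.
  apply: (@le_trans _ _ ((c + 1) * H)); first by rewrite ler_wpM2r ?lerDl.
  by rewrite mulrC -ler_pdivlMr// div1r ltW.
have [Lqv vs] := Hc v k Wv.
set s := c * _ in vs; have s0 : 0 <= s by rewrite mulr_ge0// sqrtr_ge0.
have sH : s <= c * H by rewrite ler_wpM2l.
have [|_ h2] := HC v s Lqv _ vs; first by rewrite s0 (le_trans sH).
have Wwv : inH10 (fun x => w x + v x) (fun x => h x + k x).
  have := inH10_lin 1 Ww Wv; congr inH10; apply/funext => x; rewrite ?scale1r ?mul1r//.
rewrite (energyE Wwv) (energyE Ww) (nrm2D Lh Lk) -(euler_lagrange_H10 Wv) -/H.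
have nk : nrm2 k <= H ^+ 2.
  by rewrite -[nrm2 k]sqr_sqrtr ?nrm2_ge0// lerXn2r ?nnegrE ?sqrtr_ge0.
have ss : C * s ^+ 2 <= C * c ^+ 2 * H ^+ 2.
  by rewrite -mulrA -exprMn ler_wpM2l// lerXn2r// nnegrE// mulr_ge0.
have q0 : 0 < q by apply: lt_le_trans q2.
have -> : 2^-1 * (nrm2 h + 2 * A w v + nrm2 k) - q^-1 * F (fun x => w x + v x) -
    (2^-1 * nrm2 h - q^-1 * F w) =
    2^-1 * nrm2 k - q^-1 * (F (fun x => w x + v x) - F w - q * A w v).
  move: (nrm2 h) (nrm2 k) (A w v) (F _) (F _) => x y z t r; move: q0 => /gt_eqF/negbT q0'.
  by field.
apply: le_trans (ler_normB _ _) _.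
rewrite !normrM (ger0_norm (nrm2_ge0 k)) [`|2^-1|]ger0_norm// [`|q^-1|]gtr0_norm ?invr_gt0//.
apply: (@le_trans _ _ (D * H * H)); last by rewrite ler_wpM2r.
have -> : D * H * H = 2^-1 * H ^+ 2 + C * c ^+ 2 * H ^+ 2 by rewrite /D; ring.
apply: lerD; first by rewrite ler_wpM2l.
apply: le_trans (le_trans h2 ss); rewrite ler_piMl// invf_le1//.
by apply: le_trans q2; rewrite ler1n.
Qed.

Lemma dirichlet_solution_H10 : dirichlet_solution Om K p w.
Proof. by split; [exact: inH10_H10 Ww|exact: weak_equation_H10|exact: critical_point_H10]. Qed.

End WeakSolution.

(** Under u -> l u the two sides scale with degrees p and 1, so l^(p - 1) S = 1 absorbs the
    multiplier. *)
Lemma dirichlet_scaling u g S : inH10 u g -> 0 < S ->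
  (forall psi, test psi -> A u psi = S * wbil g psi) ->
  exists2 l : R, l != 0 & dirichlet_solution Om K p (fun x => l * u x).
Proof.
move=> Wu S0 EL; pose l := S `^ (- (p - 1)^-1).
have l0 : 0 < l by exact: powR_gt0.
have lS : l `^ (p - 1) * S = 1.
  have pn : p - 1 != 0 by rewrite subr_eq0 gt_eqF.
  by rewrite /l -powRrM mulNr mulVf// powR_inv1 ?(ltW S0)// mulVf// gt_eqF.
exists l; first by rewrite gt_eqF.
have [Lu Lg _] := Wu.
have Wl : inH10 (fun x => l * u x) (fun x => l *: g x).
  have := inH10_lin (l - 1) Wu Wu; congr inH10; apply/funext => x.
    by move: (u x) => a; ring.
  by rewrite -[X in X + _]scale1r -scalerDl addrC subrK.
apply: (@dirichlet_solution_H10 _ (fun x => l *: g x)) => // psi tpsi.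
have -> : A (fun x => l * u x) psi = l * l `^ (p - 1) * A u psi.
  have [c c0 Hc] := pow_small_H10 q2 b0 n0; have [Lqu _] := Hc _ _ Wu.
  rewrite /Aq -RintZ; last exact: (Aq_int q2 mK HK Lqu (test_Lq q2 tpsi)).
  apply: eq_Rintegral => x _.
  have -> : p + 1 - 2 = p - 1 by ring.
  rewrite normrM (gtr0_norm l0) powRM ?(ltW l0)//.
  by move: (u x) (psi x) (K _) (l `^ _) (`|u x| `^ _) => a b d e f; ring.
rewrite (EL _ tpsi) -mulrA (mulrA (l `^ _)) lS mul1r /wbil mulr_sumr.
apply: eq_bigr => i _; rewrite -(ip_Z _ (Lg i) (partial_L2 i tpsi)).
by congr ip; apply/funext => x; rewrite mxE.
Qed.

End Dirichlet.

(** * The sequence of rotations *)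

Section Rotation.
Variables (R : realType) (n : nat).
Local Notation rV := 'rV[R]_n.+2.
Implicit Types (c s t : R) (x y : rV).
Local Notation i1 := (lift ord0 ord0 : 'I_n.+2).

Let l10 : (i1 == ord0) = false. Proof. by []. Qed.

Lemma rot0E c s x : rot01 c s x ord0 ord0 = c * x ord0 ord0 - s * x ord0 i1.
Proof. by rewrite mxE eqxx. Qed.

Lemma rot1E c s x : rot01 c s x ord0 i1 = s * x ord0 ord0 + c * x ord0 i1.
Proof. by rewrite mxE l10 eqxx. Qed.

Lemma rotSE c s x (i : 'I_n) :
  rot01 c s x ord0 (lift ord0 (lift ord0 i)) = x ord0 (lift ord0 (lift ord0 i)).
Proof. by rewrite mxE. Qed.

Lemma row2P x y : x ord0 ord0 = y ord0 ord0 -> x ord0 i1 = y ord0 i1 ->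
  (forall i : 'I_n, x ord0 (lift ord0 (lift ord0 i)) = y ord0 (lift ord0 (lift ord0 i))) -> x = y.
Proof.
move=> h0 h1 h2; apply/rowP => i.
by case: (unliftP ord0 i) => [j ->|->//]; case: (unliftP ord0 j) => [k ->|->].
Qed.

Lemma rot_dot c s x y : c ^+ 2 + s ^+ 2 = 1 ->
  \sum_i rot01 c s x ord0 i * rot01 c s y ord0 i = \sum_i x ord0 i * y ord0 i.
Proof.
move=> cs; rewrite !big_ord_recl rot0E rot1E rot0E rot1E !addrA; congr (_ + _); last first.
  by apply: eq_bigr => i _; rewrite !rotSE.
move: (x ord0 ord0) (y ord0 ord0) (x ord0 i1) (y ord0 i1) => a b d e.
by transitivity ((c ^+ 2 + s ^+ 2) * (a * b + d * e)); [ring|rewrite cs mul1r].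
Qed.

Definition rotmx c s : 'M[R]_n.+2 := \matrix_i rot01 c s (delta_mx ord0 i).

Lemma mul_rotmx c s x : x *m rotmx c s = rot01 c s x.
Proof.
rewrite mulmx_sum_row {2}(row_sum_delta x).
have rD (a b : rV) : rot01 c s (a + b) = rot01 c s a + rot01 c s b.
  by apply: row2P => [||i]; rewrite !(rot0E, rot1E, rotSE, mxE); ring.
have r0 : rot01 c s (0 : rV) = 0 by apply: row2P => [||i]; rewrite !(rot0E, rot1E, rotSE, mxE); ring.
rewrite (big_morph _ rD r0); apply: eq_bigr => i _; rewrite rowK.
by apply: row2P => [||j]; rewrite ?(rot0E, rot1E, rotSE); rewrite !mxE ?eqxx/=; ring.
Qed.

Lemma rotmx_orth c s : c ^+ 2 + s ^+ 2 = 1 -> rotmx c s *m (rotmx c s)^T = 1%:M.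
Proof.
move=> cs; apply/matrixP => i j; rewrite !mxE.
transitivity (\sum_k rot01 c s (delta_mx ord0 i) ord0 k * rot01 c s (delta_mx ord0 j) ord0 k).
  by apply: eq_bigr => k _; rewrite !mxE.
rewrite rot_dot// (bigD1 i)//= big1 => [|k ki]; rewrite !mxE ?eqxx/=.
  by rewrite mul1r addr0.
by rewrite (negbTE ki) mul0r.
Qed.

Definition turn t : rV -> rV := rot01 (cos t) (sin t).

Lemma turnD t t' x : turn t (turn t' x) = turn (t + t') x.
Proof.
by apply: row2P => [||i]; rewrite /turn !(rot0E, rot1E, rotSE)// cosD sinD; ring.
Qed.

Lemma turn0 x : turn 0 x = x.
Proof. by apply: row2P => [||i]; rewrite /turn !(rot0E, rot1E, rotSE)// cos0 sin0; ring. Qed.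

Lemma iter_turn t k x : iter k (turn t) x = turn (k%:R * t) x.
Proof.
elim: k => [|k IH]; first by rewrite mul0r turn0.
by rewrite iterS IH turnD -[k.+1%:R]natr1 mulrDl mul1r addrC.
Qed.

Lemma turn2pi x : turn (2 * pi) x = x.
Proof.
rewrite mulr_natl /turn cos2pi sin2pi.
by apply: row2P => [||i]; rewrite !(rot0E, rot1E, rotSE)//; ring.
Qed.

(* Real and imaginary part of [(x_0 + i x_1) ^ (2 ^ k)]. *)
Fixpoint pow2 k x : R * R :=
  if k is j.+1 then let: (a, b) := pow2 j x in (a ^+ 2 - b ^+ 2, 2 * a * b)
  else (x ord0 ord0, x ord0 i1).

Lemma pow2S k x : pow2 k.+1 x = ((pow2 k x).1 ^+ 2 - (pow2 k x).2 ^+ 2, 2 * (pow2 k x).1 * (pow2 k x).2).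
Proof. by rewrite /=; case: (pow2 k x). Qed.

(** A rotation by t multiplies x_0 + i x_1 by exp (i t), hence its power 2^k by exp (i 2^k t). *)
Lemma pow2_turn k t x : pow2 k (turn t x) =
  (cos (2 ^+ k * t) * (pow2 k x).1 - sin (2 ^+ k * t) * (pow2 k x).2,
   sin (2 ^+ k * t) * (pow2 k x).1 + cos (2 ^+ k * t) * (pow2 k x).2).
Proof.
elim: k => [|k IH]; first by rewrite /= expr0 mul1r /turn rot0E rot1E.
rewrite !pow2S IH.
have -> : 2 ^+ k.+1 * t = 2 ^+ k * t + 2 ^+ k * t by rewrite exprS; ring.
rewrite cosD sinD.
by move: (cos _) (sin _) (pow2 k x) => c s [a b] /=; congr pair; ring.
Qed.

Lemma pow2_sm k : sm (fun x => (pow2 k x).1) /\ sm (fun x => (pow2 k x).2).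
Proof.
elim: k => [|k [IH1 IH2]]; first by split; exact: sm_coord.
split.
- have -> : (fun x => (pow2 k.+1 x).1) = (fun x => (pow2 k x).1) * (fun x => (pow2 k x).1) +
    cst (-1) * ((fun x => (pow2 k x).2) * (fun x => (pow2 k x).2)).
    by apply/funext => x; rewrite pow2S !fctE /=; move: (pow2 k x) => [a b] /=; ring.
  by apply: sm_add; [exact: sm_mul|apply: sm_mul; [exact: sm_cst|exact: sm_mul]].
- have -> : (fun x => (pow2 k.+1 x).2) = cst 2 * ((fun x => (pow2 k x).1) * (fun x => (pow2 k x).2)).
    by apply/funext => x; rewrite pow2S !fctE /=; move: (pow2 k x) => [a b] /=; ring.
  by apply: sm_mul; [exact: sm_cst|exact: sm_mul].
Qed.

Lemma pow2_delta k (r : R) : pow2 k (r *: delta_mx ord0 ord0) = (r ^+ (2 ^ k), 0).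
Proof.
elim: k => [|k IH]; first by rewrite /= !mxE eqxx /= mulr1 mulr0.
by rewrite pow2S IH /= mulr0 expr0n subr0 -exprM -expnSr.
Qed.

End Rotation.

(** * Continuity, measurability and bounds of the weight *)

Section Weight.
Variables (R : realType) (K : R -> R).

(** K y - K x is the difference quotient times y - x, which tends to l times 0 along the punctured
    neighbourhood; at y = x there is nothing to prove. *)
Lemma derivable_within_continuous (A : set R) :
  {in A, forall x, derivable_within A K x} -> {within A, continuous K}.
Proof.
move=> dK; apply/subspace_continuousP => x Ax.
have /cvg_ex[l Kl] := dK x (mem_set Ax).
apply/cvgrPdist_le => e e0.
have c1 : (fun y => (K y - K x) / (y - x) * (y - x)) y @[y --> within A x^'] --> l * (x - x).
  apply: cvgM => //; apply: cvgB; last exact: cvg_cst.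
  have : y @[y --> within A x^'] `=>` nbhs x.
    by apply: cvg_trans (cvg_within _) _; exact: nbhs_dnbhs.
  by [].
rewrite subrr mulr0 in c1; move/cvgrPdist_le : c1 => /(_ e e0) h.
suff : nbhs x (fun y => A y -> `|K x - K y| <= e) by [].
have h' : nbhs x (fun y => y != x -> A y -> `|0 - (K y - K x) / (y - x) * (y - x)| <= e) by exact: h.
apply: filterS h' => y hy Ay; have [->|yx] := eqVneq y x; first by rewrite subrr normr0 ltW.
by have := hy yx Ay; rewrite sub0r normrN divfK ?subr_eq0// distrC.
Qed.

Variable n : nat.
Local Notation Om := (@unit_ball R n).

Lemma weight_measurable : {within `[0, 1], continuous K} ->
  measurable_fun Om (fun x => K (enorm x)).
Proof.
move=> cK; apply: (@measurable_comp _ _ _ _ (measurableTypeR R) _ `[0, 1]%classic K Om (@enorm R n)).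
- exact: measurable_itv.
- by move=> _ [x x1 <-]; rewrite /= in_itv/= enorm_ge0 ltW.
- by apply: subspace_continuous_measurable_fun => //; exact: measurable_itv.
- by apply: measurable_funTS; exact: measurable_enorm.
Qed.

Lemma weight_bounded : {within `[0, 1], continuous K} ->
  (forall r, 0 <= r <= 1 -> 0 < K r) ->
  exists M, forall x, Om x -> 0 <= K (enorm x) <= M.
Proof.
move=> cK K0; have [c _ Hc] := EVT_max ler01 cK.
exists (K c) => x Ox; have x01 : 0 <= enorm x <= 1 by rewrite enorm_ge0 ltW.
by rewrite ltW ?K0//= Hc// in_itv.
Qed.

End Weight.

(** * Antisymmetry and vanishing almost everywhere *)

Section AlmostEverywhere.
Variables (R : realType) (n : nat) (Q : 'M[R]_n).
Local Notation rV := 'rV[R]_n.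
Local Notation mu := (lebesgue_rV R n).
Local Notation Om := (@unit_ball R n).
Local Notation T := (fun x : rV => x *m Q).
Hypotheses (QQ : Q *m Q^T = 1%:M) (HT : mpres T).
Implicit Types (u v w : rV -> R).

Lemma aeq_orth u v : aeq u v -> aeq (fun x => u (T x)) (fun x => v (T x)).
Proof.
move=> [A [mA A0 H]]; exists (T @^-1` A); split; first exact: mpres_preimage.
  by have [_ ->] := HT.
move=> x /= nx; apply: H => /= h; apply: nx => Ox; apply: h.
by rewrite -[Om _]/((T @^-1` Om) x) preimage_orth.
Qed.

Lemma aeq_iter w k : aeq (fun x => w (T x)) (fun x => - w x) ->
  aeq (fun x => w (iter k T x)) (fun x => (-1) ^+ k * w x).
Proof.
move=> wT; elim: k => [|k IH]; first by apply: aeW => x _; rewrite mul1r.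
have IH' := aeq_orth IH; apply: filterS2 IH' wT => x h1 h2 Ox.
by rewrite iterSr h1// h2// exprS mulN1r mulrN mulNr.
Qed.

Lemma aeq_opp0 w : aeq w (fun x => - w x) -> aeq w (fun=> 0).
Proof.
apply: filterS => x H /H /eqP; rewrite -subr_eq0 opprK -mulr2n mulrn_eq0/=.
by move/eqP.
Qed.

Lemma anti_nonradial w : aeq (fun x => w (T x)) (fun x => - w x) -> radial Om w -> aeq w (fun=> 0).
Proof.
move=> wT [f wf]; apply: aeq_opp0; apply: aeq_trans wT.
have h : aeq w (f \o @enorm R n) by exact: wf.
apply: (aeq_trans h); apply: aeq_sym; apply: (aeq_trans (aeq_orth h)).
by apply: aeW => x _; rewrite /= (enorm_orth QQ).
Qed.

(** By the Lipschitz bound phi stays positive on a cube with corner a, which has positive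
    measure. *)
Lemma test_not_aeq0 phi (a : rV) : test_function Om phi -> 0 < phi a -> ~ aeq phi (fun=> 0).
Proof.
move=> tphi pa [A [mA A0 H]]; have [L L0 HL] := smooth_lip tphi.
have L1 : 0 < L + 1 by rewrite ltr_wpDl.
pose d := phi a / (L + 1); have d0 : 0 < d by rewrite divr_gt0.
have Ld : L * d < phi a.
  by rewrite /d mulrA ltr_pdivrMr// mulrDr mulr1 mulrC ltrDl.
have sub : cube a d `<=` A.
  move=> x xa; apply: H => /= h.
  have px : 0 < phi x.
    have := HL a (x - a) d (ltW d0) _; rewrite [a + _]addrC subrK => hL.
    have {hL}hL : `|phi x - phi a| <= L * d.
      apply: hL => i; have := xa i; rewrite /= !mxE in_itv/= => /andP[x1 x2].
      by rewrite ger0_norm ?subr_ge0// lerBlDl ltW.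
    by move: hL => /ler_normlP[hL _]; lra.
  have Ox : Om x by apply: contrapT => nO; move: px; rewrite (test_out tphi nO) ltxx.
  by move: px; rewrite (h Ox) ltxx.
have : (mu (cube a d) <= mu A)%E.
  apply: (@le_measure _ _ _ mu (cube a d) A) => //; [apply/mem_set; exact: measurable_cube|exact/mem_set].
rewrite A0 mu_cube ?(ltW d0)// lee_fin => h.
by have := exprn_gt0 n d0; rewrite ltNge h.
Qed.

Lemma Fq_eq0 q (K : R -> R) (M : R) u : 2 <= q -> (forall r, 0 <= r <= 1 -> 0 < K r) ->
  measurable_fun Om (fun x => K (enorm x)) -> (forall x, Om x -> 0 <= K (enorm x) <= M) ->
  Lq q u -> Fq q (fun x => K (enorm x)) u = 0 <-> aeq u (fun=> 0).
Proof.
move=> q2 K0 mK HK Lu; have q0 : 0 < q by lra.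
have mO := measurable_unit_ball (R := R) (n := n).
have I := Fq_int mK HK Lu; have mI := int_measurable I.
split => H.
  have : ae_eq mu Om (EFin \o (fun x => K (enorm x) * `|u x| `^ q)) (cst 0%E).
    apply/(ae_eq_integral_abs mu mO) => //; first by apply/measurable_EFinP.
    rewrite (eq_integral (fun x => (K (enorm x) * `|u x| `^ q)%:E)).
      by rewrite -EFin_Rint// -/(Fq _ _ _) H.
    move=> x /set_mem Ox; rewrite /= ger0_norm// mulr_ge0 ?powR_ge0//.
    by have /andP[] := HK x Ox.
  apply: filterS => x /[swap] Ox /(_ Ox) [/eqP]; rewrite mulf_eq0 gt_eqF/=; last first.
    by apply: K0; rewrite enorm_ge0 ltW.
  by rewrite powR_eq0 normr_eq0 => /andP[/eqP].
have h : aeq (fun x => K (enorm x) * `|u x| `^ q) (fun=> 0).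
  by apply: filterS H => x h Ox; rewrite h// normr0 powR0 ?mulr0// gt_eqF.
rewrite /Fq (aeq_Rint mI (measurable_cst _) h) Rintegral_cst ?mul0r//.
Qed.

End AlmostEverywhere.

(** * One solution for each angle *)

Section Solutions.
Variables (R : realType) (n : nat).
Local Notation rV := 'rV[R]_n.+2.
Local Notation mu := (lebesgue_rV R n.+2).
Local Notation Om := (@unit_ball R n.+2).
Local Notation test := (@test_function R n.+2 Om).

(** 2^(k + 1) times the angle is pi, which gives a sign change and the period 2^(k + 2); being at
    most pi / 2, the angle falls under [mpres_rot01]. *)
Definition angle k : R := pi / 2 ^+ k.+1.
Definition turnmx k : 'M[R]_n.+2 := rotmx n (cos (angle k)) (sin (angle k)).

Lemma turnmxE k (x : rV) : x *m turnmx k = turn (angle k) x.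
Proof. exact: mul_rotmx. Qed.

Lemma iter_turnmx k l j (x : rV) : j%:R * angle k = l ->
  iter j (fun y : rV => y *m turnmx k) x = turn l x.
Proof.
by move=> <-; rewrite -iter_turn; apply: eq_iter => y; exact: turnmxE.
Qed.

Lemma turnmx_orth k : turnmx k *m (turnmx k)^T = 1%:M.
Proof. by apply: rotmx_orth; exact: cos2Dsin2. Qed.

Lemma turnmx_mpres k : mpres (fun x : rV => x *m turnmx k).
Proof.
have -> : (fun x : rV => x *m turnmx k) = rot01 (cos (angle k)) (sin (angle k)).
  by apply/funext => x; exact: mul_rotmx.
apply: mpres_rot01; first exact: cos2Dsin2.
suff : 0 <= cos (angle k) by apply: contraTneq => ->; rewrite -ltNge; lra.
have p0 := pi_gt0 R; have a0 : 0 < angle k by rewrite divr_gt0// exprn_gt0.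
apply: cos_ge0_pihalf; apply/andP; split; first by lra.
rewrite /angle ler_pM2l// lef_pV2 ?posrE ?exprn_gt0//.
by rewrite exprS ler_peMr// exprn_ege1// ler1n.
Qed.

Lemma turnmx_period k (x : rV) : iter (2 ^ k.+2)%N (fun y : rV => y *m turnmx k) x = x.
Proof.
rewrite (@iter_turnmx _ (2 * pi)) ?turn2pi// /angle natrX exprS.
by field; rewrite expf_neq0.
Qed.

Lemma turnmx_iter k l (x : rV) : (k <= l)%N ->
  iter (2 ^ (l - k))%N (fun y : rV => y *m turnmx l) x = x *m turnmx k.
Proof.
move=> kl; rewrite (@iter_turnmx _ (angle k)) ?turnmxE// /angle natrX.
have -> : l.+1 = ((l - k) + k.+1)%N by rewrite addnS subnK.
by rewrite exprD invfM mulrCA mulVKf// expf_neq0.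
Qed.

(** The real part of (x_0 + i x_1)^(2^(k + 1)) with a radial cutoff: it shows that the antisymmetric
    class is not trivial. *)
Definition anti_bump k (x : rV) : R := (pow2 k.+1 x).1 * bump 2^-1 x.

Lemma anti_bumpP k : anti (turnmx k) (anti_bump k).
Proof.
split.
  apply: testM; first by apply: smP; exact: (pow2_sm _ _ _).1.
  by apply: test_bump; lra.
move=> x; have bT : bump 2^-1 (x *m turnmx k) = bump 2^-1 x.
  by rewrite /bump (enorm_orth (turnmx_orth k)).
rewrite /anti_bump bT turnmxE pow2_turn /=.
have -> : 2 ^+ k.+1 * angle k = pi :> R by rewrite /angle mulrC divfK// expf_neq0.
by rewrite cospi sinpi mulN1r mul0r subr0 mulNr.
Qed.

Lemma anti_bump_gt0 k : exists x, 0 < anti_bump k x.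
Proof.
(* On the first axis the power is a positive real, and 1 / 4 lies inside the cutoff radius 1 / 2. *)
exists (4^-1 *: delta_mx ord0 ord0); rewrite /anti_bump pow2_delta.
apply: mulr_gt0; first by rewrite /= exprn_gt0.
apply: bump_gt0 => //; rewrite /enorm (bigD1 ord0)//= big1 => [|i i0].
  by rewrite !mxE eqxx/= addr0 mulr1 sqrtr_sqr ger0_norm//; lra.
by rewrite !mxE (negbTE i0) andbF mulr0 expr0n.
Qed.

Variables (p : R) (K : R -> R).
Hypotheses (hp : 1 < p < (n.+2%:R + 2) / (n.+2%:R - 2)) (n3 : (0 < n)%N).
Hypotheses (cK : {within `[0, 1], continuous K}) (K0 : forall r, 0 <= r <= 1 -> 0 < K r).

Lemma anti_solution k : exists w, [/\ dirichlet_solution Om K p w,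
  aeq (fun x => w (x *m turnmx k)) (fun x => - w x) & ~ aeq w (fun=> 0)].
Proof.
have /andP[p1 p2] := hp.
have mK := weight_measurable (n := n.+2) cK.
have [M HK] := weight_bounded n.+2 cK K0.
have q2 : 2 <= p + 1 by lra.
(* The bound on p in the form p + 1 < 2 N / (N - 2), with denominators cleared. *)
have b0 : 0 < n.+2%:R + (p + 1) - n.+2%:R * (p + 1) / 2.
  move: p2; rewrite ltr_pdivlMr; last by rewrite subr_gt0 ltr_nat.
  by move: (n.+2%:R : R) => N; lra.
have QQ := turnmx_orth k; have HT := turnmx_mpres k.
have KT x : K (enorm (x *m turnmx k)) = K (enorm x) by rewrite (enorm_orth QQ).
have ex : exists2 phi, anti (turnmx k) phi & 0 < Fq (p + 1) (fun x => K (enorm x)) phi.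
  exists (anti_bump k); first exact: anti_bumpP.
  have tb := (anti_bumpP k).1.
  rewrite lt_neqAle (Fq_ge0 _ HK) andbT; apply/eqP => /esym.
  move/(Fq_eq0 q2 K0 mK HK (test_Lq q2 tb)).
  by have [x px] := anti_bump_gt0 k; exact: test_not_aeq0 tb px.
have m0 : (0 < 2 ^ k.+2)%N by rewrite expn_gt0.
have me : ~~ odd (2 ^ k.+2) by rewrite oddX.
have [u [g [S [Wu S0 FS uT EL]]]] := symmetric_maximizer QQ HT m0 me (turnmx_period k) q2 b0 isT mK HK KT ex.
have [l l0 Dl] := dirichlet_scaling p1 b0 isT mK HK Wu S0 EL.
exists (fun x => l * u x); split => //.
  by apply: filterS uT => x H Ox; rewrite H// mulrN.
(* If the solution vanished, so would u, against F u = S > 0. *)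
move=> lu; have [c _ Hc] := pow_small_H10 q2 b0 (isT : (0 < n.+2)%N).
have [Lu _] := Hc _ _ Wu.
have : aeq u (fun=> 0).
  by apply: filterS lu => x H Ox; apply/eqP; have /eqP := H Ox; rewrite mulf_eq0 (negbTE l0).
by move/(Fq_eq0 q2 K0 mK HK Lu); rewrite FS => S00; move: S0; rewrite S00 ltxx.
Qed.

(* [turnmx k] is an even power of [turnmx l], hence leaves z invariant. *)
Lemma anti_distinct k l w z : (k < l)%N ->
  aeq (fun x => w (x *m turnmx k)) (fun x => - w x) ->
  aeq (fun x => z (x *m turnmx l)) (fun x => - z x) -> aeq w z -> aeq w (fun=> 0).
Proof.
move=> kl wT zT wz; apply: aeq_opp0; apply: aeq_trans wT.
apply: (aeq_trans wz); apply: aeq_sym.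
apply: (aeq_trans (aeq_orth (turnmx_orth k) (turnmx_mpres k) wz)).
have := aeq_iter (turnmx_orth l) (turnmx_mpres l) (2 ^ (l - k)) zT.
apply: filterS => x H Ox; rewrite -(turnmx_iter x (ltnW kl)) H//.
by rewrite -signr_odd oddX subn_eq0 leqNgt kl /= mul1r.
Qed.

End Solutions.

Theorem theorem1p3 (R : realType) (N : nat) (p : R) (K : R -> R)
  (hN : (3 <= N)%N)
  (hp : 1 < p < (N%:R + 2) / (N%:R - 2))
  (hK : C2_on `[0, 1] K)
  (hK0 : forall r : R, 0 <= r <= 1 -> 0 < K r) :
  let V := fun r : R => r * derive_within `[0, 1] K r / K r in
  (forall r : R, 0 <= r <= 1 ->
    (V r - p * (N%:R - 2) - N%:R + 4) * (V r - p * (N%:R - 2) + N%:R)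
      - 2 * r * derive_within `[0, 1] V r < 0) ->
  exists u : nat -> 'rV[R]_N -> R,
    (forall k, dirichlet_solution (@unit_ball R N) K p (u k) /\
               ~ radial (@unit_ball R N) (u k)) /\
    (forall k l, k <> l ->
       ~ u k = u l %[ae lebesgue_rV R N in @unit_ball R N]).
Proof.
move=> V _; case: N hN hp V => [//|[//|n]] n3 hp _.
have [dK _ _] := hK; have cK := derivable_within_continuous dK.
have [u Hu] := choice (anti_solution hp n3 cK hK0).
exists u; split => [k|k l].
  have [Du uT un0] := Hu k; split => // rad; apply: un0.
  exact: (anti_nonradial (turnmx_orth R n k) (turnmx_mpres R n k) uT rad).
have [_ ukT uk0] := Hu k; have [_ ulT ul0] := Hu l.
case: (ltngtP k l) => // kl _ ukl.
  exact: (uk0 (anti_distinct kl ukT ulT ukl)).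
exact: (ul0 (anti_distinct kl ulT ukT (aeq_sym ukl))).
Qed.
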